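(* Let $0<|q|<1$, let $\mathcal{B}$ be a unital Banach algebra and $T,S\in\mathcal{B}$ with $TS=q^{-1}ST$, and let $U=U_x\cup U_y\subseteq\mathbb{C}_{xy}$ be $(\mathfrak{q},\mathfrak{d})$-open. The unital homomorphism $\mathfrak{A}_q\to\mathcal{B}$, $x\mapsto T$, $y\mapsto S$, extends to a continuous algebra homomorphism $\mathcal{O}_q(U)\to\mathcal{B}$ (along the canonical map $\mathfrak{A}_q\to\mathcal{O}_q(U)$ sending $x,y$ to $x,y$) if and only if $\sigma(T)\subseteq U_x$ and $\sigma(S)\subseteq U_y$. In that case the extension is given by $\sum_nf_n(x)y^n\mapsto\sum_nf_n(T)S^n$, with $f_n(T)$ the holomorphic functional calculus.
   Context: $\mathfrak{A}_q=\mathbb{C}\langle x,y\rangle/(xy-q^{-1}yx)$ is the quantum plane. $\sigma(\cdot)$ denotes spectrum in $\mathcal{B}$. $q$-open: standard-open subset of $\mathbb{C}$ containing $0$ and $q^nz$ for each of its points $z$, $n\in\mathbb{Z}_+$. A $(\mathfrak{q},\mathfrak{d})$-open set of $\mathbb{C}_{xy}=(\mathbb{C}\times\{0\})\cup(\{0\}\times\mathbb{C})$ is $U=U_x\cup U_y$ with $U_x$ nonempty $q$-open and $U_y=B(0,r_y)$, $0<r_y\le\infty$. $\mathcal{O}_q(U)$ is the Fréchet algebra of formal series $f=\sum_{n\ge0}f_n(x)y^n$, $f_n\in\mathcal{O}(U_x)$, with $\sum_n\|f_n\|_K\rho^n<\infty$ for all compact $K\subseteq U_x$ and $0<\rho<r_y$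 ($\|g\|_K=\sup_K|g|$), with those seminorms and product $f\cdot g=\sum_n\big(\sum_{i+j=n}f_i(z)g_j(q^iz)\big)y^n$. *)

(* Defs.v *)
From HB Require Import structures.
From mathcomp Require Import all_boot all_order all_algebra.
From mathcomp Require Import all_classical all_reals all_analysis.
From mathcomp Require Export complex.
Import Order.TTheory GRing.Theory Num.Theory numFieldNormedType.Exports.

Set Implicit Arguments.
Unset Strict Implicit.
Unset Printing Implicit Defensive.

Local Open Scope ring_scope.
Local Open Scope classical_set_scope.
Local Open Scope complex_scope.

HB.mixin Record CompleteNormedModule_isBanachAlgebra (K : numFieldType) V
  of CompleteNormedModule K V := {
  bmul : V -> V -> V;
  bone : V;
  bmulA : associative bmul;
  bmul1l : left_id bone bmul;
  bmul1r : right_id bone bmul;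
  bmulDl : left_distributive bmul +%R;
  bmulDr : right_distributive bmul +%R;
  bmulZl : forall (a : K) (x y : V), bmul (a *: x) y = a *: bmul x y;
  bmulZr : forall (a : K) (x y : V), bmul x (a *: y) = a *: bmul x y;
  bnormM : forall x y : V, `|bmul x y| <= `|x| * `|y|;
  bnorm1 : `|bone| = 1
}.

#[short(type="banachAlgType")]
HB.structure Definition BanachAlgebra (K : numFieldType) :=
  { V of CompleteNormedModule_isBanachAlgebra K V & CompleteNormedModule K V }.

Declare Scope banach_scope.
Delimit Scope banach_scope with B.
Notation "x *b y" := (bmul x y) (at level 40, left associativity) : banach_scope.
Notation "\1b" := (bone) : banach_scope.

Definition bexp (K : numFieldType) (B : banachAlgType K) (a : B) (n : nat) : B :=
  iter n (bmul a) bone.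
Notation "x ^b n" := (bexp x n) (at level 29, left associativity) : banach_scope.

Local Open Scope banach_scope.

Section Defs.
Variable R : realType.
Local Notation C := (R[i] : numFieldType).

Definition cabs (z : C) : R := complex.Re `|z|.

Section Banach.
Variable B : banachAlgType C.

Definition invertible (a : B) : Prop :=
  exists b : B, a *b b = \1b /\ b *b a = \1b.

Definition spectrum (a : B) : set C := [set l | ~ invertible (l *: \1b - a)].

Definition binv (a : B) : B := xget 0 [set b | a *b b = \1b /\ b *b a = \1b].
End Banach.

Definition unit_int (V : normedModType C) (g : R -> V) : V :=
  lim ((fun N : nat => (N.+1%:R : C)^-1 *:
          \sum_(k < N.+1) g (k%:R / N.+1%:R)) @ \oo).

Definition poly_edges (p : seq C) : seq (C * C) := zip p (rot 1 p).

(* a cycle is a finite list of closed polygons *)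
Definition cycle_edges (G : seq (seq C)) : seq (C * C) :=
  flatten (map poly_edges G).

Definition seg_pt (e : C * C) (t : R) : C := e.1 + t%:C * (e.2 - e.1).

Definition seg_int (V : normedModType C) (e : C * C) (h : C -> V) : V :=
  (e.2 - e.1) *: unit_int (fun t => h (seg_pt e t)).

Definition cycle_int (V : normedModType C) (G : seq (seq C)) (h : C -> V) : V :=
  \sum_(e <- cycle_edges G) seg_int e h.

Definition cycle_trace (G : seq (seq C)) : set C :=
  [set z | exists e t, e \in cycle_edges G /\ 0 <= t <= 1 /\ z = seg_pt e t].

Definition two_pi_i : C := (2 * pi)%:C * 'i.

Definition winding (G : seq (seq C)) (w : C) : C :=
  two_pi_i^-1 * cycle_int G (fun l => (l - w)^-1).

Definition holomorphic_on (U : set C) (f : C -> C) : Prop :=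
  forall z, U z -> derivable f z 1.

Definition holo_calc_rel (B : banachAlgType C) (U : set C) (a : B)
    (f : C -> C) (v : B) : Prop :=
  exists G : seq (seq C),
    [/\ cycle_trace G `<=` U `\` spectrum a,
        (forall w, spectrum a w -> winding G w = 1),
        (forall w, ~ U w -> winding G w = 0) &
        v = two_pi_i^-1 *: cycle_int G (fun l => f l *: binv (l *: \1b - a))].

Definition holo_calc (B : banachAlgType C) (U : set C) (a : B) (f : C -> C) : B :=
  xget 0 (holo_calc_rel U a f).

Definition q_open (q : C) (Ux : set C) : Prop :=
  [/\ open Ux, Ux 0 & forall z n, Ux z -> Ux (q ^+ n * z)].

(* U_y = B(0, ry), 0 < ry <= +oo *)
Definition disc (ry : \bar R) : set C := [set z | ((cabs z)%:E < ry)%E].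

(* a formal series sum_n f_n(x) y^n is represented by f : nat -> C -> C *)
Definition supnorm (K : set C) (g : C -> C) : \bar R :=
  ereal_sup ([set (cabs (g z))%:E | z in K] `|` [set 0%E]).

Definition qseminorm (K : set C) (rho : R) (f : nat -> C -> C) : \bar R :=
  (\sum_(0 <= n <oo) (supnorm K (f n) * (rho ^+ n)%:E))%E.

Definition seminorm_index (Ux : set C) (ry : \bar R) (K : set C) (rho : R) :=
  [/\ compact K, K `<=` Ux, 0 < rho & (rho%:E < ry)%E].

Definition Oq (Ux : set C) (ry : \bar R) : set (nat -> C -> C) :=
  [set f | (forall n, holomorphic_on Ux (f n)) /\
           forall K rho, seminorm_index Ux ry K rho ->
             (qseminorm K rho f < +oo)%E].

Definition Oq_add (f g : nat -> C -> C) : nat -> C -> C :=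
  fun n z => f n z + g n z.
Definition Oq_scale (c : C) (f : nat -> C -> C) : nat -> C -> C :=
  fun n z => c * f n z.
Definition Oq_mul (q : C) (f g : nat -> C -> C) : nat -> C -> C :=
  fun n z => \sum_(i < n.+1) f i z * g (n - i)%N (q ^+ i * z).
Definition Oq_one : nat -> C -> C := fun n _ => if n == 0%N then 1 else 0.
Definition Oq_x : nat -> C -> C := fun n z => if n == 0%N then z else 0.
Definition Oq_y : nat -> C -> C := fun n _ => if n == 1%N then 1 else 0.

Definition Oq_continuous (B : banachAlgType C) (Ux : set C) (ry : \bar R)
    (Phi : (nat -> C -> C) -> B) : Prop :=
  forall f, Oq Ux ry f -> forall eps : R, 0 < eps ->
    exists m (Ks : 'I_m -> set C) (rhos : 'I_m -> R) (delta : R),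
      [/\ forall i, seminorm_index Ux ry (Ks i) (rhos i), 0 < delta &
          forall g, Oq Ux ry g ->
            (forall i, (qseminorm (Ks i) (rhos i)
                          (fun n z => (g n z - f n z)%R) < delta%:E)%E) ->
            `|Phi g - Phi f| < eps%:C].

(* Phi is a continuous (unital) algebra homomorphism O_q(U) -> B extending
   the homomorphism A_q -> B, x |-> T, y |-> S (along A_q -> O_q(U)). *)
Definition Oq_extension (B : banachAlgType C) (q : C) (Ux : set C)
    (ry : \bar R) (T S : B) (Phi : (nat -> C -> C) -> B) : Prop :=
  [/\ Oq_continuous Ux ry Phi,
      (forall f g, Oq Ux ry f -> Oq Ux ry g ->
         Phi (Oq_add f g) = Phi f + Phi g),
      (forall c f, Oq Ux ry f -> Phi (Oq_scale c f) = c *: Phi f),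
      (forall f g, Oq Ux ry f -> Oq Ux ry g ->
         Phi (Oq_mul q f g) = Phi f *b Phi g) &
      [/\ Phi Oq_one = \1b, Phi Oq_x = T & Phi Oq_y = S]].

End Defs.

(* Main.v *)
(** Cauchy's theorem in its homology form, for functions on open subsets of C
    with values in a Banach space, makes the holomorphic functional calculus
    independent of the cycle.  It also gives a rigidity principle: a bounded
    linear map D from O(U) to B with D ((l - z) g) = (l - A) D g and spectrum A
    inside U is D f = f(A) D 1.  Indeed f is reproduced from the quotients
    (f l - f z) / (l - z), and D sends such a quotient to
    resolvent A l (f(l) D 1 - D f); integrate over a cycle around the spectrum.
    The principle yields the multiplicativity of the calculus, the commutation
    rule S f(T) = f(qT) S, and Phi (f(x)) = f(T) for every extension Phi.

    Necessity: for l outside U_x (resp. U_y) the element l - x (resp. l - y) is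
    invertible in O_q(U), with inverse 1 / (l - x) (resp. the geometric series).
    Sufficiency: a cycle around the spectrum of S in the disc gives
    |S^n| <= c rho^n with rho < r_y, so the series of f_n(T) S^n converges
    absolutely, and the Cauchy product with the commutation rule makes the sum
    multiplicative. *)

Require Import Defs.
From HB Require Import structures.
From mathcomp Require Import all_boot all_order all_algebra.
From mathcomp Require Import all_classical all_reals all_analysis.
From mathcomp Require Import complex.
From mathcomp Require Import ring lra zify.
Import Order.TTheory GRing.Theory Num.Theory numFieldNormedType.Exports.
Local Open Scope ring_scope.
Local Open Scope classical_set_scope.
Local Open Scope complex_scope.
Local Open Scope banach_scope.
Set Implicit Arguments.
Unset Strict Implicit.
Unset Printing Implicit Defensive.


(** * Real-valued norms *)

(** Cycles are arbitrary polygons known only through their winding numbers, so Cauchy's theorem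
    cannot rest on a deformation. Rational approximation takes its place: a cycle made of grid
    squares reproduces a holomorphic function, its Riemann sums approximate that function by simple
    fractions, and the integral of a simple fraction is a winding number.

    The map [D] of the rigidity principle is known on holomorphic functions only and is bounded by
    one sup norm over a compact set, so it cannot be moved under an integral. Riemann sums with
    common nodes replace the integral; their error is uniform on that compact set, hence visible to
    [D].

    A series of O_q(U) is represented by functions on all of the plane, and an extension is a map on
    such representatives. Only its continuity forces it to ignore the values off U_x. Without this,
    [1 / (l - x)] would not be sent to an inverse, because the product with [l - x] equals 1 on U_x
    but not at [l]. *)

Section RealNorm.
Variable R : realType.
Local Notation C := (R[i] : numFieldType).

(** The norm of a complex normed module is itself a complex number. Its real part carries all of it
    and is open to real arithmetic. *)
Definition nr (V : normedZmodType C) (v : V) : R := complex.Re `|v|.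

Lemma normE (V : normedZmodType C) (v : V) : `|v| = (nr v)%:C.
Proof.
have := normr_ge0 v; rewrite /nr; move: (`|v| : R[i]) => [a b].
by rewrite lecE /= => /andP[/eqP -> _].
Qed.

Lemma cabsE (z : C) : cabs z = nr z.
Proof. by []. Qed.

Lemma nr_ge0 (V : normedZmodType C) (v : V) : 0 <= nr v.
Proof. by rewrite -lecR -normE normr_ge0. Qed.

Lemma nr_lt (V : normedZmodType C) (v : V) (e : R) : (nr v < e) = (`|v| < e%:C).
Proof. by rewrite !normE ltcR. Qed.

Lemma nrD (V : normedZmodType C) (v w : V) : nr (v + w) <= nr v + nr w.
Proof. by rewrite -lecR -normE rmorphD /= -!normE ler_normD. Qed.

Lemma nrN (V : normedZmodType C) (v : V) : nr (- v) = nr v.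
Proof. by rewrite /nr normrN. Qed.

Lemma nrBC (V : normedZmodType C) (v w : V) : nr (v - w) = nr (w - v).
Proof. by rewrite -nrN opprB. Qed.

Lemma nrB (V : normedZmodType C) (v w : V) : nr (v - w) <= nr v + nr w.
Proof. by rewrite (le_trans (nrD _ _))// nrN. Qed.

Lemma nr_tri (V : normedZmodType C) (u v w : V) : nr (v - w) <= nr (v - u) + nr (u - w).
Proof. by rewrite (le_trans _ (nrD _ _))// addrA subrK. Qed.

Lemma nr0 (V : normedZmodType C) : nr (0 : V) = 0.
Proof. by rewrite /nr normr0. Qed.

Lemma nr_eq0 (V : normedZmodType C) (v : V) : (nr v == 0) = (v == 0).
Proof. by rewrite -(inj_eq (@complexI R)) -normE normr_eq0. Qed.

Lemma nr_gt0 (V : normedZmodType C) (v : V) : (0 < nr v) = (v != 0).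
Proof. by rewrite lt_def nr_ge0 andbT nr_eq0. Qed.

Lemma nr_real (x : R) : nr (x%:C : C) = `|x|.
Proof. by rewrite /nr normc_def /= expr0n /= addr0 sqrtr_sqr. Qed.

Lemma nrM (a b : C) : nr (a * b) = nr a * nr b.
Proof. by apply: complexI; rewrite rmorphM /= -!normE normrM. Qed.

Lemma nr1 : nr (1 : C) = 1.
Proof. by rewrite /nr normr1. Qed.

Lemma nrX (a : C) n : nr (a ^+ n) = nr a ^+ n.
Proof. by elim: n => [|n IH]; rewrite ?expr0 ?nr1// !exprS nrM IH. Qed.

Lemma nrV (a : C) : nr a^-1 = (nr a)^-1.
Proof. by apply: complexI; rewrite fmorphV /= -!normE normfV. Qed.

Lemma nrZ (V : normedModType C) (a : C) (v : V) : nr (a *: v) = nr a * nr v.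
Proof. by apply: complexI; rewrite rmorphM /= -!normE normrZ. Qed.

Lemma nr_nat n : nr (n%:R : C) = n%:R.
Proof. by rewrite -[_%:R in LHS](rmorph_nat (@real_complex R)) nr_real ger0_norm. Qed.

Lemma nr_natV n : nr (n%:R^-1 : C) = n%:R^-1.
Proof. by rewrite nrV nr_nat. Qed.

Lemma nr_sum (V : normedZmodType C) I (s : seq I) (P : pred I) (F : I -> V) :
  nr (\sum_(i <- s | P i) F i) <= \sum_(i <- s | P i) nr (F i).
Proof.
elim/big_ind2: _ => [|x1 x2 y1 y2 h1 h2|i _]//; first by rewrite nr0.
exact: le_trans (nrD _ _) (lerD h1 h2).
Qed.

Lemma nr_lower (V : normedZmodType C) (v w : V) : nr v - nr w <= nr (v - w).
Proof. by rewrite lerBlDr (le_trans _ (nrD _ _))// subrK. Qed.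

Lemma nr_small0 (V : normedZmodType C) (v : V) : (forall e : R, 0 < e -> nr v <= e) -> v = 0.
Proof.
move=> h; apply/eqP; rewrite -nr_eq0 eq_le nr_ge0 andbT.
by apply/ler_addgt0Pr => e e0; rewrite add0r h.
Qed.

Lemma nr_small_eq (V : normedZmodType C) (v w : V) :
  (forall e : R, 0 < e -> nr (v - w) <= e) -> v = w.
Proof. by move=> h; apply/eqP; rewrite -subr_eq0; apply/eqP/nr_small0. Qed.

Lemma nr_Re (z : C) : `|complex.Re z| <= nr z.
Proof. by rewrite -lecR -normE normc_ge_Re. Qed.

Lemma nr_Im (z : C) : `|complex.Im z| <= nr z.
Proof.
rewrite /nr normc_def /= -sqrtr_sqr ler_wsqrtr//.
by rewrite lerDr sqr_ge0.
Qed.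

Lemma nr_i : nr ('i : C) = 1.
Proof. by rewrite /nr normc_def /= expr0n /= add0r expr1n sqrtr1. Qed.

Lemma nr_ReIm (z : C) : nr z <= `|complex.Re z| + `|complex.Im z|.
Proof.
rewrite /nr normc_def /= -[leRHS]ger0_norm ?addr_ge0// -sqrtr_sqr ler_wsqrtr//.
rewrite sqrrD !real_normK ?num_real// -addrA lerD2l lerDr.
by rewrite mulrn_wge0// mulr_ge0.
Qed.

(** A positive element of [C] has zero imaginary part, so real radii suffice. *)
Lemma cvg_nrP (V : normedModType C) (u : nat -> V) (l : V) :
  u @ \oo --> l <->
  forall e : R, 0 < e -> exists N, forall n, (N <= n)%N -> nr (u n - l) < e.
Proof.
split=> [/cvgrPdist_lt h e e0|h].
  have /h[N _ hN] : (0 : C) < e%:C by rewrite ltcR.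
  by exists N => n Nn; rewrite nr_lt distrC; apply: hN.
apply/cvgrPdist_lt => e; case: e => a b /=; rewrite ltcE /= => /andP[/eqP -> a0].
have [N hN] := h _ a0; exists N => // n /= Nn; rewrite distrC.
by have := hN _ Nn; rewrite nr_lt.
Qed.

Definition nr_cauchy (V : normedModType C) (u : nat -> V) :=
  forall e : R, 0 < e -> exists N, forall m n, (N <= m)%N -> (N <= n)%N -> nr (u m - u n) < e.

(** A predicate instead of a structure, so that every integral below serves both [C] and Banach
    algebras. *)
Definition nr_complete (V : normedModType C) :=
  forall u : nat -> V, nr_cauchy u -> cvg (u @ \oo).

Lemma completeNormedModule_nr_complete (V : completeNormedModType C) : nr_complete V.
Proof.
move=> u hu; apply: cauchy_cvg; apply/cauchyP => e.
case: e => a b; rewrite ltcE /= => /andP[/eqP -> a0].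
have [N hN] := hu _ a0; exists (u N).
exists N => // n /= Nn; rewrite -ball_normE /= -[_ +i* _]/(a%:C) -nr_lt.
exact: hN.
Qed.

Lemma complex_nr_complete : nr_complete C.
Proof.
move=> u hu.
have cauchy_real (v : nat -> R) : (forall m n, `|v m - v n| <= nr (u m - u n)) -> cvg (v @ \oo).
  move=> hv; apply: cauchy_cvg; apply/cauchyP => e e0.
  have [N hN] := hu _ e0; exists (v N).
  exists N => // n /= Nn; rewrite -ball_normE /=.
  exact: le_lt_trans (hv _ _) (hN _ _ _ _).
have h1 : cvg ((fun n => complex.Re (u n)) @ \oo).
  by apply: cauchy_real => m n; rewrite -raddfB nr_Re.
have h2 : cvg ((fun n => complex.Im (u n)) @ \oo).
  by apply: cauchy_real => m n; rewrite -raddfB nr_Im.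
apply/cvg_ex; exists ((lim ((fun n => complex.Re (u n)) @ \oo) +i* lim ((fun n => complex.Im (u n)) @ \oo)) : C).
apply/cvg_nrP => e e0.
have e2 : 0 < e / 2 by rewrite divr_gt0.
move/cvgrPdist_lt/(_ _ e2) : h1 => [N1 _ h1].
move/cvgrPdist_lt/(_ _ e2) : h2 => [N2 _ h2].
exists (maxn N1 N2) => n; rewrite geq_max => /andP[n1 n2].
apply: le_lt_trans (nr_ReIm _) _.
rewrite !raddfB /= [ltRHS]splitr ltrD// distrC; [exact: h1|exact: h2].
Qed.

End RealNorm.
Opaque nr.

(** * A reflexive decision procedure for abelian groups *)

Section ZmodReflection.
Variable V : zmodType.

Inductive zexpr := ZAtom of nat | ZZero | ZAdd of zexpr & zexpr | ZOpp of zexpr.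

Fixpoint zeval (env : seq V) e : V :=
  match e with
  | ZAtom n => nth 0 env n
  | ZZero => 0
  | ZAdd a b => zeval env a + zeval env b
  | ZOpp a => - zeval env a
  end.

Fixpoint zcoef e (i : nat) : int :=
  match e with
  | ZAtom n => if n == i then 1 else 0
  | ZZero => 0
  | ZAdd a b => zcoef a i + zcoef b i
  | ZOpp a => - zcoef a i
  end.

Lemma zevalE env e : zeval env e = \sum_(i < size env) nth 0 env i *~ zcoef e i.
Proof.
elim: e => [n||a IHa b IHb|a IHa] /=.
- have [ln|ln] := ltnP n (size env); last first.
    rewrite nth_default// big1// => i _; rewrite gtn_eqF// ?mulr0z//.
    exact: leq_trans (ltn_ord i) ln.
  rewrite (bigD1 (Ordinal ln))//= eqxx mulr1z big1 ?addr0// => i ni.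
  rewrite ifF ?mulr0z//; apply/negbTE; apply: contra ni => /eqP ni.
  by apply/eqP/val_inj.
- by rewrite big1// => i _; rewrite mulr0z.
- by rewrite IHa IHb -big_split /=; apply: eq_bigr => i _; rewrite mulrzDr.
- by rewrite IHa -sumrN; apply: eq_bigr => i _; rewrite mulrNz.
Qed.

(** An additive expression is determined by the integer coefficients of its atoms, and these are
    compared by computation. *)
Lemma zreflect env e f :
  all (fun i => zcoef e i == zcoef f i) (iota 0 (size env)) -> zeval env e = zeval env f.
Proof.
move=> /allP h; rewrite !zevalE; apply: eq_bigr => i _; congr (_ *~ _).
by apply/eqP/h; rewrite mem_iota add0n ltn_ord.
Qed.
End ZmodReflection.

Ltac zmod_index_syn x env :=
  match env with
  | x :: _ => constr:(0%N)
  | _ :: ?t => let n := zmod_index_syn x t in constr:(S n)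
  end.
(* Atoms are compared up to conversion when no syntactic match is found: the
   same term often carries different inferred structures. *)
Ltac zmod_index_conv x env :=
  match env with
  | ?y :: _ =>
    let _ := match constr:(Set) with _ => unify x y end in constr:(0%N)
  | _ :: ?t => let n := zmod_index_conv x t in constr:(S n)
  end.
Ltac zmod_index x env :=
  match env with
  | _ => zmod_index_syn x env
  | _ => zmod_index_conv x env
  end.
Ltac zmod_atoms t env :=
  match t with
  | (?a + ?b)%R => let e1 := zmod_atoms a env in zmod_atoms b e1
  | (- ?a)%R => zmod_atoms a env
  | 0%R => env
  | _ => match env with
         | _ => let n := zmod_index t env in env
         | _ => constr:(cons t env)
         end
  end.
Ltac zmod_reify t env :=
  match t with
  | (?a + ?b)%R => let e1 := zmod_reify a env in let e2 := zmod_reify b env in constr:(ZAdd e1 e2)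
  | (- ?a)%R => let e := zmod_reify a env in constr:(ZOpp e)
  | 0%R => constr:(ZZero)
  | _ => let n := zmod_index t env in constr:(ZAtom n)
  end.
Ltac zmod :=
  match goal with
  | |- @eq ?T ?u ?v =>
    let env0 := constr:(@nil T) in
    let env1 := zmod_atoms u env0 in
    let env := zmod_atoms v env1 in
    let e := zmod_reify u env in
    let f := zmod_reify v env in
    refine (@zreflect _ env e f _); vm_compute; reflexivity
  end.
(** * Integration over the unit interval *)

Section UnitIntegral.
Variable R : realType.
Local Notation C := (R[i] : numFieldType).

Definition riem (V : normedModType C) (n : nat) (g : R -> V) : V :=
  (n%:R : C)^-1 *: \sum_(k < n) g (k%:R / n%:R).

(** A mesh [1 / n] on which [g] oscillates by at most [w]. Uniform continuity is kept in this form
    because [n] then serves directly as the number of sample points. *)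
Definition modulus01 (V : normedModType C) (g : R -> V) (n : nat) (w : R) :=
  forall s t : R, 0 <= s <= 1 -> 0 <= t <= 1 -> `|s - t| <= n%:R^-1 -> nr (g s - g t) <= w.

Definition ucont01 (V : normedModType C) (g : R -> V) :=
  forall e : R, 0 < e -> exists2 n, (0 < n)%N & modulus01 g n e.

Lemma sum_mul_ord (V : nmodType) (F : nat -> V) n m :
  \sum_(k < n * m) F k = \sum_(i < n) \sum_(j < m) F (i * m + j)%N.
Proof.
elim: n => [|n IH]; first by rewrite mul0n !big_ord0.
by rewrite big_ord_recr /= -IH mulSnr big_split_ord.
Qed.

Lemma ord_div01 n (k : 'I_n) : 0 <= (k%:R / n%:R : R) <= 1.
Proof.
have n0 : (0 < n)%N by case: n k => // -[].
by rewrite divr_ge0//= ler_pdivrMr ?ltr0n// mul1r ler_nat ltnW.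
Qed.

Lemma natC0 n : (0 < n)%N -> (n%:R : C) != 0.
Proof. by rewrite lt0n pnatr_eq0. Qed.

Lemma natR0 n : (0 < n)%N -> (n%:R : R) != 0.
Proof. by rewrite lt0n pnatr_eq0. Qed.

Lemma avg_cst (V : normedModType C) n (v : V) : (0 < n)%N ->
  (n%:R : C)^-1 *: \sum_(k < n) v = v.
Proof.
move=> n0; rewrite sumr_const card_ord -[X in _ *: X]scaler_nat scalerA.
by rewrite mulVf ?scale1r ?natC0.
Qed.

Lemma nr_avg (V : normedModType C) n (F : 'I_n -> V) (M : R) : (0 < n)%N ->
  (forall k, nr (F k) <= M) -> nr ((n%:R : C)^-1 *: \sum_(k < n) F k) <= M.
Proof.
move=> n0 h; rewrite nrZ nr_natV mulrC ler_pdivrMr ?ltr0n//.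
apply: (le_trans (nr_sum _ _ _)).
apply: (@le_trans _ _ (\sum_(k < n) M)); first exact: ler_sum.
by rewrite sumr_const card_ord mulr_natr.
Qed.

(** Each coarse sample is compared with the average of the [m] fine samples of its own cell, all
    within [1 / n] of it. Passing through [n * m] points compares any two sums. *)
Lemma riem_refine (V : normedModType C) (g : R -> V) n m w : (0 < n)%N -> (0 < m)%N ->
  modulus01 g n w -> nr (riem n g - riem (n * m) g) <= w.
Proof.
move=> n0 m0 h.
have -> : riem (n * m) g = (n%:R : C)^-1 *: \sum_(i < n)
    ((m%:R : C)^-1 *: \sum_(j < m) g ((i * m + j)%:R / (n * m)%:R)).
  rewrite /riem (@sum_mul_ord _ (fun k => g (k%:R / (n * m)%:R))).
  by rewrite -scaler_sumr scalerA natrM invfM.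
rewrite /riem -scalerBr -sumrB.
apply: nr_avg => // i.
have -> : g (i%:R / n%:R) = (m%:R : C)^-1 *: \sum_(j < m) g (i%:R / n%:R).
  by rewrite avg_cst.
rewrite -scalerBr -sumrB; apply: nr_avg => // j.
have n0' := natR0 n0; have m0' := natR0 m0.
apply: h; first exact: ord_div01.
  have lt : (i * m + j < n * m)%N.
    by rewrite -ltn_subRL (leq_trans (ltn_ord j))// -mulnBl leq_pmull// subn_gt0.
  by have := ord_div01 (Ordinal lt).
have -> : i%:R / n%:R - (i * m + j)%:R / (n * m)%:R = - (j%:R / m%:R / n%:R) :> R.
  by rewrite natrD !natrM; field; rewrite n0' m0'.
have /andP[j0 j1] := ord_div01 j.
rewrite normrN ger0_norm ?divr_ge0//.
by rewrite ler_pdivrMr ?ltr0n// mulVf.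
Qed.

Lemma modulus01_le (V : normedModType C) (g : R -> V) n m w : (0 < n)%N -> (n <= m)%N ->
  modulus01 g n w -> modulus01 g m w.
Proof.
move=> n0 nm h s t hs ht hst; apply: h => //; apply: (le_trans hst).
by rewrite lef_pV2 ?posrE ?ltr0n ?ler_nat// (leq_trans n0).
Qed.

Lemma unit_intE (V : normedModType C) (g : R -> V) :
  unit_int g = lim ((fun N => riem N.+1 g) @ \oo).
Proof. by []. Qed.

Lemma riem_cauchy (V : normedModType C) (g : R -> V) :
  ucont01 g -> nr_cauchy (fun N => riem N.+1 g).
Proof.
move=> hg e e0; have e4 : 0 < e / 4 by rewrite divr_gt0.
have [n n0 hn] := hg _ e4.
exists n => p q np nq.
have hp := modulus01_le n0 (leqW np) hn.
have hq := modulus01_le n0 (leqW nq) hn.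
apply: le_lt_trans (nr_tri (riem (p.+1 * q.+1) g) _ _) _.
have h1 := riem_refine (ltn0Sn p) (ltn0Sn q) hp.
have h2 := riem_refine (ltn0Sn q) (ltn0Sn p) hq.
rewrite nrBC mulnC in h2; lra.
Qed.

Section Complete.
Variable V : normedModType C.
Hypothesis hV : nr_complete V.

Lemma unit_int_cvg (g : R -> V) : ucont01 g -> (fun N => riem N.+1 g) @ \oo --> unit_int g.
Proof. by move=> /riem_cauchy/hV. Qed.

Lemma unit_int_err (g : R -> V) n w : ucont01 g -> (0 < n)%N -> modulus01 g n w ->
  nr (riem n g - unit_int g) <= w.
Proof.
move=> hg n0 hn; apply/ler_addgt0Pr => e e0.
have /cvg_nrP/(_ _ e0)[N hN] := unit_int_cvg hg.
have := hN (n * N.+1).-1; rewrite prednK ?muln_gt0 ?n0//.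
move=> /(_ _) hN'; apply: le_trans (nr_tri (riem (n * N.+1) g) _ _) _.
apply: lerD; first exact: riem_refine.
apply/ltW/hN'; rewrite -ltnS prednK ?muln_gt0 ?n0//.
by rewrite leq_pmull.
Qed.

Lemma unit_int_bound (g : R -> V) M : ucont01 g -> (forall t, 0 <= t <= 1 -> nr (g t) <= M) ->
  nr (unit_int g) <= M.
Proof.
move=> hg hM; apply/ler_addgt0Pr => e e0; have [n n0 hn] := hg _ e0.
have := unit_int_err hg n0 hn.
have : nr (riem n g) <= M by apply: nr_avg => // k; apply: hM; exact: ord_div01.
have := nr_lower (unit_int g) (riem n g); rewrite nrBC; lra.
Qed.

(** Left sums with [2 * n] points split exactly into two sums with [n] points, so that no cell is
    cut. Halving is the only subdivision made below. *)
Lemma unit_int_half (g : R -> V) : ucont01 g ->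
  unit_int g = 2^-1 *: (unit_int (fun t => g (t / 2)) + unit_int (fun t => g ((1 + t) / 2))).
Proof.
move=> hg; apply: nr_small_eq => e e0.
have e3 : 0 < e / 3 by rewrite divr_gt0.
have half (a : R) : 0 <= a <= 1 -> ucont01 (fun t => g ((a + t) / 2)) /\
    forall n w, (0 < n)%N -> modulus01 g n w -> modulus01 (fun t => g ((a + t) / 2)) n w.
  move=> a01.
  have hm n w : (0 < n)%N -> modulus01 g n w -> modulus01 (fun t => g ((a + t) / 2)) n w.
    move=> n0 hn s t hs ht hst; apply: hn; [lra|lra|].
    have -> : (a + s) / 2 - (a + t) / 2 = (s - t) / 2 by field.
    rewrite normrM (ger0_norm (_ : 0 <= 2^-1 :> R))//; have := normr_ge0 (s - t); lra.
  by split=> // d d0; have [n n0 hn] := hg _ d0; exists n => //; exact: hm.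
have [|h1 m1] := half 0; first by rewrite lexx ler01.
have [|h2 m2] := half 1; first by rewrite lexx ler01.
have e2 : 0 < e / 2 by rewrite divr_gt0.
have [n n0 hn] := hg _ e2.
have n20 : (0 < 2 * n)%N by rewrite muln_gt0.
have E1 := unit_int_err hg n20 (modulus01_le n0 (leq_pmull _ _) hn).
have E2 := unit_int_err h1 n0 (m1 _ _ n0 hn).
have E3 := unit_int_err h2 n0 (m2 _ _ n0 hn).
have e01 : (fun t => g ((0 + t) / 2)) = (fun t => g (t / 2)) by apply/funext => t; rewrite add0r.
rewrite e01 in E2.
have eq : riem (2 * n) g = 2^-1 *: (riem n (fun t => g (t / 2)) + riem n (fun t => g ((1 + t) / 2))).
  rewrite /riem -scalerDr scalerA natrM invfM; congr (_ *: _).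
  rewrite (@sum_mul_ord _ (fun k => g (k%:R / (2 * n)%:R))) big_ord_recr big_ord1 /=.
  have n0' := natR0 n0.
  congr (_ + _); apply: eq_bigr => i _; congr g; rewrite [(2 * n)%:R]natrM.
    by rewrite mul0n add0n; field.
  by rewrite mul1n natrD; field.
apply: le_trans (nr_tri (riem (2 * n) g) _ _) _; rewrite [leRHS]splitr; apply: lerD.
  by rewrite nrBC; exact: E1.
rewrite {1}eq -scalerBr opprD addrACA nrZ nr_natV.
by have := nrD (riem n (fun t => g (t / 2)) - unit_int (fun t => g (t / 2)))
  (riem n (fun t => g ((1 + t) / 2)) - unit_int (fun t => g ((1 + t) / 2))); lra.
Qed.

Lemma unit_int_lim (g : R -> V) l : (fun N => riem N.+1 g) @ \oo --> l -> unit_int g = l.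
Proof. by move=> h; apply: cvg_lim. Qed.

Lemma unit_intD (f g : R -> V) : ucont01 f -> ucont01 g ->
  unit_int (fun t => f t + g t) = unit_int f + unit_int g.
Proof.
move=> hf hg; apply: unit_int_lim.
rewrite (_ : (fun N => _) = (fun N => riem N.+1 f) \+ (fun N => riem N.+1 g)).
  by apply: cvgD; exact: unit_int_cvg.
by apply/funext => N; rewrite /riem /= big_split /= scalerDr.
Qed.

Lemma ucont01D (f g : R -> V) : ucont01 f -> ucont01 g -> ucont01 (fun t => f t + g t).
Proof.
move=> hf hg e e0; have e2 : 0 < e / 2 by rewrite divr_gt0.
have [n n0 hn] := hf _ e2; have [m m0 hm] := hg _ e2.
exists (maxn n m); first by rewrite leq_max n0.
move=> s t hs ht hst; rewrite opprD addrACA.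
have h1 := modulus01_le n0 (leq_maxl n m) hn hs ht hst.
have h2 := modulus01_le m0 (leq_maxr n m) hm hs ht hst.
by have := nrD (f s - f t) (g s - g t); lra.
Qed.

End Complete.

Lemma ucont01_cst (V : normedModType C) (v : V) : ucont01 (fun=> v).
Proof. by move=> e e0; exists 1%N => // s t _ _ _; rewrite subrr nr0 ltW. Qed.

Lemma unit_int_cst (V : normedModType C) (v : V) : unit_int (fun=> v) = v.
Proof.
apply: unit_int_lim; rewrite (_ : (fun N => _) = fun=> v); first exact: cvg_cst.
by apply/funext => N; rewrite /riem avg_cst.
Qed.

Definition bounded_linear (V W : normedModType C) (L : V -> W) :=
  [/\ (forall u v, L (u + v) = L u + L v), (forall a v, L (a *: v) = a *: L v) &
      exists2 c : R, 0 <= c & forall v, nr (L v) <= c * nr v].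

Lemma bounded_linear_sum (V W : normedModType C) (L : V -> W) : bounded_linear L ->
  forall I (s : seq I) (P : pred I) F, L (\sum_(i <- s | P i) F i) = \sum_(i <- s | P i) L (F i).
Proof.
move=> [LD LZ _] I s P F; apply: (big_morph L) => //.
by rewrite -(scale0r (0 : V)) LZ scale0r.
Qed.

Lemma bounded_linearB (V W : normedModType C) (L : V -> W) : bounded_linear L ->
  forall u v, L (u - v) = L u - L v.
Proof. by move=> [LD LZ _] u v; rewrite LD -scaleN1r LZ scaleN1r. Qed.

Lemma ucont01_linear (V W : normedModType C) (L : V -> W) (g : R -> V) : bounded_linear L ->
  ucont01 g -> ucont01 (fun t => L (g t)).
Proof.
move=> hL; have [_ _ [c c0 hc]] := hL; move=> hg e e0.
have d0 : 0 < e / (c + 1) by rewrite divr_gt0// ltr_wpDl.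
have [n n0 hn] := hg _ d0; exists n => // s t hs ht hst.
rewrite -bounded_linearB//; apply: (le_trans (hc _)).
have := hn _ _ hs ht hst; rewrite ler_pdivlMr ?ltr_wpDl//; apply: le_trans.
by rewrite mulrC ler_wpM2l ?nr_ge0// lerDl.
Qed.

Lemma riem_linear (V W : normedModType C) (L : V -> W) (g : R -> V) n : bounded_linear L ->
  riem n (fun t => L (g t)) = L (riem n g).
Proof.
by move=> hL; have [_ LZ _] := hL; rewrite /riem LZ; congr (_ *: _); rewrite bounded_linear_sum.
Qed.

Lemma unit_int_linear (V W : normedModType C) (L : V -> W) (g : R -> V) : nr_complete V ->
  bounded_linear L -> ucont01 g -> unit_int (fun t => L (g t)) = L (unit_int g).
Proof.
move=> hV hL hg; have [_ _ [c c0 hc]] := hL; apply: unit_int_lim; apply/cvg_nrP => e e0.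
have d0 : 0 < e / (c + 1) by rewrite divr_gt0// ltr_wpDl.
have /cvg_nrP/(_ _ d0)[N hN] := unit_int_cvg hV hg; exists N => n /hN.
rewrite riem_linear// -bounded_linearB// ltr_pdivlMr ?ltr_wpDl//; apply: le_lt_trans.
by apply: (le_trans (hc _)); rewrite mulrC ler_wpM2l ?nr_ge0// lerDl.
Qed.

(** Reversal turns a left sum into a right sum, and the two differ only in the end samples. *)
Lemma riem_reverse (V : normedModType C) (g : R -> V) n : (0 < n)%N ->
  riem n (fun t => g (1 - t)) - riem n g = (n%:R : C)^-1 *: (g 1 - g 0).
Proof.
move=> n0; rewrite /riem -scalerBr; congr (_ *: _).
case: n n0 => // n _.
rewrite [X in X - _]big_ord_recl [X in _ - X]big_ord_recl /= mul0r subr0.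
rewrite opprD addrACA -[RHS]addr0; congr (_ + _); apply/eqP; rewrite subr_eq0; apply/eqP.
rewrite [LHS](reindex_inj rev_ord_inj) /=; apply: eq_bigr => i _; congr g.
rewrite /bump /= !add1n -subSn// subSS natrB ?leqW// ?(ltnW (ltn_ord i))//.
  have /natR0 : (0 < n.+1)%N by []. 
  by rewrite -natr1 => ?; field.
Qed.

Lemma unit_int_reverse (V : normedModType C) (g : R -> V) :
  unit_int (fun t => g (1 - t)) = unit_int g.
Proof.
have small (f : R -> V) (l : V) : (fun N => riem N.+1 f) @ \oo --> l ->
    (fun N => riem N.+1 (fun t => f (1 - t))) @ \oo --> l.
  move=> /cvg_nrP hf; apply/cvg_nrP => e e0.
  have e2 : 0 < e / 2 by rewrite divr_gt0.
  have [N hN] := hf _ e2.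
  have [M hM] : exists M : nat, 2 * nr (f 1 - f 0) / e < M%:R.
    by exists (Num.bound (2 * nr (f 1 - f 0) / e)); rewrite archi_boundP// divr_ge0 ?mulr_ge0 ?nr_ge0 ?ltW.
  exists (maxn N M) => n; rewrite geq_max => /andP[Nn Mn].
  apply: le_lt_trans (nr_tri (riem n.+1 f) _ _) _; rewrite [ltRHS]splitr; apply: ltrD; last exact: hN.
  rewrite riem_reverse// nrZ nr_natV mulrC ltr_pdivrMr ?ltr0n//.
  rewrite ltr_pdivrMr// in hM.
  have : (M%:R : R) <= n.+1%:R by rewrite ler_nat leqW.
  by move=> /(ler_wpM2r (ltW e0)); lra.
(* [g] is arbitrary: if the sums of one side diverge, so do those of the other, and both limits are
   then the same default value. *)
have [hc|hc] := pselect (cvgn (fun N => riem N.+1 g)).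
  by apply: unit_int_lim; apply: small.
rewrite unit_intE dvgP; last first.
  move=> hc'; apply: hc; move/small : hc'.
  rewrite (_ : (fun t => g (1 - (1 - t))) = g); first by move/cvgP.
  by apply/funext => t; rewrite opprB addrC subrK.
by rewrite unit_intE dvgP.
Qed.

End UnitIntegral.

(** * Nested bisection *)

Section Bisection.
Variable R : realType.
Local Notation C := (R[i] : numFieldType).

Lemma exp2_small (L e : R) : 0 < e -> exists n, L / 2 ^+ n < e.
Proof.
move=> e0; exists (Num.bound (`|L| / e)).
have h : `|L| / e < 2 ^+ Num.bound (`|L| / e).
  apply: (lt_trans (archi_boundP _)); first by rewrite divr_ge0// ltW.
  by rewrite -natrX ltr_nat ltn_expl.
rewrite ltr_pdivrMr ?exprn_gt0//; rewrite ltr_pdivrMr// in h.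
by rewrite mulrC; apply: le_lt_trans h; exact: ler_norm.
Qed.

(** One nested-set argument for intervals and for triangles: [L] is a size that halves and [pt] a
    marked point that moves by at most the current size. The marked points converge, and the
    geometric tail accounts for the factor 2. *)
Lemma bisection (X : Type) (pt : X -> C) (L : X -> R) (Bad : X -> Prop) (x0 : X) :
  (forall x, Bad x -> exists y, [/\ Bad y, L y = L x / 2 & nr (pt y - pt x) <= L x]) ->
  Bad x0 ->
  exists (x : nat -> X) (p : C), [/\ forall n, Bad (x n), forall n, L (x n) = L x0 / 2 ^+ n &
     forall n, nr (pt (x n) - p) <= 2 * (L x0 / 2 ^+ n)].
Proof.
move=> step bad0.
have /choice[f hf] : forall x, exists y, Bad x ->
    [/\ Bad y, L y = L x / 2 & nr (pt y - pt x) <= L x].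
  move=> x; have [bx|nbx] := pselect (Bad x); last by exists x.
  by have [y hy] := step _ bx; exists y.
pose x n := iter n f x0.
have badx n : Bad (x n) by elim: n => //= n /hf[].
have Lx n : L (x n) = L x0 / 2 ^+ n.
  elim: n => [|n IH]; first by rewrite expr0 divr1.
  by rewrite /x /=; have [_ -> _] := hf _ (badx n); rewrite IH exprS invfM mulrA mulrAC.
have L0 : 0 <= L x0.
  by have [_ _] := hf _ bad0; apply: le_trans; exact: nr_ge0.
have dist n k : nr (pt (x (n + k)%N) - pt (x n)) <= 2 * (L x0 / 2 ^+ n) - 2 * (L x0 / 2 ^+ (n + k)).
  elim: k => [|k IH]; first by rewrite addn0 !subrr nr0.
  apply: le_trans (nr_tri (pt (x (n + k)%N)) _ _) _.
  have [_ _] := hf _ (badx (n + k)%N); rewrite Lx addnS /x /= -/(x (n + k)%N) => h.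
  have -> : L x0 / 2 ^+ (n + k).+1 = L x0 / 2 ^+ (n + k) / 2 by rewrite exprSr invfM mulrA.
  by rewrite /x in IH h; lra.
have pos n : 0 <= 2 * (L x0 / 2 ^+ n) by rewrite mulr_ge0// divr_ge0// exprn_ge0.
have hc : nr_cauchy (fun n => pt (x n)).
  move=> e e0; have [N hN] := exp2_small (4 * L x0) e0; exists N => m n Nm Nn.
  apply: le_lt_trans (nr_tri (pt (x N)) _ _) _; rewrite -(subnKC Nm) -(subnKC Nn) [X in _ + X]nrBC.
  have := dist N (m - N)%N; have := dist N (n - N)%N.
  have := pos (N + (m - N))%N; have := pos (N + (n - N))%N.
  rewrite -mulrA in hN; lra.
have /cvg_nrP hp := @complex_nr_complete R _ hc.
exists x, (lim ((fun n => pt (x n)) @ \oo)); split=> // n.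
apply/ler_addgt0Pr => e e0; have [N hN] := hp _ e0.
apply: le_trans (nr_tri (pt (x (n + N)%N)) _ _) _; apply: lerD; last first.
  by apply/ltW/hN; rewrite leq_addl.
by rewrite nrBC; apply: (le_trans (dist n N)); rewrite gerBl.
Qed.
End Bisection.

(** * The fundamental theorem on the unit interval *)

Section FTC.
Variable R : realType.
Local Notation C := (R[i] : numFieldType).
Variable V : normedModType C.
Hypothesis hV : nr_complete V.

Lemma unit_int_near (g : R -> V) (v : V) (w : R) : ucont01 g ->
  (forall t, 0 <= t <= 1 -> nr (g t - v) <= w) -> nr (unit_int g - v) <= w.
Proof.
move=> hg hw; rewrite -[X in _ - X]unit_int_cst.
have -> : unit_int g - unit_int (fun=> v) = unit_int (fun t => g t - v).
  by rewrite unit_intD ?unit_int_cst //; exact: ucont01_cst.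
apply: unit_int_bound => //; apply: ucont01D => //; exact: ucont01_cst.
Qed.

Lemma ucont01_affine (g : R -> V) a b : 0 <= a <= 1 -> 0 <= b <= 1 -> ucont01 g ->
  ucont01 (fun t => g (a + t * (b - a))).
Proof.
move=> a01 b01 hg e e0; have [n n0 hn] := hg _ e0; exists n => // s t hs ht hst.
apply: hn; [nra|nra|].
have -> : a + s * (b - a) - (a + t * (b - a)) = (s - t) * (b - a) by ring.
rewrite normrM; apply: le_trans hst; rewrite ler_piMr//.
by rewrite ler_norml; apply/andP; split; lra.
Qed.

(* Bisection: a defect larger than e times the length would survive on nested
   intervals and contradict the derivative at their common point. *)
Lemma unit_int_ftc (P g : R -> V) : ucont01 g ->
  (forall t : R, 0 <= t <= 1 -> forall e : R, 0 < e -> exists2 d : R, 0 < d & forall s : R,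
     0 <= s <= 1 -> `|s - t| < d -> nr (P s - P t - (s - t)%:C *: g t) <= e * `|s - t|) ->
  unit_int g = P 1 - P 0.
Proof.
move=> hg hP.
pose D a b := P b - P a - (b - a)%:C *: unit_int (fun t => g (a + t * (b - a))).
suff : D 0 1 = 0.
  rewrite /D subr0 scale1r => /eqP; rewrite subr_eq0 => /eqP ->; congr unit_int.
  by apply/funext => t; rewrite mulr1 add0r.
apply: nr_small0 => e e0.
have [//|Dbad] := leP (nr (D 0 1)) e.
pose Bad (x : R * R) := [/\ 0 <= x.1, x.1 <= x.2, x.2 <= 1 & nr (D x.1 x.2) > e * (x.2 - x.1)].
have step x : Bad x -> exists y, [/\ Bad y, y.2 - y.1 = (x.2 - x.1) / 2 &
    nr (y.1%:C - x.1%:C : C) <= x.2 - x.1].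
  case: x => a b [/= a0 ab b1 bad]; pose m := (a + b) / 2.
  have Dm : D a b = D a m + D m b.
    rewrite /D [X in _ - _ *: X]unit_int_half //; last by apply: ucont01_affine => //; lra.
    have -> : (fun t => g (a + t / 2 * (b - a))) = (fun t => g (a + t * (m - a))).
      by apply/funext => t; congr g; rewrite /m; field.
    have -> : (fun t => g (a + (1 + t) / 2 * (b - a))) = (fun t => g (m + t * (b - m))).
      by apply/funext => t; congr g; rewrite /m; field.
    have -> : (m - a)%:C = (b - a)%:C * 2^-1 :> C.
      have -> : m - a = (b - a) / 2 by rewrite /m; field.
      by rewrite rmorphM fmorphV /= rmorph_nat.
    have -> : (b - m)%:C = (b - a)%:C * 2^-1 :> C.
      have -> : b - m = (b - a) / 2 by rewrite /m; field.
      by rewrite rmorphM fmorphV /= rmorph_nat.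
    by rewrite scalerA scalerDr; zmod.
  have [bm|bm] := leP (nr (D a m)) (e * (m - a)).
    exists (m, b); split=> /=; first 2 last.
    - by rewrite -rmorphB nr_real ger0_norm /m; lra.
    - split=> /=; [rewrite /m; lra|rewrite /m; lra|lra|].
      have eq : e * (b - a) = e * (b - m) + e * (m - a) by ring.
      by have := nrD (D a m) (D m b); rewrite -Dm; lra.
    - by rewrite /m; lra.
  exists (a, m); split=> /=; first 2 last.
  - by rewrite subrr nr0; lra.
  - by split=> //=; rewrite /m; lra.
  - by rewrite /m; lra.
have bad01 : Bad (0, 1) by split=> //=; rewrite subr0 mulr1.
have [x [p [badx Lx dx]]] := bisection (pt := fun x : R * R => x.1%:C) step bad01.
rewrite /= subr0 in Lx dx.
pose t := complex.Re p.
have dt n : `|(x n).1 - t| <= 2 * (1 / 2 ^+ n).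
  apply: le_trans (dx n); rewrite -[(x n).1]/(complex.Re ((x n).1%:C : C)) -raddfB; exact: nr_Re.
have t01 : 0 <= t <= 1.
  apply/andP; split; apply/ler_addgt0Pr => d d0; have [n hn] := exp2_small 2 d0.
    by have := dt n; have [/= x0 _ _ _] := badx n; rewrite ler_norml => /andP[_]; lra.
  by have := dt n; have [/= _ x12 x21 _] := badx n; rewrite ler_norml => /andP[+ _]; lra.
(* The three errors below weigh 3, 2 and 1 times [e / 12 * (b - a)]: together half of what a bad
   interval must exceed. *)
have e12 : 0 < e / 12 by rewrite divr_gt0.
have [d d0 hd] := hP _ t01 _ e12; have [N N0 hN] := hg _ e12.
have m0 : 0 < Num.min d N%:R^-1 by rewrite lt_min d0 invr_gt0 ltr0n.
have [n hn] := exp2_small 3 m0; move: hn; rewrite lt_min => /andP[nd nN].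
move: (badx n) (dt n) (Lx n); case: (x n) => a b [/= a0 ab b1 +] at_ Lab.
move=> h; exfalso; move: h; apply/negP; rewrite -leNgt.
have pos : 0 < (2 ^+ n : R)^-1 by rewrite invr_gt0 exprn_gt0.
have bt : `|b - t| <= 3 * (b - a).
  have -> : b - t = (b - a) + (a - t) by ring.
  by apply: (le_trans (ler_normD _ _)); rewrite (ger0_norm (_ : 0 <= b - a)); lra.
have a01 : 0 <= a <= 1 by lra.
have b01 : 0 <= b <= 1 by lra.
have H1 : nr (P b - P t - (b - t)%:C *: g t) <= e / 12 * `|b - t| by apply: hd => //; lra.
have H2 : nr (P a - P t - (a - t)%:C *: g t) <= e / 12 * `|a - t| by apply: hd => //; lra.
have H3 : nr (unit_int (fun s => g (a + s * (b - a))) - g t) <= e / 12.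
  apply: unit_int_near; first exact: ucont01_affine.
  move=> s s01; apply: hN => //; first nra.
  have -> : a + s * (b - a) - t = s * (b - a) + (a - t) by ring.
  apply: (le_trans (ler_normD _ _)); rewrite ger0_norm; last by nra.
  have : s * (b - a) <= b - a by nra.
  lra.
have -> : D a b = (P b - P t - (b - t)%:C *: g t) - (P a - P t - (a - t)%:C *: g t)
    - (b - a)%:C *: (unit_int (fun s => g (a + s * (b - a))) - g t).
  rewrite /D scalerBr opprB.
  have -> : (b - a)%:C *: g t = (b - t)%:C *: g t - (a - t)%:C *: g t.
    by rewrite -scalerBl -rmorphB; congr (_%:C *: _); ring.
  move: (_ *: unit_int _) (_ *: g t) (_ *: g t) (P a) (P b) (P t) => I u v pa pb pt.
  by zmod.
have H4 : nr ((b - a)%:C *: (unit_int (fun s => g (a + s * (b - a))) - g t)) <= (b - a) * (e / 12).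
  by rewrite nrZ nr_real ger0_norm ?ler_wpM2l //; lra.
apply: (le_trans (nrB _ _)); apply: (le_trans (lerD (nrB _ _) H4)).
have : e / 12 * `|b - t| <= e / 12 * (3 * (b - a)) by apply: ler_wpM2l => //; lra.
have : e / 12 * `|a - t| <= e / 12 * (2 * (b - a)) by apply: ler_wpM2l; lra.
have : 0 <= e * (b - a) by apply: mulr_ge0; lra.
lra.
Qed.
End FTC.

(** * Compactness in the complex plane *)

Section Complex.
Variable R : realType.
Local Notation C := (R[i] : numFieldType).

(** The compactness argument behind the uniform bounds below: a property that holds near each point
    for all small scales [d] holds on [K] for one common scale. The scales form the second filter of
    a near covering. *)
Lemma compact_uniform (X : topologicalType) (K : set X) (P : R -> X -> Prop) : compact K ->
  (forall x, K x -> exists2 r : R, 0 < r & \forall y \near x, forall d, 0 < d < r -> P d y) ->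
  exists2 d : R, 0 < d & forall x, K x -> P d x.
Proof.
move=> /compact_near_coveringP cK hP.
have := cK R (0 : R)^'+ P _; case.
  move=> x /hP [r r0 hr].
  exists ([set y | forall d, 0 < d < r -> P d y], [set d | 0 < d < r]); first split => //=.
    near=> d; apply/andP; split; near: d; [exact: nbhs_right_gt|exact: nbhs_right_lt].
  by move=> [y d] /= [h1 h2]; exact: h1.
move=> r /= r0 hr; exists (r / 2); first by rewrite divr_gt0.
move=> x Kx; apply: (hr (r / 2)) => //=; last by rewrite divr_gt0.
by rewrite sub0r normrN ger0_norm ?divr_ge0 ?ltW// ltr_pdivrMr//; lra.
Unshelve. all: by end_near. Qed.

Lemma nbhs_nrP (x : C) (P : C -> Prop) :
  (\forall y \near x, P y) <-> exists2 r : R, 0 < r & forall y, nr (y - x) < r -> P y.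
Proof.
split.
  move/nbhs_ballP => [e /=]; case: e => a b; rewrite ltcE /= => /andP[/eqP -> a0] h.
  exists a => // y hy; apply: h; rewrite -ball_normE /= distrC -[_ +i* _]/(a%:C).
  by rewrite -nr_lt.
move=> [r r0 h]; apply/nbhs_ballP; exists r%:C => /=; first by rewrite ltcR.
by move=> y; rewrite -ball_normE /= distrC -nr_lt; exact: h.
Qed.

Lemma open_nrP (U : set C) : open U <->
  forall x, U x -> exists2 r : R, 0 < r & forall y, nr (y - x) < r -> U y.
Proof.
rewrite openE; split => h x Ux; first by have /nbhs_nrP := h _ Ux.
by apply/nbhs_nrP; exact: h.
Qed.

Definition nr_closed (K : set C) :=
  forall x, (forall e : R, 0 < e -> exists2 y, K y & nr (y - x) < e) -> K x.

Lemma closed_nrP (K : set C) : closed K <-> nr_closed K.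
Proof.
rewrite -openC open_nrP; split => h x.
  move=> hx; apply: contrapT => Kx; have [r r0 hr] := h _ Kx.
  by have [y Ky /hr] := hx _ r0.
move=> Kx; apply: contrapT => hn; apply: Kx; apply: h => e e0.
apply: contrapT => hy; apply: hn; exists e => // y ye Ky; apply: hy.
by exists y.
Qed.

Definition nr_bounded (K : set C) := exists M : R, forall x, K x -> nr x <= M.

Lemma cts_of_cvg (X : topologicalType) (f : X -> C) (x : X) :
  (forall e : R, 0 < e -> \forall y \near x, nr (f y - f x) < e) -> {for x, continuous f}.
Proof.
move=> h; apply/cvgrPdist_lt => e; case: e => a b; rewrite ltcE /= => /andP[/eqP -> a0].
have := h _ a0; apply: filterS => y; rewrite distrC -[_ +i* _]/(a%:C).
by rewrite -nr_lt.
Qed.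

Lemma compact_of_closed_bounded (K : set C) : nr_closed K -> nr_bounded K -> compact K.
Proof.
move=> clK [M hM].
(* [K] is the continuous image of its preimage among real row vectors of length 2, where closed
   bounded sets are compact. *)
pose f (v : 'rV[R]_2) : C := v ord0 ord0 +i* v ord0 ord_max.
have cf : continuous f.
  move=> v; apply: cts_of_cvg => e e0.
  have e2 : 0 < e / 2 by rewrite divr_gt0.
  have c0 := @coord_continuous R 1 2 ord0 ord0 v; have c1 := @coord_continuous R 1 2 ord0 ord_max v.
  move/cvgrPdist_lt/(_ _ e2) : c0 => c0; move/cvgrPdist_lt/(_ _ e2) : c1 => c1.
  near=> w.
  apply: le_lt_trans (nr_ReIm _) _; rewrite [ltRHS]splitr !raddfB /=; apply: ltrD; rewrite distrC.
    by near: w; exact: c0.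
  by near: w; exact: c1.
have -> : K = f @` (f @^-1` K).
  apply/seteqP; split => z; last by move=> [v /= Kv <-].
  move=> Kz; exists (\row_j (if j == ord0 then complex.Re z else complex.Im z)).
    by rewrite /= /f !mxE /=; case: z Kz.
  by rewrite /f !mxE /=; case: z Kz.
apply: continuous_compact; first exact: continuous_subspaceT.
apply: bounded_closed_compact; last first.
  by apply: preimage_closed => //; apply/closed_nrP.
exists M; split; first by rewrite num_real.
move=> N MN v /= Kv; rewrite /Num.Def.normr /= mx_normrE.
have N0 : 0 <= N by apply: ltW; apply: le_lt_trans MN; exact: le_trans (nr_ge0 _) (hM _ Kv).
apply/bigmax_leP; split=> // -[i j] _ /=; apply: ltW; apply: le_lt_trans MN; apply: le_trans (hM _ Kv).
rewrite (ord1 i).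
have [->|->] : j = ord0 \/ j = ord_max.
  by case: j => -[|[|//]] hj; [left|right]; apply/val_inj.
  exact: (nr_Re (f v)).
exact: (nr_Im (f v)).
Unshelve. all: by end_near. Qed.

End Complex.

(** * Segments, cycles and complex derivatives *)

Section Segments.
Variable R : realType.
Local Notation C := (R[i] : numFieldType).

Definition ccont (V : normedModType C) (F : C -> V) (z : C) :=
  forall e : R, 0 < e -> exists2 d : R, 0 < d & forall w, nr (w - z) < d -> nr (F w - F z) < e.

(** A first-order expansion instead of a limit of quotients: the case [w = z] needs no exclusion,
    and values may lie in any normed module. [derivable_cderivP] links it to [derivable]. *)
Definition cderiv (V : normedModType C) (F : C -> V) (z : C) (D : V) :=
  forall e : R, 0 < e -> exists2 d : R, 0 < d &
    forall w, nr (w - z) < d -> nr (F w - F z - (w - z) *: D) <= e * nr (w - z).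

Definition segment (e : C * C) : set C := [set z | exists2 t : R, 0 <= t <= 1 & z = seg_pt e t].

Definition segc (V : normedModType C) (h : C -> V) (e : C * C) :=
  ucont01 (fun t => h (seg_pt e t)).

Lemma cderiv_ccont (V : normedModType C) (F : C -> V) z D : cderiv F z D -> ccont F z.
Proof.
move=> hF e e0; have [d d0 hd] := hF 1 ltr01.
(* The summand 1 keeps the divisor positive when [D] is 0; the same device recurs below. *)
have c0 : 0 < nr D + 1 by rewrite ltr_wpDl ?nr_ge0.
exists (Num.min d (e / (nr D + 1))); first by rewrite lt_min d0 divr_gt0.
move=> w; rewrite lt_min => /andP[/hd h1]; rewrite ltr_pdivlMr // => h2.
rewrite mul1r in h1.
have -> : F w - F z = (F w - F z - (w - z) *: D) + (w - z) *: D by rewrite subrK.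
apply: le_lt_trans (nrD _ _) _; rewrite nrZ; lra.
Qed.

Lemma ccont_uniform (V : normedModType C) (F : C -> V) (K : set C) : compact K ->
  (forall z, K z -> ccont F z) -> forall e : R, 0 < e -> exists2 d : R, 0 < d &
    forall z, K z -> forall w, nr (w - z) < d -> nr (F w - F z) < e.
Proof.
move=> cK hF e e0; apply: (compact_uniform (P := fun d z => forall w, nr (w - z) < d -> nr (F w - F z) < e)) => //.
move=> x /hF/(_ (e / 2)); rewrite divr_gt0 // => /(_ isT) [d d0 hd].
exists (d / 2); first by rewrite divr_gt0.
apply/nbhs_nrP; exists (d / 2); first by rewrite divr_gt0.
move=> y yx r /andP[r0 rd] w wy.
have h1 : nr (F y - F x) < e / 2 by apply: hd; lra.
have h2 : nr (F w - F x) < e / 2.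
  by apply: hd; apply: le_lt_trans (nr_tri y _ _) _; lra.
by apply: le_lt_trans (nr_tri (F x) _ _) _; rewrite [X in _ + X]nrBC; lra.
Qed.

Lemma compact_nr_bounded (K : set C) : compact K -> nr_bounded K.
Proof.
move=> cK; have [d d0 hd] : exists2 d : R, 0 < d & forall x, K x -> nr x <= d^-1.
  apply: (compact_uniform (P := fun d x => nr x <= d^-1)) => // x _.
  have p0 : 0 < nr x + 1 by rewrite ltr_wpDl ?nr_ge0.
  exists (nr x + 1)^-1; first by rewrite invr_gt0.
  apply/nbhs_nrP; exists 1 => // y yx d /andP[d0 d1].
  have : nr x + 1 <= d^-1 by rewrite -[leLHS]invrK lef_pV2 ?posrE ?invr_gt0 // ltW.
  by have := nr_lower y x; lra.
by exists d^-1.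
Qed.

Lemma ccont_bounded (V : normedModType C) (F : C -> V) (K : set C) : compact K ->
  (forall z, K z -> ccont F z) -> exists2 M : R, 0 < M & forall z, K z -> nr (F z) <= M.
Proof.
move=> cK hF; have [d d0 hd] : exists2 d : R, 0 < d & forall x, K x -> nr (F x) <= d^-1.
  apply: (compact_uniform (P := fun d x => nr (F x) <= d^-1)) => // x /hF/(_ 1 ltr01) [r r0 hr].
  have p0 : 0 < nr (F x) + 1 by rewrite ltr_wpDl ?nr_ge0.
  exists (nr (F x) + 1)^-1; first by rewrite invr_gt0.
  apply/nbhs_nrP; exists r => // y /hr yx d /andP[d0 d1].
  have : nr (F x) + 1 <= d^-1 by rewrite -[leLHS]invrK lef_pV2 ?posrE ?invr_gt0 // ltW.
  by have := nr_lower (F y) (F x); lra.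
by exists d^-1; rewrite ?invr_gt0.
Qed.

Lemma compact_away (K U : set C) : compact K -> open U -> K `<=` U ->
  exists2 d : R, 0 < d & forall x, K x -> forall y, nr (y - x) < d -> U y.
Proof.
move=> cK /open_nrP oU KU.
apply: (compact_uniform (P := fun d x => forall y, nr (y - x) < d -> U y)) => // x /KU/oU [r r0 hr].
exists (r / 2); first by rewrite divr_gt0.
apply/nbhs_nrP; exists (r / 2); first by rewrite divr_gt0.
move=> y yx d /andP[d0 dr] w wy; apply: hr; apply: le_lt_trans (nr_tri y _ _) _; lra.
Qed.

Lemma seg_ptB (e : C * C) s t : seg_pt e s - seg_pt e t = (s - t)%:C * (e.2 - e.1).
Proof. by rewrite /seg_pt rmorphB /=; ring. Qed.

Lemma seg_pt_lip (e : C * C) s t : nr (seg_pt e s - seg_pt e t) = `|s - t| * nr (e.2 - e.1).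
Proof. by rewrite seg_ptB nrM nr_real. Qed.

Lemma compact_segment (e : C * C) : compact (segment e).
Proof.
have -> : segment e = seg_pt e @` `[0, 1]%classic.
  apply/seteqP; split => z /=.
    by move=> [t t01 ->]; exists t => //=; rewrite in_itv.
  by move=> [t /=]; rewrite in_itv /= => t01 <-; exists t.
apply: continuous_compact; last exact: segment_compact.
apply: continuous_subspaceT => t; apply: cts_of_cvg => d d0.
have c0 : 0 < nr (e.2 - e.1) + 1 by rewrite ltr_wpDl ?nr_ge0.
near=> s; rewrite seg_pt_lip.
have : `|s - t| < d / (nr (e.2 - e.1) + 1).
  by rewrite distrC; near: s; apply: cvgr_dist_lt => //; rewrite divr_gt0.
rewrite ltr_pdivlMr //; apply: le_lt_trans.
by rewrite ler_wpM2l // lerDl.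
Unshelve. all: by end_near. Qed.

Lemma segc_ucont (V : normedModType C) (h : C -> V) (e : C * C) :
  (forall eps : R, 0 < eps -> exists2 d : R, 0 < d & forall z w, segment e z -> segment e w ->
     nr (w - z) < d -> nr (h w - h z) <= eps) -> segc h e.
Proof.
move=> hh eps eps0; have [d d0 hd] := hh _ eps0.
have c0 : 0 < nr (e.2 - e.1) + 1 by rewrite ltr_wpDl ?nr_ge0.
pose n := (Num.bound ((nr (e.2 - e.1) + 1) / d)).+1.
have hn : (nr (e.2 - e.1) + 1) / d < n%:R.
  apply: (@lt_trans _ _ (Num.bound ((nr (e.2 - e.1) + 1) / d))%:R); last by rewrite ltr_nat.
  by apply: archi_boundP; rewrite divr_ge0 // ltW.
exists n => // s t s01 t01 st; apply: hd; [by exists t|by exists s|].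
rewrite seg_pt_lip; apply: (@le_lt_trans _ _ (n%:R^-1 * nr (e.2 - e.1))).
  by rewrite ler_wpM2r ?nr_ge0.
rewrite mulrC ltr_pdivrMr ?ltr0n //; rewrite ltr_pdivrMr // in hn.
by rewrite mulrC; lra.
Qed.

Lemma segc_ccont (V : normedModType C) (h : C -> V) (e : C * C) :
  (forall z, segment e z -> ccont h z) -> segc h e.
Proof.
move=> hh; apply: segc_ucont => eps eps0.
have [d d0 hd] := ccont_uniform (@compact_segment e) hh eps0; exists d => // z w zs _ wz.
exact/ltW/hd.
Qed.

Lemma ler_div_succ (e x A : R) : 0 <= e -> 0 <= x -> 0 <= A -> e / (A + 1) * (x * A) <= e * x.
Proof.
move=> e0 x0 A0; have -> : e / (A + 1) * (x * A) = e * x * (A / (A + 1)) by ring.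
by apply: ler_piMr; [exact: mulr_ge0|rewrite ler_pdivrMr ?ltr_wpDl // mul1r lerDl].
Qed.

Lemma segment_nr (e : C * C) z p (r : R) : segment e z -> nr (e.1 - p) <= r -> nr (e.2 - p) <= r ->
  nr (z - p) <= r.
Proof.
move=> [t /andP[t0 t1] ->] h1 h2; rewrite /seg_pt.
have -> : e.1 + t%:C * (e.2 - e.1) - p = (1 - t)%:C * (e.1 - p) + t%:C * (e.2 - p).
  by rewrite rmorphB /= rmorph1; ring.
apply: (le_trans (nrD _ _)); rewrite !nrM !nr_real !ger0_norm ?subr_ge0 //.
nra.
Qed.

Section Integrals.
Variable V : normedModType C.
Hypothesis hV : nr_complete V.

Lemma seg_int_rev (h : C -> V) (a b : C) : seg_int (b, a) h = - seg_int (a, b) h.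
Proof.
rewrite /seg_int /= -scaleNr opprB; congr (_ *: _).
rewrite -[RHS]unit_int_reverse; congr unit_int; apply/funext => t.
by congr h; rewrite /seg_pt /= rmorphB /= rmorph1; ring.
Qed.

Lemma seg_intD (f g : C -> V) (e : C * C) : segc f e -> segc g e ->
  seg_int e (fun z => f z + g z) = seg_int e f + seg_int e g.
Proof. by move=> hf hg; rewrite /seg_int -scalerDr -unit_intD. Qed.

Lemma segcD (f g : C -> V) (e : C * C) : segc f e -> segc g e -> segc (fun z => f z + g z) e.
Proof. exact: ucont01D. Qed.

Lemma seg_int_linear (W : normedModType C) (L : V -> W) (f : C -> V) (e : C * C) :
  bounded_linear L -> segc f e -> seg_int e (fun z => L (f z)) = L (seg_int e f).
Proof.
by move=> hL hf; have [_ LZ _] := hL; rewrite /seg_int (unit_int_linear hV hL hf) LZ.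
Qed.

Lemma seg_int_bound (h : C -> V) (e : C * C) (M : R) : segc h e ->
  (forall z, segment e z -> nr (h z) <= M) -> nr (seg_int e h) <= nr (e.2 - e.1) * M.
Proof.
move=> hh hM; rewrite /seg_int nrZ ler_wpM2l ?nr_ge0 //.
by apply: unit_int_bound => // t t01; apply: hM; exists t.
Qed.

Lemma midC (a b : C) : (a + b) / 2 - a = (b - a) / 2.
Proof. by field. Qed.

Lemma seg_int_mid (h : C -> V) (a b : C) : segc h (a, b) ->
  seg_int (a, b) h = seg_int (a, (a + b) / 2) h + seg_int ((a + b) / 2, b) h.
Proof.
move=> hh; rewrite /seg_int [X in _ *: X = _]unit_int_half // scalerA scalerDr /=.
congr (_ *: _ + _ *: _).
- by rewrite midC.
- congr unit_int; apply/funext => t; congr h; rewrite /seg_pt /= midC rmorphM fmorphV /= rmorph_nat.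
  by ring.
- by field.
- congr unit_int; apply/funext => t; congr h; rewrite /seg_pt /= rmorphM fmorphV rmorphD /= rmorph_nat rmorph1.
  by field.
Qed.

Lemma seg_int_ftc (F h : C -> V) (e : C * C) : segc h e ->
  (forall z, segment e z -> cderiv F z (h z)) -> seg_int e h = F e.2 - F e.1.
Proof.
move=> hh hF; rewrite /seg_int -(@unit_int_linear R V V (fun v => (e.2 - e.1) *: v)) //; last first.
  split; [by move=> u v; rewrite scalerDr|by move=> a v; rewrite !scalerA mulrC|].
  by exists (nr (e.2 - e.1)); [exact: nr_ge0|move=> v; rewrite nrZ].
rewrite (@unit_int_ftc R V hV (fun t => F (seg_pt e t))).
- by rewrite /seg_pt mul1r mul0r addr0 [e.1 + _]addrC subrK.
- apply: (@ucont01_linear R V V (fun v => (e.2 - e.1) *: v)) => //.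
  split; [by move=> u v; rewrite scalerDr|by move=> a v; rewrite !scalerA mulrC|].
  by exists (nr (e.2 - e.1)); [exact: nr_ge0|move=> v; rewrite nrZ].
- move=> t t01 eps eps0.
  have c0 : 0 < nr (e.2 - e.1) + 1 by rewrite ltr_wpDl ?nr_ge0.
  have [d d0 hd] := hF (seg_pt e t) (ex_intro2 _ _ t t01 erefl) _ (divr_gt0 eps0 c0).
  exists (d / (nr (e.2 - e.1) + 1)); first by rewrite divr_gt0.
  move=> s s01; rewrite ltr_pdivlMr // => st.
  have le : `|s - t| * nr (e.2 - e.1) <= `|s - t| * (nr (e.2 - e.1) + 1).
    by rewrite ler_wpM2l // lerDl.
  have := hd (seg_pt e s); rewrite seg_pt_lip => /(_ (le_lt_trans le st)).
  rewrite seg_ptB scalerA; move/le_trans; apply.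
  by apply: ler_div_succ; rewrite ?nr_ge0 // ltW.
Qed.

End Integrals.
End Segments.

Section Derivatives.
Variable R : realType.
Local Notation C := (R[i] : numFieldType).

Lemma cderiv_ext (V : normedModType C) (F G : C -> V) z D (r : R) : 0 < r ->
  (forall w, nr (w - z) < r -> F w = G w) -> cderiv F z D -> cderiv G z D.
Proof.
move=> r0 FG hF e e0; have [d d0 hd] := hF _ e0.
exists (Num.min d r); first by rewrite lt_min d0.
move=> w; rewrite lt_min => /andP[wd wr].
by rewrite -!FG ?subrr ?nr0 //; exact: hd.
Qed.

Lemma cderiv_eq (V : normedModType C) (F : C -> V) z D D' : D = D' -> cderiv F z D -> cderiv F z D'.
Proof. by move->. Qed.

Lemma cderiv_cst (V : normedModType C) (v : V) z : cderiv (fun=> v) z 0.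
Proof.
move=> e e0; exists 1 => // w _; rewrite subrr sub0r scaler0 oppr0 nr0.
by rewrite mulr_ge0 ?nr_ge0 // ltW.
Qed.

Lemma cderiv_id (z : C) : cderiv id z 1.
Proof.
move=> e e0; exists 1 => // w _.
rewrite (_ : id w - id z - (w - z) *: 1 = 0) ?nr0 ?mulr_ge0 ?nr_ge0 // 1?ltW //.
by rewrite -[_ *: 1]/(_ * 1) mulr1 subrr.
Qed.

Lemma cderivD (V : normedModType C) (F G : C -> V) z D E :
  cderiv F z D -> cderiv G z E -> cderiv (fun w => F w + G w) z (D + E).
Proof.
move=> hF hG e e0; have e2 : 0 < e / 2 by rewrite divr_gt0.
have [d d0 hd] := hF _ e2; have [c c0 hc] := hG _ e2.
exists (Num.min d c); first by rewrite lt_min d0.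
move=> w; rewrite lt_min => /andP[/hd h1 /hc h2].
have -> : F w + G w - (F z + G z) - (w - z) *: (D + E) =
  (F w - F z - (w - z) *: D) + (G w - G z - (w - z) *: E) by rewrite scalerDr; zmod.
by apply: (le_trans (nrD _ _)); lra.
Qed.

Lemma cderivZ (V : normedModType C) (f : C -> C) (F : C -> V) z f' D :
  cderiv f z f' -> cderiv F z D -> cderiv (fun w => f w *: F w) z (f z *: D + f' *: F z).
Proof.
move=> hf hF e e0; have hc := cderiv_ccont hf.
have e3 : 0 < e / 3 by rewrite divr_gt0.
have A0 : 0 < nr (f z) + 1 by rewrite ltr_wpDl ?nr_ge0.
have B0 : 0 < nr (F z) + 1 by rewrite ltr_wpDl ?nr_ge0.
have C0 : 0 < nr D + 1 by rewrite ltr_wpDl ?nr_ge0.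
have [d1 d10 h1] := hf _ (divr_gt0 e3 B0).
have [d2 d20 h2] := hF _ (divr_gt0 e3 A0).
have [d3 d30 h3] := hc _ (divr_gt0 e3 C0).
have [d4 d40 h4] := hc _ ltr01.
exists (Num.min (Num.min d1 d2) (Num.min d3 d4)); first by rewrite !lt_min d10 d20 d30.
move=> w; rewrite !lt_min => /andP[/andP[/h1 k1 /h2 k2] /andP[/h3 k3 /h4 k4]].
have -> : f w *: F w - f z *: F z - (w - z) *: (f z *: D + f' *: F z) =
   f w *: (F w - F z - (w - z) *: D) + (f w - f z) *: ((w - z) *: D)
   + (f w - f z - (w - z) * f') *: F z.
  have e1 : (w - z) *: (f z *: D) = f z *: ((w - z) *: D) by rewrite !scalerA mulrC.
  have e2 : (w - z) *: (f' *: F z) = ((w - z) * f') *: F z by rewrite scalerA.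
  rewrite [(w - z) *: (_ + _)]scalerDr e1 e2 scalerBr [f w *: (_ - _)]scalerBr.
  by rewrite [(f w - f z) *: _]scalerBl !scalerBl; zmod.
set x := nr (w - z) in k1 k2 k3 k4 *.
have x0 : 0 <= x := nr_ge0 _.
have fw : nr (f w) <= nr (f z) + 1 by have := nr_lower (f w) (f z); lra.
have t1 : nr (f w) * nr (F w - F z - (w - z) *: D) <= e / 3 * x.
  apply: (@le_trans _ _ ((nr (f z) + 1) * (e / 3 / (nr (f z) + 1) * x))).
    by apply: ler_pM; rewrite ?nr_ge0.
  by rewrite mulrA (mulrC _ (e / 3 / _)) divfK // gt_eqF.
have t2 : nr (f w - f z) * (x * nr D) <= e / 3 * x.
  apply: (@le_trans _ _ (e / 3 / (nr D + 1) * (x * (nr D + 1)))).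
    by apply: ler_pM; rewrite ?nr_ge0 ?mulr_ge0 ?nr_ge0 ?ler_wpM2l ?lerDl // ltW.
  by rewrite (mulrC x) mulrA divfK // gt_eqF.
have t3 : nr (f w - f z - (w - z) * f') * nr (F z) <= e / 3 * x.
  apply: (@le_trans _ _ (e / 3 / (nr (F z) + 1) * x * (nr (F z) + 1))).
    by apply: ler_pM; rewrite ?nr_ge0 ?lerDl.
  by rewrite mulrAC divfK // gt_eqF.
apply: (le_trans (nrD _ _)); rewrite [X in _ + X <= _]nrZ.
apply: (@le_trans _ _ ((e / 3 * x + e / 3 * x) + e / 3 * x)); last by lra.
apply: lerD => //; apply: (le_trans (nrD _ _)); rewrite !nrZ; exact: lerD.
Qed.

Lemma cderiv_affine (V : normedModType C) (F : C -> V) (a b z : C) D :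
  cderiv F (a * z + b) D -> cderiv (fun w => F (a * w + b)) z (a *: D).
Proof.
move=> hF e e0; have A0 : 0 < nr a + 1 by rewrite ltr_wpDl ?nr_ge0.
have [d d0 hd] := hF _ (divr_gt0 e0 A0).
exists (d / (nr a + 1)); first by rewrite divr_gt0.
move=> w; rewrite ltr_pdivlMr // => wd.
have E : a * w + b - (a * z + b) = (w - z) * a by ring.
have := hd (a * w + b); rewrite E nrM.
have le : nr (w - z) * nr a <= nr (w - z) * (nr a + 1) by rewrite ler_wpM2l ?nr_ge0 // lerDl.
move=> /(_ (le_lt_trans le wd)); rewrite scalerA => /le_trans; apply.
by apply: ler_div_succ; rewrite ?nr_ge0 // ltW.
Qed.

Lemma cderiv_inv (z : C) : z != 0 -> cderiv (fun w => w^-1) z (- z^-1 ^+ 2).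
Proof.
move=> z0 e e0; have nz : 0 < nr z by rewrite nr_gt0.
have p0 : 0 < e * nr z ^+ 3 / 2 by rewrite divr_gt0 // mulr_gt0 // exprn_gt0.
exists (Num.min (nr z / 2) (e * nr z ^+ 3 / 2)); first by rewrite lt_min p0 divr_gt0.
move=> w; rewrite lt_min => /andP[w1 w2].
have wz : nr z / 2 < nr w.
  have := nr_lower z w; rewrite nrBC; lra.
have w0 : w != 0 by rewrite -nr_gt0; apply: lt_trans wz; rewrite divr_gt0.
rewrite (_ : w^-1 - z^-1 - _ = (w - z) ^+ 2 * (w^-1 * z^-1 ^+ 2)); last first.
  have -> : (w - z) *: - z^-1 ^+ 2 = (w - z) * - z^-1 ^+ 2 by [].
  by field; rewrite z0 w0.
have -> : nr ((w - z) ^+ 2 * (w^-1 * z^-1 ^+ 2)) = nr (w - z) * (nr (w - z) * ((nr w)^-1 * (nr z)^-1 ^+ 2)).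
  by rewrite nrM nrX nrM (nrX z^-1 2) !nrV; ring.
rewrite [leRHS]mulrC; apply: ler_wpM2l; first exact: nr_ge0.
have iw : (nr w)^-1 <= 2 / nr z.
  by rewrite -[2 / nr z]invf_div lef_pV2 ?posrE ?nr_gt0 ?w0 ?divr_gt0 // ltW.
apply: (@le_trans _ _ (e * nr z ^+ 3 / 2 * (2 / nr z * (nr z)^-1 ^+ 2))).
  apply: ler_pM; [exact: nr_ge0| |exact: ltW|].
    by rewrite mulr_ge0 ?exprn_ge0 ?invr_ge0 ?nr_ge0.
  by apply: ler_wpM2r; rewrite ?exprn_ge0 ?invr_ge0 ?nr_ge0.
rewrite (_ : _ * _ = e) //; field; exact: lt0r_neq0.
Qed.

Lemma cderiv_subV (w z : C) : z != w -> cderiv (fun l => (l - w)^-1) z (- (z - w)^-1 ^+ 2).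
Proof.
move=> zw; have := @cderiv_affine C (fun x => x^-1) 1 (- w) z (- (z - w)^-1 ^+ 2).
rewrite mul1r scale1r => /(_ _) h; apply: (@cderiv_ext _ (fun l => (1 * l - w)^-1) _ _ _ 1) => //.
  by move=> l _; rewrite mul1r.
by apply: h; apply: cderiv_inv; rewrite subr_eq0.
Qed.

Lemma cderivX (f : C -> C) z f' n : cderiv f z f' -> cderiv (fun w => f w ^+ n) z (n%:R * f z ^+ n.-1 * f').
Proof.
move=> hf; elim: n => [|n IH]; first by rewrite !mul0r; exact: cderiv_cst.
rewrite (_ : (fun w => f w ^+ n.+1) = (fun w => f w *: (f w ^+ n : C))); last first.
  by apply/funext => w; rewrite exprS.
have := cderivZ hf IH; apply: cderiv_eq.
rewrite -![_ *: _]/(_ * _) /=; case: n {IH} => [|n] /=; first by rewrite !mul0r mulr0 expr0; ring.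
by rewrite -[n.+2%:R]natr1 exprS; ring.
Qed.

End Derivatives.

Section Cycles.
Variable R : realType.
Local Notation C := (R[i] : numFieldType).

Lemma unit_int_ext (V : normedModType C) (f g : R -> V) :
  (forall t, 0 <= t <= 1 -> f t = g t) -> unit_int f = unit_int g.
Proof.
move=> fg; rewrite !unit_intE; congr (lim (_ @ \oo)); apply/funext => N.
by rewrite /riem; congr (_ *: _); apply: eq_bigr => k _; rewrite fg // ord_div01.
Qed.

Lemma seg_int_ext (V : normedModType C) (f g : C -> V) (e : C * C) :
  (forall z, segment e z -> f z = g z) -> seg_int e f = seg_int e g.
Proof.
move=> fg; rewrite /seg_int; congr (_ *: _); apply: unit_int_ext => t t01.
by apply: fg; exists t.
Qed.

Lemma segc_ext (V : normedModType C) (f g : C -> V) (e : C * C) :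
  (forall z, segment e z -> f z = g z) -> segc f e -> segc g e.
Proof.
move=> fg hf eps eps0; have [n n0 hn] := hf _ eps0; exists n => // s t s01 t01 st.
by rewrite -!fg; [exact: hn|exists t|exists s].
Qed.

Definition edges_int (V : normedModType C) (E : seq (C * C)) (h : C -> V) : V :=
  \sum_(e <- E) seg_int e h.

Definition edges_trace (E : seq (C * C)) : set C := [set z | exists2 e, e \in E & segment e z].

Lemma edges_intE (V : normedModType C) G (h : C -> V) : cycle_int G h = edges_int (cycle_edges G) h.
Proof. by []. Qed.

Lemma cycle_traceE (G : seq (seq C)) : cycle_trace G = edges_trace (cycle_edges G).
Proof.
apply/seteqP; split => z /=; first by move=> [e [t [he [t01 ->]]]]; exists e => //; exists t.
by move=> [e he [t t01 ->]]; exists e, t.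
Qed.

Definition edges_length (E : seq (C * C)) : R := \sum_(e <- E) nr (e.2 - e.1).

Lemma edges_length_ge0 E : 0 <= edges_length E.
Proof. by apply: sumr_ge0 => e _; exact: nr_ge0. Qed.

Lemma compact_edges_trace E : compact (edges_trace E).
Proof.
elim: E => [|e E IH].
  rewrite (_ : edges_trace [::] = set0); first exact: compact0.
  by apply/seteqP; split => z // [].
rewrite (_ : edges_trace _ = segment e `|` edges_trace E).
  by apply: compactU => //; exact: compact_segment.
apply/seteqP; split => z /=.
  by move=> [e']; rewrite inE => /orP[/eqP -> ?|he' h]; [left|right; exists e'].
by move=> [h|[e' he' h]]; [exists e; rewrite ?inE ?eqxx|exists e'; rewrite // inE he' orbT].
Qed.

Definition edges_cont (V : normedModType C) (E : seq (C * C)) (h : C -> V) :=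
  forall e, e \in E -> segc h e.

Lemma edges_cont_ccont (V : normedModType C) E (h : C -> V) :
  (forall z, edges_trace E z -> ccont h z) -> edges_cont E h.
Proof. by move=> hh e he; apply: segc_ccont => z hz; apply: hh; exists e. Qed.

Section Integrals.
Variable V : normedModType C.
Hypothesis hV : nr_complete V.

Lemma edges_int_ext E (f g : C -> V) : (forall z, edges_trace E z -> f z = g z) ->
  edges_int E f = edges_int E g.
Proof.
move=> fg; apply: eq_big_seq => e he; apply: seg_int_ext => z hz.
by apply: fg; exists e.
Qed.

Lemma edges_intD E (f g : C -> V) : edges_cont E f -> edges_cont E g ->
  edges_int E (fun z => f z + g z) = edges_int E f + edges_int E g.
Proof.
move=> hf hg; rewrite /edges_int -big_split /=; apply: eq_big_seq => e he.
by rewrite seg_intD //; [exact: hf|exact: hg].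
Qed.

Lemma edges_contD E (f g : C -> V) : edges_cont E f -> edges_cont E g ->
  edges_cont E (fun z => f z + g z).
Proof. by move=> hf hg e he; apply: segcD; [exact: hf|exact: hg]. Qed.

Lemma edges_int_linear (W : normedModType C) (L : V -> W) E (f : C -> V) :
  bounded_linear L -> edges_cont E f -> edges_int E (fun z => L (f z)) = L (edges_int E f).
Proof.
move=> hL hf; rewrite /edges_int (bounded_linear_sum hL); apply: eq_big_seq => e he.
by rewrite seg_int_linear //; exact: hf.
Qed.

Lemma edges_cont_linear (W : normedModType C) (L : V -> W) E (f : C -> V) :
  bounded_linear L -> edges_cont E f -> edges_cont E (fun z => L (f z)).
Proof. by move=> hL hf e he; apply: (ucont01_linear hL); exact: hf. Qed.

Lemma bounded_linear_scale (a : C) : bounded_linear (fun v : V => a *: v).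
Proof.
split; [by move=> u v; rewrite scalerDr|by move=> b v; rewrite !scalerA mulrC|].
by exists (nr a); [exact: nr_ge0|move=> v; rewrite nrZ].
Qed.

Lemma bounded_linear_scaler (v : V) : bounded_linear (fun a : C => a *: v).
Proof.
split; [by move=> a b; rewrite scalerDl|by move=> a b; rewrite scalerA|].
by exists (nr v); [exact: nr_ge0|move=> a; rewrite nrZ mulrC].
Qed.

Lemma edges_intZ E (f : C -> V) (a : C) : edges_cont E f ->
  edges_int E (fun z => a *: f z) = a *: edges_int E f.
Proof. exact: (edges_int_linear (bounded_linear_scale a)). Qed.

Lemma edges_int_bound E (h : C -> V) (M : R) : edges_cont E h ->
  (forall z, edges_trace E z -> nr (h z) <= M) -> nr (edges_int E h) <= edges_length E * M.
Proof.
move=> hh hM; apply: (le_trans (nr_sum _ _ _)); rewrite /edges_length mulr_suml !big_seq.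
apply: ler_sum => e he; apply: seg_int_bound => //; first exact: hh.
by move=> z hz; apply: hM; exists e.
Qed.

(** A polygon is closed: the ends of its edges are its starts, rotated, so the differences
    cancel. *)
Lemma sum_poly_edges (F : C -> V) p : \sum_(e <- poly_edges p) (F e.2 - F e.1) = 0.
Proof.
rewrite sumrB -(big_map snd xpredT F) -(big_map fst xpredT F).
rewrite -/(unzip1 _) -/(unzip2 _) unzip1_zip ?unzip2_zip ?size_rot //.
by apply/eqP; rewrite subr_eq0; apply/eqP/perm_big; rewrite perm_rot.
Qed.

Lemma sum_cycle_edges (F : C -> V) G : \sum_(e <- cycle_edges G) (F e.2 - F e.1) = 0.
Proof.
elim: G => [|p G IH]; first by rewrite big_nil.
by rewrite /cycle_edges /= big_cat /= IH addr0 sum_poly_edges.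
Qed.

Lemma cycle_int_primitive G (F h : C -> V) :
  (forall z, cycle_trace G z -> ccont h z) -> (forall z, cycle_trace G z -> cderiv F z (h z)) ->
  cycle_int G h = 0.
Proof.
rewrite cycle_traceE => hh hF; rewrite -(sum_cycle_edges F G); apply: eq_big_seq => e he.
by apply: seg_int_ftc => //; [exact: (edges_cont_ccont hh)|move=> z hz; apply: hF; exists e].
Qed.

End Integrals.

Lemma ccont_subV (w z : C) n : z != w -> ccont (fun l => (l - w)^-1 ^+ n) z.
Proof. by move=> zw; exact: cderiv_ccont (cderivX _ (cderiv_subV zw)). Qed.

Lemma cycle_int_subVX G (w : C) n : (1 < n)%N -> ~ cycle_trace G w ->
  cycle_int G (fun l => (l - w)^-1 ^+ n : C) = 0.
Proof.
case: n => [//|[//|n]] _ Gw.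
have ne z : cycle_trace G z -> z != w by move=> Gz; apply/eqP => zw; rewrite zw in Gz.
have n0 : (n.+1%:R : C) != 0 by rewrite pnatr_eq0.
apply: (@cycle_int_primitive _ (@complex_nr_complete R) _ (fun l => (- n.+1%:R^-1 : C) *: ((l - w)^-1 ^+ n.+1 : C))).
  by move=> z /ne; exact: ccont_subV.
move=> z /ne zw; have := cderivZ (cderiv_cst (- n.+1%:R^-1 : C) z) (cderivX n.+1 (cderiv_subV zw)).
apply: cderiv_eq; rewrite scale0r addr0 /=; set x := (z - w)^-1.
have -> : - n.+1%:R^-1 *: (n.+1%:R * x ^+ n * - x ^+ 2) = - n.+1%:R^-1 * (n.+1%:R * x ^+ n * - x ^+ 2) by [].
by rewrite !exprS; field.
Qed.

Lemma cycle_int_X G n : cycle_int G (fun l => l ^+ n : C) = 0.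
Proof.
have n0 : (n.+1%:R : C) != 0 by rewrite pnatr_eq0.
apply: (@cycle_int_primitive _ (@complex_nr_complete R) _ (fun l => (n.+1%:R^-1 : C) *: (l ^+ n.+1 : C))).
  by move=> z _; exact: cderiv_ccont (cderivX _ (cderiv_id z)).
move=> z _; have := cderivZ (cderiv_cst (n.+1%:R^-1 : C) z) (cderivX n.+1 (cderiv_id z)).
by apply: cderiv_eq; rewrite scale0r addr0 /= -[_ *: _]/(_ * _) mulr1 mulKf.
Qed.

End Cycles.
Opaque unit_int.

(** * Goursat's theorem and the winding of polygons *)

Section Goursat.
Variable R : realType.
Local Notation C := (R[i] : numFieldType).
Local Notation hC := (@complex_nr_complete R).

Lemma le_geometric_eq0 (x K : R) : (forall n, x <= K / 2 ^+ n) -> 0 <= x -> x = 0.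
Proof.
move=> h x0; apply/eqP; rewrite eq_le x0 andbT; apply/ler_addgt0Pr => e e0.
by have [n hn] := exp2_small K e0; rewrite add0r; apply: (le_trans (h n)); exact: ltW.
Qed.

(** Here [a N] are the integrals of the remainders of an expansion and [c N * b N] those of its
    terms. Only the term of index 0 lacks a primitive, so only it contributes. *)
Lemma telescope_step (a b c : nat -> C) : (forall N, a N = a N.+1 + c N * b N) ->
  (forall N, b N.+1 = 0) -> c 0%N = 1 -> forall N, a N.+1 = a 0%N - b 0%N.
Proof.
move=> ha hb hc; elim=> [|N IH]; first by rewrite [a 0%N]ha hc mul1r addrK.
by rewrite -IH [a N.+1]ha hb mulr0 addr0.
Qed.

Lemma geometric_kernel_bound (x y : C) (c : R) N : 0 < c -> c <= nr y -> nr x <= 2^-1 ->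
  nr ((x ^+ N : C) *: (y^-1 : C)) <= c^-1 / 2 ^+ N.
Proof.
move=> c0 cy hx; rewrite nrZ nrX nrV mulrC; apply: ler_pM.
- by rewrite invr_ge0 nr_ge0.
- by rewrite exprn_ge0 ?nr_ge0.
- by rewrite lef_pV2 ?posrE //; exact: lt_le_trans cy.
- by rewrite -exprVn lerXn2r ?nnegrE ?nr_ge0 ?invr_ge0.
Qed.

(* Expand 1 / (l - w') in powers of w' - w: all terms but the first have
   primitives, and the remainder tends to 0. *)
Lemma cycle_int_subV_local G (w w' : C) (d : R) : 0 < d ->
  (forall l, cycle_trace G l -> d <= nr (l - w)) -> nr (w' - w) <= d / 2 ->
  cycle_int G (fun l => (l - w')^-1 : C) = cycle_int G (fun l => (l - w)^-1 : C).
Proof.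
move=> d0 hd hw.
have Gw l : cycle_trace G l -> l != w.
  by move=> /hd h; rewrite -subr_eq0 -nr_gt0; exact: lt_le_trans h.
have Gw'd l : cycle_trace G l -> d / 2 <= nr (l - w').
  by move=> /hd h; have := nr_tri w' l w; lra.
have Gw' l : cycle_trace G l -> l != w'.
  by move=> /Gw'd h; rewrite -subr_eq0 -nr_gt0; apply: lt_le_trans h; rewrite divr_gt0.
have Gnw : ~ cycle_trace G w by move=> /Gw; rewrite eqxx.
pose I N l : C := ((w' - w) ^+ N : C) *: (((l - w)^-1 ^+ N : C) *: ((l - w')^-1 : C)).
have cI N l : cycle_trace G l -> ccont (I N) l.
  move=> Gl; apply: cderiv_ccont; apply: cderivZ; first exact: cderiv_cst.
  apply: cderivZ; last exact/cderiv_subV/Gw'.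
  exact/cderivX/cderiv_subV/Gw.
have step N : cycle_int G (I N) = cycle_int G (I N.+1) + (w' - w) ^+ N * cycle_int G (fun l => (l - w)^-1 ^+ N.+1 : C).
  have cX : edges_cont (cycle_edges G) (fun l => (l - w)^-1 ^+ N.+1 : C).
    by apply: edges_cont_ccont => l; rewrite -cycle_traceE => /Gw h; exact: ccont_subV.
  rewrite -[_ * _]/(_ *: _) !edges_intE -(edges_intZ hC) // -(edges_intD hC); first last.
  - by apply: (edges_cont_linear (@bounded_linear_scale _ _ _)).
  - by apply: edges_cont_ccont => l; rewrite -cycle_traceE; exact: cI.
  apply: edges_int_ext => l; rewrite -cycle_traceE => Gl.
  have h1 := Gw _ Gl; have h2 := Gw' _ Gl.
  rewrite /I -![_ *: _]/(_ * _) !exprS.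
  by field; rewrite !subr_eq0 h1 h2.
have E1 : cycle_int G (I 0%N) = cycle_int G (fun l => (l - w')^-1 : C).
  by apply: edges_int_ext => l _; rewrite /I !expr0 !scale1r.
have E2 N : cycle_int G (I N.+1) = cycle_int G (fun l => (l - w')^-1 : C) - cycle_int G (fun l => (l - w)^-1 : C).
  rewrite -E1; apply: (telescope_step (a := fun N => cycle_int G (I N)) step) => [{}N|].
    exact: cycle_int_subVX.
  exact: expr0.
apply/eqP; rewrite -subr_eq0; apply/eqP; move: E2; set D := _ - _ => E2.
suff : nr D = 0 by move/eqP; rewrite nr_eq0 => /eqP.
apply: (@le_geometric_eq0 _ (edges_length (cycle_edges G) * (2 / d))) => [N|]; last exact: nr_ge0.
have p2 : 0 < (2 ^+ N : R)^-1 by rewrite invr_gt0 exprn_gt0.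
rewrite -(E2 N) -mulrA; clear D E2 E1 step; apply: (@edges_int_bound _ _ hC).
  by apply: edges_cont_ccont => l; rewrite -cycle_traceE; exact: cI.
move=> l; rewrite -cycle_traceE => Gl; rewrite /I scalerA -exprMn.
have l0 : 0 < nr (l - w) by exact: lt_le_trans (hd _ Gl).
have d2 : 0 < d / 2 by rewrite divr_gt0.
have q1 : nr ((w' - w) * (l - w)^-1) <= 2^-1.
  by rewrite nrM nrV (ler_pdivrMr _ _ l0); have := hd _ Gl; lra.
apply: (le_trans (geometric_kernel_bound N.+1 d2 (Gw'd _ Gl) q1)).
rewrite invf_div; apply: ler_wpM2l; first by rewrite divr_ge0 // ltW.
by rewrite lef_pV2 ?posrE ?exprn_gt0 // exprS ler_peMl ?exprn_ge0 // ler1n.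
Qed.

(** Expansion in powers of [l / w]: the terms are monomials in [l], which have primitives, and the
    remainders shrink by the ratio 1/2. *)
Lemma cycle_int_subV_far G (w : C) (M : R) : (forall l, cycle_trace G l -> nr l <= M) ->
  2 * M <= nr w -> 0 < nr w -> cycle_int G (fun l => (l - w)^-1 : C) = 0.
Proof.
move=> hM hw w0.
have w0' : w != 0 by rewrite -nr_gt0.
have Gwd l : cycle_trace G l -> nr w / 2 <= nr (l - w).
  by move=> /hM h; have := nr_lower w l; rewrite nrBC; lra.
have Gw l : cycle_trace G l -> l != w.
  by move=> /Gwd h; rewrite -subr_eq0 -nr_gt0; apply: lt_le_trans h; rewrite divr_gt0.
pose J N l : C := (w^-1 ^+ N : C) *: ((l ^+ N : C) *: ((l - w)^-1 : C)).
have cJ N l : cycle_trace G l -> ccont (J N) l.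
  move=> Gl; apply: cderiv_ccont; apply: cderivZ; first exact: cderiv_cst.
  apply: cderivZ; last exact/cderiv_subV/Gw.
  exact/cderivX/cderiv_id.
have step N : cycle_int G (J N) = cycle_int G (J N.+1).
  have cX : edges_cont (cycle_edges G) (fun l => l ^+ N : C).
    by apply: edges_cont_ccont => l _; exact: cderiv_ccont (cderivX _ (cderiv_id _)).
  rewrite -[RHS]addr0 -(mulr0 (- w^-1 ^+ N.+1)) -(cycle_int_X G N).
  rewrite -[_ * _]/(_ *: _) !edges_intE -(edges_intZ hC) // -(edges_intD hC); first last.
  - by apply: (edges_cont_linear (@bounded_linear_scale _ _ _)).
  - by apply: edges_cont_ccont => l; rewrite -cycle_traceE; exact: cJ.
  apply: edges_int_ext => l; rewrite -cycle_traceE => Gl.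
  have h1 := Gw _ Gl.
  rewrite /J -![_ *: _]/(_ * _) !exprS.
  by field; rewrite subr_eq0 h1 w0'.
have E N : cycle_int G (fun l => (l - w)^-1 : C) = cycle_int G (J N).
  elim: N => [|N IH]; last by rewrite -step.
  by apply: edges_int_ext => l _; rewrite /J !expr0 !scale1r.
suff : nr (cycle_int G (fun l => (l - w)^-1 : C)) = 0 by move/eqP; rewrite nr_eq0 => /eqP.
apply: (@le_geometric_eq0 _ (edges_length (cycle_edges G) * (2 / nr w))) => [N|]; last exact: nr_ge0.
rewrite (E N) -mulrA; clear E step; apply: (@edges_int_bound _ _ hC).
  by apply: edges_cont_ccont => l; rewrite -cycle_traceE; exact: cJ.
move=> l; rewrite -cycle_traceE => Gl; rewrite /J scalerA -exprMn.
have d2 : 0 < nr w / 2 by rewrite divr_gt0.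
have q1 : nr (w^-1 * l) <= 2^-1.
  by rewrite mulrC nrM nrV (ler_pdivrMr _ _ w0); have := hM _ Gl; lra.
by apply: (le_trans (geometric_kernel_bound N d2 (Gwd _ Gl) q1)); rewrite invf_div.
Qed.

Definition convexC (X : set C) := forall a b, X a -> X b -> segment (a, b) `<=` X.

Variable V : normedModType C.
Hypothesis hV : nr_complete V.

Definition tri (F : C -> V) (a b c : C) : V :=
  seg_int (a, b) F + seg_int (b, c) F + seg_int (c, a) F.

Lemma tri_split (F : C -> V) a b c :
  segc F (a, b) -> segc F (b, c) -> segc F (c, a) ->
  tri F a b c = tri F a ((a + b) / 2) ((c + a) / 2) + tri F ((a + b) / 2) b ((b + c) / 2)
   + tri F ((c + a) / 2) ((b + c) / 2) c + tri F ((b + c) / 2) ((c + a) / 2) ((a + b) / 2).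
Proof.
move=> h1 h2 h3; rewrite /tri (seg_int_mid hV h1) (seg_int_mid hV h2) (seg_int_mid hV h3).
set p := (a + b) / 2; set q := (b + c) / 2; set r := (c + a) / 2.
rewrite (seg_int_rev F r p) (seg_int_rev F p q) (seg_int_rev F q r); zmod.
Qed.

Definition perimeter (a b c : C) : R := nr (b - a) + nr (c - b) + nr (a - c).

Lemma tri_bound (F : C -> V) a b c (M : R) :
  segc F (a, b) -> segc F (b, c) -> segc F (c, a) ->
  (forall z, segment (a, b) z \/ segment (b, c) z \/ segment (c, a) z -> nr (F z) <= M) ->
  nr (tri F a b c) <= perimeter a b c * M.
Proof.
move=> h1 h2 h3 hM; rewrite /perimeter !mulrDl.
apply: (le_trans (nrD _ _)); apply: lerD; first (apply: (le_trans (nrD _ _)); apply: lerD).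
- by apply: seg_int_bound => // z hz; apply: hM; left.
- by apply: seg_int_bound => // z hz; apply: hM; right; left.
- by apply: seg_int_bound => // z hz; apply: hM; right; right.
Qed.

Lemma tri_primitive (F P : C -> V) a b c : (forall z, cderiv P z (F z)) -> (forall z, ccont F z) ->
  tri F a b c = 0.
Proof.
move=> hP hF; rewrite /tri !(seg_int_ftc hV (F := P)) /=; [zmod| | | | | |] => //;
  by apply: segc_ccont => z _; exact: hF.
Qed.

Lemma nr_midC (a b : C) : nr ((a + b) / 2 - a) = nr (b - a) / 2.
Proof. by rewrite midC nrM nrV (nr_nat _ 2). Qed.

Lemma perimeter_mid (a b c : C) :
  [/\ perimeter a ((a + b) / 2) ((c + a) / 2) = perimeter a b c / 2,
      perimeter ((a + b) / 2) b ((b + c) / 2) = perimeter a b c / 2,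
      perimeter ((c + a) / 2) ((b + c) / 2) c = perimeter a b c / 2 &
      perimeter ((b + c) / 2) ((c + a) / 2) ((a + b) / 2) = perimeter a b c / 2].
Proof.
have h (x : C) : nr (x / 2) = nr x / 2 by rewrite nrM nrV (nr_nat _ 2).
have E (x y : C) : x = y / 2 -> nr x = nr y / 2 by move=> ->.
split; rewrite /perimeter.
- rewrite (E ((a + b) / 2 - a) (b - a)); last by field.
  rewrite (E ((c + a) / 2 - (a + b) / 2) (c - b)); last by field.
  rewrite (E (a - (c + a) / 2) (a - c)); last by field.
  by field.
- rewrite (E (b - (a + b) / 2) (b - a)); last by field.
  rewrite (E ((b + c) / 2 - b) (c - b)); last by field.
  rewrite (E ((a + b) / 2 - (b + c) / 2) (a - c)); last by field.
  by field.
- rewrite (E ((b + c) / 2 - (c + a) / 2) (b - a)); last by field.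
  rewrite (E (c - (b + c) / 2) (c - b)); last by field.
  rewrite (E ((c + a) / 2 - c) (a - c)); last by field.
  by field.
- rewrite (E ((c + a) / 2 - (b + c) / 2) (a - b)); last by field.
  rewrite (E ((a + b) / 2 - (c + a) / 2) (b - c)); last by field.
  rewrite (E ((b + c) / 2 - (a + b) / 2) (c - a)); last by field.
  rewrite (nrBC a b) (nrBC b c) (nrBC c a); by field.
Qed.

Lemma perimeter_ge (a b c : C) : [/\ nr (b - a) <= perimeter a b c, nr (c - a) <= perimeter a b c,
   nr ((b + c) / 2 - a) <= perimeter a b c, nr ((a + b) / 2 - a) <= perimeter a b c &
   nr ((c + a) / 2 - a) <= perimeter a b c].
Proof.
have := nr_ge0 (b - a); have := nr_ge0 (c - b); have := nr_ge0 (a - c); rewrite /perimeter => h1 h2 h3.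
split.
- lra.
- by rewrite nrBC; lra.
- have -> : (b + c) / 2 - a = (b - a) / 2 + (c - a) / 2 by field.
  by apply: (le_trans (nrD _ _)); rewrite !nrM !nrV (nr_nat _ 2) (nrBC c a); lra.
- by rewrite nr_midC; lra.
- by rewrite [c + a]addrC nr_midC nrBC; lra.
Qed.

Lemma segment_mid (a b : C) : segment (a, b) ((a + b) / 2).
Proof.
exists 2^-1; first by apply/andP; split; lra.
by rewrite /seg_pt fmorphV /= rmorph_nat; field.
Qed.

(** One of the four triangles cut off by the midpoints keeps a quarter of the integral, while the
    squared perimeter is also divided by 4. At the common point of the nested triangles [F] is
    affine up to a small error, and the affine part has an explicit primitive. *)
Lemma goursat (X : set C) (F : C -> V) : nr_closed X -> convexC X ->
  (forall z, X z -> exists D, cderiv F z D) ->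
  forall a b c, X a -> X b -> X c -> tri F a b c = 0.
Proof.
move=> clX cvX hF.
have segX a b : X a -> X b -> segc F (a, b).
  move=> Xa Xb; apply: segc_ccont => z hz; have [D /cderiv_ccont //] := hF _ (cvX _ _ Xa Xb _ hz).
have midX a b : X a -> X b -> X ((a + b) / 2).
  by move=> Xa Xb; apply: (cvX _ _ Xa Xb); exact: segment_mid.
move=> a b c Xa Xb Xc.
suff small (e : R) : 0 < e -> nr (tri F a b c) <= e * perimeter a b c ^+ 2.
  apply: nr_small0 => e e0; have P0 : 0 < perimeter a b c ^+ 2 + 1 by rewrite ltr_wpDl ?sqr_ge0.
  apply: (le_trans (small _ (divr_gt0 e0 P0))); rewrite mulrAC ler_pdivrMr //.
  by rewrite ler_wpM2l ?lerDl // ltW.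
move=> e0; have [//|bad0] := leP (nr (tri F a b c)) (e * perimeter a b c ^+ 2).
exfalso; move: bad0.
pose Bad (T : C * C * C) := [/\ X T.1.1, X T.1.2, X T.2 &
  e * perimeter T.1.1 T.1.2 T.2 ^+ 2 < nr (tri F T.1.1 T.1.2 T.2)].
have step T : Bad T -> exists T', [/\ Bad T', perimeter T'.1.1 T'.1.2 T'.2 = perimeter T.1.1 T.1.2 T.2 / 2 &
    nr (T'.1.1 - T.1.1) <= perimeter T.1.1 T.1.2 T.2].
  case: T => -[u v] w [/= Xu Xv Xw bad].
  have [p1 p2 p3 p4] := perimeter_mid u v w.
  have [g1 g2 g3 g4 g5] := perimeter_ge u v w.
  have sp := tri_split (segX _ _ Xu Xv) (segX _ _ Xv Xw) (segX _ _ Xw Xu).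
  have m1 := midX _ _ Xu Xv; have m2 := midX _ _ Xv Xw; have m3 := midX _ _ Xw Xu.
  pose q := e * (perimeter u v w / 2) ^+ 2.
  have [t1|t1] := leP (nr (tri F u ((u + v) / 2) ((w + u) / 2))) q; last first.
    exists (u, (u + v) / 2, (w + u) / 2); split=> //=; first by split=> //=; rewrite p1.
    by rewrite subrr nr0; apply: le_trans g1; exact: nr_ge0.
  have [t2|t2] := leP (nr (tri F ((u + v) / 2) v ((v + w) / 2))) q; last first.
    by exists ((u + v) / 2, v, (v + w) / 2); split=> //=; split=> //=; rewrite p2.
  have [t3|t3] := leP (nr (tri F ((w + u) / 2) ((v + w) / 2) w)) q; last first.
    by exists ((w + u) / 2, (v + w) / 2, w); split=> //=; split=> //=; rewrite p3.
  have [t4|t4] := leP (nr (tri F ((v + w) / 2) ((w + u) / 2) ((u + v) / 2))) q; last first.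
    by exists ((v + w) / 2, (w + u) / 2, (u + v) / 2); split=> //=; split=> //=; rewrite p4.
  exfalso; move: bad; apply/negP; rewrite -leNgt sp.
  have -> : e * perimeter u v w ^+ 2 = q + q + q + q by rewrite /q; field.
  apply: (le_trans (nrD _ _)); apply: lerD => //.
  apply: (le_trans (nrD _ _)); apply: lerD => //.
  by apply: (le_trans (nrD _ _)); apply: lerD.
move=> bad0; have bad : Bad (a, b, c) by split.
have [x [p [badx Lx dx]]] := bisection (pt := fun T : C * C * C => T.1.1)
   (L := fun T => perimeter T.1.1 T.1.2 T.2) step bad.
rewrite /= in Lx dx; set L0 := perimeter a b c in Lx dx.
have Xp : X p.
  apply: clX => d d0; have [n hn] := exp2_small (2 * L0) d0.
  by exists (x n).1.1; [have [] := badx n|apply: le_lt_trans (dx n) _; rewrite mulrA].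
have [D hD] := hF _ Xp.
(* The marked vertex is within two perimeters of [p], hence the whole triangle within three; the
   divisor 3 absorbs this. *)
have [d d0 hd] := hD _ (divr_gt0 e0 (ltr0n R 3)).
have [n hn] := exp2_small (3 * L0) d0.
move: (badx n) (dx n) (Lx n); case: (x n) => -[u v] w [/= Xu Xv Xw +] du Ln.
apply/negP; rewrite -leNgt.
have [g1 g2 _ _ _] := perimeter_ge u v w.
have P0 : 0 <= perimeter u v w by apply: le_trans g1; exact: nr_ge0.
pose aff z := F p + (z - p) *: D.
pose rem z := F z + (-1 : C) *: aff z.
have daff z : cderiv aff z D.
  have h1 := cderivD (cderiv_cst (F p) z) (cderivZ (cderivD (cderiv_id z) (cderiv_cst (- p) z)) (cderiv_cst D z)).
  by move: h1; apply: cderiv_eq; rewrite scaler0 !add0r addr0 scale1r.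
have aff0 a' b' c' : tri aff a' b' c' = 0.
  apply: (@tri_primitive _ (fun z => (z - p) *: F p + (2^-1 *: ((z - p) ^+ 2 : C) : C) *: D)); last first.
    by move=> z; exact: cderiv_ccont (daff z).
  move=> z; have sub : cderiv (fun z : C => z - p) z 1.
    by have := cderivD (cderiv_id z) (cderiv_cst (- p) z); apply: cderiv_eq; rewrite addr0.
  have h1 := cderivZ sub (cderiv_cst (F p) z).
  have h2 := cderivZ (cderivZ (cderiv_cst (2^-1 : C) z) (cderivX 2 sub)) (cderiv_cst D z).
  have := cderivD h1 h2; apply: cderiv_eq; rewrite /aff !scaler0 !add0r scale1r scale0r addr0.
  by congr (_ + _ *: _); rewrite -![_ *: _]/(_ * _) /= expr1 mulr1 mulKf // pnatr_eq0.
have caff e' : segc aff e' by apply: segc_ccont => z _; exact: cderiv_ccont (daff z).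
have caff' e' : segc (fun z => (-1 : C) *: aff z) e'.
  exact: (@ucont01_linear _ _ _ (fun v : V => (-1 : C) *: v) (fun t => aff (seg_pt e' t)) (bounded_linear_scale V (-1)) (caff e')).
have triF : tri F u v w = tri rem u v w.
  rewrite {2}/tri /rem !seg_intD ?(seg_int_linear hV (bounded_linear_scale V (-1))) //; try exact: segX.
  by have := aff0 u v w; rewrite /tri => h; rewrite !scaleN1r -[LHS]subr0 -h /tri; zmod.
rewrite triF.
have crem a' b' : X a' -> X b' -> segc rem (a', b').
  by move=> Xa' Xb'; apply: segcD => //; exact: segX.
apply: (@le_trans _ _ (perimeter u v w * (e / 3 * (3 * perimeter u v w)))); last first.
  by rewrite le_eqVlt; apply/orP; left; apply/eqP; field.
apply: tri_bound; try exact: crem.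
have near z a' b' : (a' = u \/ a' = v \/ a' = w) -> (b' = u \/ b' = v \/ b' = w) ->
    segment (a', b') z -> nr (z - p) <= 3 * perimeter u v w.
  have nv a'' : (a'' = u \/ a'' = v \/ a'' = w) -> nr (a'' - p) <= 3 * perimeter u v w.
    have up : nr (u - p) <= 2 * perimeter u v w by rewrite Ln.
    by case=> [|[|]] ->; [lra| |]; apply: (le_trans (nr_tri u _ _)); lra.
  by move=> ha hb hz; apply: segment_nr hz _ _; exact: nv.
move=> z hz; have zp : nr (z - p) <= 3 * perimeter u v w.
  by case: hz => [|[|]]; apply: near; tauto.
have -> : rem z = F z - F p - (z - p) *: D by rewrite /rem /aff scaleN1r; zmod.
apply: (@le_trans _ _ (e / 3 * nr (z - p))); last by apply: ler_wpM2l => //; rewrite divr_ge0 ?ltW.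
by apply: hd; apply: le_lt_trans zp _; rewrite Ln mulrA.
Qed.


End Goursat.

(** * Goursat's theorem on squares *)

Section Squares.
Variable R : realType.
Local Notation C := (R[i] : numFieldType).
Local Notation hC := (@complex_nr_complete R).

(** Half-planes are written with one complex direction [u], so that the sides of a square and the
    cuts near a vertex are instances of one shape. *)
Lemma nr_closed_ge (u z : C) (c : R) : nr_closed [set w | c <= complex.Re (u * (w - z))].
Proof.
move=> x hx /=; apply/ler_addgt0Pr => e e0.
have A0 : 0 < nr u + 1 by rewrite ltr_wpDl ?nr_ge0.
have [y /= hy yx] := hx _ (divr_gt0 e0 A0).
apply: (le_trans hy); rewrite -lerBlDl.
have -> : complex.Re (u * (y - z)) - complex.Re (u * (x - z)) = complex.Re (u * (y - x)).
  by rewrite -raddfB /=; congr complex.Re; ring.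
apply: (le_trans (ler_norm _)); apply: (le_trans (nr_Re _)); rewrite nrM.
rewrite ltr_pdivlMr // in yx; have := nr_ge0 (y - x); nra.
Qed.

Lemma convexC_ge (u z : C) (c : R) : convexC [set w | c <= complex.Re (u * (w - z))].
Proof.
move=> a b /= ha hb w [t /andP[t0 t1] ->] /=; rewrite /seg_pt /=.
have -> : u * (a + t%:C * (b - a) - z) = (1 - t)%:C * (u * (a - z)) + t%:C * (u * (b - z)).
  by rewrite rmorphB /= rmorph1; ring.
rewrite raddfD /=; move: ha hb; move: (u * (a - z)) (u * (b - z)) => [x y] [x' y'] /=.
rewrite !mul0r !subr0; nra.
Qed.

Lemma nr_closedI (X Y : set C) : nr_closed X -> nr_closed Y -> nr_closed (X `&` Y).
Proof.
move=> hX hY x hx; split; [apply: hX|apply: hY] => e /hx [y [Xy Yy] yx]; by exists y.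
Qed.

Lemma convexCI (X Y : set C) : convexC X -> convexC Y -> convexC (X `&` Y).
Proof. by move=> hX hY a b [Xa Ya] [Xb Yb] z hz; split; [exact: hX hz|exact: hY hz]. Qed.

Section Vertex.
Variable V : normedModType C.
Hypothesis hV : nr_complete V.

(* Only continuity is assumed at the vertex z; the half-plane conditions keep the
   opposite side away from z. *)
Lemma goursat_vertex (X : set C) (F : C -> V) (z u : C) (M : R) : nr_closed X -> convexC X -> X z ->
  (forall w, X w -> w != z -> exists D, cderiv F w D) -> ccont F z ->
  (forall w, X w -> nr (F w) <= M) ->
  forall a b, X a -> X b -> 0 < complex.Re (u * (a - z)) -> 0 < complex.Re (u * (b - z)) ->
  tri F z a b = 0.
Proof.
move=> clX cvX Xz hF cF hM a b Xa Xb ra rb.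
have cX w : X w -> ccont F w.
  move=> Xw; have [->//|/(hF _ Xw)[D]] := eqVneq w z; exact: cderiv_ccont.
have sX a' b' : X a' -> X b' -> segc F (a', b').
  by move=> Xa' Xb'; apply: segc_ccont => w hw; apply: cX; exact: cvX hw.
have mX a' b' : X a' -> X b' -> X ((a' + b') / 2).
  by move=> Xa' Xb'; apply: (cvX _ _ Xa' Xb'); exact: segment_mid.
apply: nr_small0 => e e0.
(* Of the four triangles of the midpoint subdivision only the corner at [z] can contribute.
   Iterating halves its perimeter each time while [F] stays bounded by [M]. *)
suff h n : nr (tri F z a b) <= perimeter z a b / 2 ^+ n * M.
  have [n hn] := exp2_small (perimeter z a b * M) e0; apply: (le_trans (h n)).
  by rewrite mulrAC ltW.
elim: n a b Xa Xb ra rb => [|n IH] a b Xa Xb ra rb.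
  rewrite expr0 divr1; apply: (tri_bound hV); try exact: sX.
  by move=> w [|[]] hw; apply: hM; apply: cvX hw.
have m1 := mX _ _ Xz Xa; have m2 := mX _ _ Xa Xb; have m3 := mX _ _ Xb Xz.
pose c := Num.min (complex.Re (u * (a - z))) (complex.Re (u * (b - z))) / 2.
have c0 : 0 < c by rewrite divr_gt0 // lt_min ra.
have ca : 2 * c <= complex.Re (u * (a - z)) by rewrite /c mulrC divfK // ge_min lexx.
have cb : 2 * c <= complex.Re (u * (b - z)) by rewrite /c mulrC divfK // ge_min lexx orbT.
have half (x : C) : complex.Re (x / 2) = complex.Re x / 2.
  have -> : x / 2 = (2^-1)%:C * x by rewrite mulrC fmorphV /= rmorph_nat.
  by case: x => x y /=; rewrite mul0r subr0 mulrC.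
pose Y := X `&` [set w | c <= complex.Re (u * (w - z))].
have clY : nr_closed Y by apply: nr_closedI => //; exact: nr_closed_ge.
have cvY : convexC Y by apply: convexCI => //; exact: convexC_ge.
have dY w : Y w -> exists D, cderiv F w D.
  move=> [Xw /= cw]; apply: hF => //; apply: contraTneq cw => ->.
  by rewrite subrr mulr0 -ltNge.
have Ya : Y a by split=> //=; lra.
have Yb : Y b by split=> //=; lra.
have Yza : Y ((z + a) / 2).
  split=> //=; have -> : u * ((z + a) / 2 - z) = u * (a - z) / 2 by field.
  by rewrite half; lra.
have Ybz : Y ((b + z) / 2).
  split=> //=; have -> : u * ((b + z) / 2 - z) = u * (b - z) / 2 by field.
  by rewrite half; lra.
have Yab : Y ((a + b) / 2) by apply: (cvY a b) => //; exact: segment_mid.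
have [p1 _ _ _] := perimeter_mid z a b.
rewrite (tri_split hV (sX _ _ Xz Xa) (sX _ _ Xa Xb) (sX _ _ Xb Xz)).
rewrite (goursat hV clY cvY dY Yza Ya Yab) (goursat hV clY cvY dY Ybz Yab Yb).
rewrite (goursat hV clY cvY dY Yab Ybz Yza) !addr0.
have -> : perimeter z a b / 2 ^+ n.+1 = perimeter z ((z + a) / 2) ((b + z) / 2) / 2 ^+ n.
  by rewrite p1 exprS invfM mulrA.
by apply: IH => //; [case: Yza => _ /=|case: Ybz => _ /=]; lra.
Qed.

End Vertex.

Definition square (p : C) (s : R) : set C :=
  [set w | 0 <= complex.Re (w - p) <= s /\ 0 <= complex.Im (w - p) <= s].

Definition square_in (p : C) (s : R) : set C :=
  [set w | 0 < complex.Re (w - p) < s /\ 0 < complex.Im (w - p) < s].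

Definition square_cycle (p : C) (s : R) : seq (seq C) :=
  [:: [:: p; p + (s +i* 0); p + (s +i* s); p + (0 +i* s)]].

(** Multiplication by [0 -i* 1] turns imaginary parts into real parts, so all four sides become
    half-planes of the shape above; closedness and convexity follow from theirs. *)
Lemma square_half_planes p s : square p s =
  ([set w | 0 <= complex.Re (1 * (w - p))] `&` [set w | - s <= complex.Re ((-1) * (w - p))]) `&`
  ([set w | 0 <= complex.Re ((0 -i* 1) * (w - p))] `&` [set w | - s <= complex.Re ((0 +i* 1) * (w - p))]).
Proof.
apply/seteqP; split => w; rewrite /square /=; move: (w - p) => [x y] /=;
  rewrite !(mul1r, mul0r, mulN1r, subr0, sub0r, oppr0, opprK).
  by move=> [/andP[a b] /andP[c d]]; rewrite !lerN2.
by move=> [[a b] [c d]]; rewrite !lerN2 in b d; split; apply/andP.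
Qed.

Lemma nr_closed_square p s : nr_closed (square p s).
Proof. by rewrite square_half_planes; do 2?apply: nr_closedI; exact: nr_closed_ge. Qed.

Lemma convexC_square p s : convexC (square p s).
Proof. by rewrite square_half_planes; do 2?apply: convexCI; exact: convexC_ge. Qed.

Lemma square_diam p s w : square p s w -> nr (w - p) <= 2 * s.
Proof.
move=> [/andP[a b] /andP[c d]]; apply: (le_trans (nr_ReIm _)); rewrite !ger0_norm //; lra.
Qed.

Lemma compact_square p s : compact (square p s).
Proof.
apply: compact_of_closed_bounded; first exact: nr_closed_square.
exists (2 * s + nr p) => w /square_diam h; have := nr_lower w p; lra.
Qed.

Lemma square_vertices p s : 0 <= s -> [/\ square p s p, square p s (p + (s +i* 0)),
  square p s (p + (s +i* s)) & square p s (p + (0 +i* s))].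
Proof.
move=> s0; have E (x : C) : p + x - p = x by rewrite addrC addKr.
by rewrite /square; split=> /=; rewrite ?E ?subrr /= !lexx s0.
Qed.

Lemma square_cycle_intE (V : normedModType C) p s (F : C -> V) :
  cycle_int (square_cycle p s) F = seg_int (p, p + (s +i* 0)) F +
   seg_int (p + (s +i* 0), p + (s +i* s)) F + seg_int (p + (s +i* s), p + (0 +i* s)) F +
   seg_int (p + (0 +i* s), p) F.
Proof. by rewrite /cycle_int /cycle_edges /= !big_cons big_nil addr0 !addrA. Qed.

Lemma square_trace p s w : 0 <= s -> cycle_trace (square_cycle p s) w ->
  square p s w /\ [\/ complex.Re (w - p) = 0, complex.Re (w - p) = s,
     complex.Im (w - p) = 0 | complex.Im (w - p) = s].
Proof.
move=> s0; rewrite cycle_traceE => -[e he hw].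
have [v0 v1 v2 v3] := square_vertices p s0.
have cv := @convexC_square p s; move: hw.
have E (x : C) : p + x - p = x by rewrite addrC addKr.
move: he; rewrite !inE => /or4P[]/eqP -> hw; (split; first by apply: cv hw); case: hw => t _ ->;
  rewrite /seg_pt /=.
- by rewrite [p + _ - p]E E; apply: Or43; rewrite /= mulr0 mul0r addr0.
- have -> : p + (s +i* 0) + t%:C * (p + (s +i* s) - (p + (s +i* 0))) - p = (s +i* 0) + t%:C * ((s +i* s) - (s +i* 0)) by ring.
  by apply: Or42; rewrite /= subrr mulr0 mul0r subr0 addr0.
- have -> : p + (s +i* s) + t%:C * (p + (0 +i* s) - (p + (s +i* s))) - p = (s +i* s) + t%:C * ((0 +i* s) - (s +i* s)) by ring.
  by apply: Or44; rewrite /= subrr mulr0 mul0r !addr0.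
- have -> : p + (0 +i* s) + t%:C * (p - (p + (0 +i* s))) - p = (0 +i* s) + t%:C * (- (0 +i* s)) by ring.
  by apply: Or41; rewrite /= oppr0 mulr0 mul0r subr0 addr0.
Qed.

Lemma square_edges p s e : 0 <= s -> e \in cycle_edges (square_cycle p s) -> square p s e.1 /\ square p s e.2.
Proof.
move=> s0; have [v0 v1 v2 v3] := square_vertices p s0.
by rewrite !inE => /or4P[]/eqP ->.
Qed.

Section SquareCauchy.
Variable V : normedModType C.
Hypothesis hV : nr_complete V.

Lemma square_goursat p s (F : C -> V) : 0 <= s ->
  (forall z, square p s z -> exists D, cderiv F z D) -> cycle_int (square_cycle p s) F = 0.
Proof.
move=> s0 hF; have [v0 v1 v2 v3] := square_vertices p s0.
have g := goursat hV (@nr_closed_square p s) (@convexC_square p s) hF.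
have := g _ _ _ v0 v1 v2; have := g _ _ _ v0 v2 v3.
rewrite square_cycle_intE /tri => h1 h2.
rewrite -[RHS]addr0 -{1}h2 -h1 (seg_int_rev F p (p + (s +i* s))); zmod.
Qed.

(** The square is cut into four triangles with apex [z], one on each side. The direction [u] is the
    conjugate of the outward normal of that side. *)
Lemma square_goursat_point p s (F : C -> V) z : square_in p s z ->
  (forall w, square p s w -> w != z -> exists D, cderiv F w D) -> ccont F z ->
  cycle_int (square_cycle p s) F = 0.
Proof.
move=> [/andP[z1 z2] /andP[z3 z4]] hF cF.
have s0 : 0 <= s by lra.
have Xz : square p s z by split; apply/andP; split; exact: ltW.
have [v0 v1 v2 v3] := square_vertices p s0.
have [M M0 hM] : exists2 M : R, 0 < M & forall w, square p s w -> nr (F w) <= M.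
  apply: ccont_bounded; first exact: compact_square.
  move=> w sw; have [->//|/(hF _ sw)[D]] := eqVneq w z; exact: cderiv_ccont.
have g u := goursat_vertex hV (u := u) (@nr_closed_square p s) (@convexC_square p s) Xz hF cF hM.
have t1 : tri F z p (p + (s +i* 0)) = 0.
  apply: (g (0 +i* 1)) => //.
    by move: z3 z4; rewrite -opprB; move: (p - z) => [x y] /=; lra.
  by have -> : p + (s +i* 0) - z = (s +i* 0) - (z - p) by [ring|]; move: z3 z4; move: (z - p) => [x y] /=; lra.
have t2 : tri F z (p + (s +i* 0)) (p + (s +i* s)) = 0.
  apply: (g 1) => //; rewrite mul1r.
    by have -> : p + (s +i* 0) - z = (s +i* 0) - (z - p) by [ring|]; move: z1 z2; move: (z - p) => [x y] /=; lra.
  by have -> : p + (s +i* s) - z = (s +i* s) - (z - p) by [ring|]; move: z1 z2; move: (z - p) => [x y] /=; lra.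
have t3 : tri F z (p + (s +i* s)) (p + (0 +i* s)) = 0.
  apply: (g (0 -i* 1)) => //.
    by have -> : p + (s +i* s) - z = (s +i* s) - (z - p) by [ring|]; move: z3 z4; move: (z - p) => [x y] /=; lra.
  by have -> : p + (0 +i* s) - z = (0 +i* s) - (z - p) by [ring|]; move: z3 z4; move: (z - p) => [x y] /=; lra.
have t4 : tri F z (p + (0 +i* s)) p = 0.
  apply: (g (-1)) => //; rewrite mulN1r.
    by have -> : p + (0 +i* s) - z = (0 +i* s) - (z - p) by [ring|]; move: z1 z2; move: (z - p) => [x y] /=; lra.
  by rewrite opprB.
rewrite square_cycle_intE.
have : tri F z p (p + (s +i* 0)) + tri F z (p + (s +i* 0)) (p + (s +i* s)) +
   tri F z (p + (s +i* s)) (p + (0 +i* s)) + tri F z (p + (0 +i* s)) p = 0.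
  by rewrite t1 t2 t3 t4 !addr0.
move=> <-; rewrite /tri (seg_int_rev F z p) (seg_int_rev F z (p + (s +i* 0))).
rewrite (seg_int_rev F z (p + (s +i* s))) (seg_int_rev F z (p + (0 +i* s))); zmod.
Qed.

End SquareCauchy.
End Squares.

(** * The logarithmic integral along one side of a square *)

Section SquareWinding.
Variable R : realType.
Local Notation C := (R[i] : numFieldType).
Local Notation hC := (@complex_nr_complete R).

Lemma derive_epsP (K : numFieldType) (f : K -> K) (x df : K) :
  h^-1 *: ((f \o shift x) (h *: (1 : K)) - f x) @[h --> 0^'] --> df <->
  forall e : K, 0 < e -> exists2 d : K, 0 < d &
    forall h, `|h| < d -> `|f (x + h) - f x - h * df| <= e * `|h|.
Proof.
split=> [/cvgrPdist_le H e e0|H].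
  have /nbhs_ballP [d /= d0 hd] := H _ e0; exists d => // h hh.
  have [->|h0] := eqVneq h 0; first by rewrite addr0 subrr mul0r subrr normr0 mulr0.
  have := hd h; rewrite -ball_normE /= sub0r normrN => /(_ hh h0).
  rewrite /= -[h *: 1]/(h * 1) mulr1 (addrC h x) => {}hd.
  have -> : f (x + h) - f x - h * df = - (h * (df - h^-1 * (f (x + h) - f x))) by field.
  by rewrite normrN normrM mulrC ler_wpM2r.
apply/cvgrPdist_le => e e0; have [d d0 hd] := H _ e0.
apply/nbhs_ballP; exists d => //= h; rewrite -ball_normE /= sub0r normrN => hh h0.
rewrite /= -[h *: 1]/(h * 1) mulr1 (addrC h x) -[_ *: _]/(_ * _).
have hn : 0 < `|h| by rewrite normr_gt0.
rewrite -(ler_pM2r hn) -normrM; apply: le_trans (hd _ hh).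
by rewrite -normrN; have -> : - ((df - h^-1 * (f (x + h) - f x)) * h) = f (x + h) - f x - h * df by field.
Qed.

Lemma derivable_cderivP (f : C -> C) (z : C) : derivable f z 1 <-> exists D, cderiv f z D.
Proof.
have key (D : C) : cderiv f z D <-> (forall e : C, 0 < e -> exists2 d : C, 0 < d &
    forall h, `|h| < d -> `|f (z + h) - f z - h * D| <= e * `|h|).
  split=> H.
    move=> e; case: e => e im; rewrite ltcE /= => /andP[/eqP -> e0].
    have [d d0 hd] := H _ e0; exists d%:C; first by rewrite ltcR.
    move=> h; rewrite -[e +i* 0]/(e%:C) !normE ltcR -rmorphM lecR => hh.
    by have := hd (z + h); rewrite addrC addKr; apply.
  move=> e e0; have [|d d0 hd] := H e%:C; first by rewrite ltcR.
  case: d d0 hd => d im; rewrite ltcE /= => /andP[/eqP -> d0] hd.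
  exists d => // w wd; have := hd (w - z); rewrite -[d +i* 0]/(d%:C) !normE ltcR -rmorphM lecR => /(_ wd).
  by rewrite [z + _]addrC subrK.
split; first by move=> /cvg_ex [D /derive_epsP hD]; exists D; apply/key.
by move=> [D /key /derive_epsP hD]; apply/cvg_ex; exists D.
Qed.

Lemma is_derive_eps (f : R -> R) (x df : R) : is_derive x 1 f df ->
  forall e : R, 0 < e -> exists2 d : R, 0 < d &
    forall h, `|h| < d -> `|f (x + h) - f x - h * df| <= e * `|h|.
Proof.
by case=> h1 h2; apply/derive_epsP; rewrite -h2; exact: h1.
Qed.

(* The integral of 1 / z along one side of a square centred at the origin. *)
Lemma unit_int_atan : unit_int (fun t => ((2 * t - 1)%:C - 'i)^-1 : C) = (pi / 4)%:C * 'i.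
Proof.
pose e : C * C := (-1, 1).
have pt t : seg_pt e t = (2 * t - 1)%:C.
  by rewrite /seg_pt /e /= rmorphB rmorphM /= rmorph1 rmorph_nat; ring.
have ne z (r : R) : segment e z -> z != 0 +i* 1 /\ z != 0 -i* 1.
  by move=> [t _ ->]; rewrite pt !eq_complex /= ![0 == _]eq_sym oppr_eq0 oner_eq0 !andbF.
have c1 : ucont01 (fun t => ((2 * t - 1)%:C - 'i)^-1 : C).
  have : segc (fun z : C => (z - 'i)^-1 : C) e.
    by apply: segc_ccont => z /(ne _ 0)[h _]; exact: cderiv_ccont (cderiv_subV h).
  by rewrite /segc (_ : (fun t => _) = (fun t => ((2 * t - 1)%:C - 'i)^-1 : C)) //; apply/funext => t; rewrite pt.
have c2 : ucont01 (fun t => ((2 * (1 - t) - 1)%:C - 'i)^-1 : C).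
  have : segc (fun z : C => (-1 : C) *: ((z - (- 'i))^-1 : C)) e.
    apply: segc_ccont => z /(ne _ 0)[_ h]; apply: cderiv_ccont; apply: cderivZ; first exact: cderiv_cst.
    by apply: cderiv_subV; rewrite (_ : - 'i = 0 -i* 1) //; apply/eqP; rewrite eq_complex /= oppr0 !eqxx.
  rewrite /segc (_ : (fun t => _) = (fun t => ((2 * (1 - t) - 1)%:C - 'i)^-1 : C)) //; apply/funext => t.
  rewrite pt scaleN1r -invrN; congr (_^-1); rewrite !rmorphB !rmorphM rmorphB /= rmorph1 rmorph_nat; ring.
(* Adding the value at [1 - t] cancels the real part; what remains is ['i] times the derivative of
   [atan (2 * t - 1)]. *)
pose h (t : R) := (2 / (1 + (2 * t - 1) ^+ 2)).
have E t : ((2 * t - 1)%:C - 'i)^-1 + ((2 * (1 - t) - 1)%:C - 'i)^-1 = (h t)%:C * 'i :> C.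
  have -> : 2 * (1 - t) - 1 = - (2 * t - 1) by ring.
  rewrite /h; move: (2 * t - 1) => u.
  have u1 : 1 + u ^+ 2 != 0 by rewrite gt_eqF // ltr_pwDl // sqr_ge0.
  have n1 : u%:C - 'i != 0 :> C by rewrite eq_complex /= sub0r oppr_eq0 oner_eq0 andbF.
  have n2 : (- u)%:C - 'i != 0 :> C by rewrite eq_complex /= sub0r oppr_eq0 oner_eq0 andbF.
  have i2 : 'i * 'i = -1 :> C by rewrite -expr2 sqr_i.
  have P : (u%:C - 'i) * ((- u)%:C - 'i) = - (1 + u ^+ 2)%:C :> C.
    rewrite rmorphD rmorphN rmorphXn /= rmorph1.
    have -> : (u%:C - 'i) * (- u%:C - 'i) = 'i * 'i - u%:C ^+ 2 :> C by ring.
    by rewrite i2; ring.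
  have S : (u%:C - 'i) + ((- u)%:C - 'i) = - (2 * 'i) :> C by rewrite rmorphN /=; ring.
  have u1' : (1 + u ^+ 2)%:C != 0 :> C by rewrite eq_complex /= eqxx andbT.
  have -> : (u%:C - 'i)^-1 + ((- u)%:C - 'i)^-1 = ((u%:C - 'i) + ((- u)%:C - 'i)) / ((u%:C - 'i) * ((- u)%:C - 'i)) :> C.
    by move: n1 n2; move: (u%:C - 'i) ((- u)%:C - 'i) => a b a0 b0; field; rewrite a0 b0.
  rewrite S P rmorphM fmorphV /= rmorph_nat.
  by move: u1'; move: (1 + u ^+ 2)%:C => y y0; field.
have J : unit_int (fun t => (h t)%:C * 'i : C) = (pi / 2)%:C * 'i.
  have ch : ucont01 (fun t => (h t)%:C * 'i : C).
    by have := ucont01D c1 c2; rewrite (_ : (fun t => _ + _) = (fun t => (h t)%:C * 'i)) //; apply/funext => t; exact: E.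
  rewrite (unit_int_ftc hC (P := fun t => (atan (2 * t - 1))%:C * 'i) ch).
    rewrite mulr1 mulr0 sub0r atanN -mulrBl -rmorphB /=; congr (_%:C * _).
    by rewrite (_ : 2 - 1 = 1) ?atan1 //; [field|ring].
  move=> t t01 eps eps0.
  have [d d0 hd] := is_derive_eps (is_derive1_atan (2 * t - 1)) (divr_gt0 eps0 (ltr0n R 2)).
  exists (d / 2); first by rewrite divr_gt0.
  move=> s s01 st; have := hd (2 * (s - t)).
  have -> : 2 * t - 1 + 2 * (s - t) = 2 * s - 1 by ring.
  rewrite normrM ger0_norm // => hd'.
  have -> : (atan (2 * s - 1))%:C * 'i - (atan (2 * t - 1))%:C * 'i - (s - t)%:C *: ((h t)%:C * 'i) =
     (atan (2 * s - 1) - atan (2 * t - 1) - 2 * (s - t) * (1 + (2 * t - 1) ^+ 2)^-1)%:C * 'i :> C.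
    rewrite -[_ *: _]/(_ * _) mulrA -!mulrBl -rmorphM -!rmorphB; congr (_%:C * _); rewrite /h; ring.
  rewrite nrM nr_real (_ : nr ('i : C) = 1) ?mulr1; last first.
    exact: nr_i.
  by apply: (le_trans (hd' _)); lra.
have R2 : unit_int (fun t => ((2 * (1 - t) - 1)%:C - 'i)^-1 : C) = unit_int (fun t => ((2 * t - 1)%:C - 'i)^-1 : C).
  exact: (unit_int_reverse (fun t => ((2 * t - 1)%:C - 'i)^-1 : C)).
have D := unit_intD hC c1 c2.
have E' : unit_int (fun t => ((2 * t - 1)%:C - 'i)^-1 + ((2 * (1 - t) - 1)%:C - 'i)^-1 : C) =
   unit_int (fun t => (h t)%:C * 'i : C) by apply: unit_int_ext => t _; exact: E.
move: D; rewrite E' J R2; move: (unit_int _) => X hX.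
have -> : X = (X + X) / 2 by field.
rewrite -hX; have -> : pi / 4 = (pi / 2) / 2 :> R by field.
by rewrite [in RHS]rmorphM /= fmorphV /= rmorph_nat; ring.
Qed.

End SquareWinding.

(** * Winding number and Cauchy's formula for squares *)

Section SquareCauchyFormula.
Variable R : realType.
Local Notation C := (R[i] : numFieldType).
Local Notation hC := (@complex_nr_complete R).

(** The form dl / (l - c) is invariant under scaling and rotation about [c]. Every side is the
    bottom side turned by some [k], so each contributes the same quarter of 2 pi i. *)
Lemma square_side_int (c : C) (s : R) (k : C) : 0 < s -> k != 0 ->
  seg_int (c + (s / 2)%:C * k * (-1 - 'i), c + (s / 2)%:C * k * (1 - 'i)) (fun l => (l - c)^-1 : C)
   = (pi / 2)%:C * 'i.
Proof.
move=> s0 k0; rewrite /seg_int /=.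
have S0 : (s / 2)%:C != 0 :> C by rewrite eq_complex /= eqxx andbT gt_eqF // divr_gt0.
set a := (s / 2)%:C * k.
have a0 : a != 0 by rewrite mulf_neq0.
have -> : c + a * (1 - 'i) - (c + a * (-1 - 'i)) = 2 * a by ring.
have E : unit_int (fun t => (seg_pt (c + a * (-1 - 'i), c + a * (1 - 'i)) t - c)^-1 : C) =
  unit_int (fun t => a^-1 *: (((2 * t - 1)%:C - 'i)^-1 : C)).
  apply: unit_int_ext => t _; rewrite /seg_pt /= -[_ *: _]/(_ * _) -invfM; congr (_^-1).
  by rewrite rmorphB rmorphM /= rmorph1 rmorph_nat; ring.
rewrite E (unit_int_linear hC (bounded_linear_scale C a^-1)).
  rewrite unit_int_atan -![_ *: _]/(_ * _).
  have -> : pi / 2 = 2 * (pi / 4) :> R by field.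
  by rewrite [in RHS]rmorphM /= rmorph_nat; field.
have : segc (fun z : C => (z - 'i)^-1 : C) (-1, 1).
  apply: segc_ccont => z [t _ ->]; apply: cderiv_ccont; apply: cderiv_subV.
  rewrite /seg_pt /= (_ : -1 + _ = (2 * t - 1)%:C); last first.
    by rewrite rmorphB rmorphM /= rmorph1 rmorph_nat; ring.
  by rewrite eq_complex /= ![0 == _]eq_sym oner_eq0 !andbF.
rewrite /segc (_ : (fun t => _) = (fun t => ((2 * t - 1)%:C - 'i)^-1 : C)) //; apply/funext => t.
by congr (_^-1); rewrite /seg_pt /= rmorphB rmorphM /= rmorph1 rmorph_nat; ring.
Qed.

Lemma square_winding_center p (s : R) : 0 < s ->
  cycle_int (square_cycle p s) (fun l => (l - (p + ((s / 2) +i* (s / 2))))^-1 : C) = two_pi_i R.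
Proof.
move=> s0; rewrite square_cycle_intE; set c := p + ((s / 2) +i* (s / 2)).
have i0 : 'i != 0 :> C by rewrite eq_complex /= oner_eq0 andbF.
have side k a b : k != 0 -> a - c = (s / 2)%:C * k * (-1 - 'i) -> b - c = (s / 2)%:C * k * (1 - 'i) ->
    seg_int (a, b) (fun l => (l - c)^-1 : C) = (pi / 2)%:C * 'i.
  move=> k0 ha hb; rewrite -(square_side_int c s0 k0) -ha -hb.
  by rewrite ![c + _]addrC !subrK.
have D x : p + x - c = x - ((s / 2) +i* (s / 2)) by rewrite /c; ring.
have D0 : p - c = - ((s / 2) +i* (s / 2)) by rewrite /c; ring.
have h : s / 2 + s / 2 = s by field.
have h1 : s - s / 2 = s / 2 by field.
(* The four sides are the bottom one turned by [1], ['i], [-1] and [- 'i]. *)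
rewrite (side 1) ?oner_neq0 ?D ?D0 // 1?(side 'i) ?D ?D0 // 1?(side (-1)) ?oppr_eq0 ?oner_neq0 ?D ?D0 // 1?(side (- 'i)) ?oppr_eq0 ?D ?D0 //; try
  by apply/eqP; rewrite eq_complex /= !(mul0r, mulr0, mulr1, mul1r, addr0, add0r, subr0, sub0r, oppr0, mulrN1, mulN1r, mulrN, mulNr, opprK, h1) !eqxx.
rewrite /two_pi_i; have -> : 2 * pi = pi / 2 + pi / 2 + pi / 2 + pi / 2 :> R by field.
by rewrite !rmorphD /= !mulrDl.
Qed.

(** The segment is walked in [N] steps of length at most [d / 2], the reach of
    [cycle_int_subV_local]. *)
Lemma cycle_int_subV_path G (a b : C) (d : R) : 0 < d ->
  (forall z l, segment (a, b) z -> cycle_trace G l -> d <= nr (l - z)) ->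
  cycle_int G (fun l => (l - b)^-1 : C) = cycle_int G (fun l => (l - a)^-1 : C).
Proof.
move=> d0 hd.
pose N := (Num.bound (nr (b - a) / (d / 2))).+1.
have N0 : 0 < N%:R :> R by rewrite ltr0n.
have hN : nr (b - a) / (d / 2) < N%:R.
  apply: (@lt_trans _ _ (Num.bound (nr (b - a) / (d / 2)))%:R); last by rewrite ltr_nat.
  by rewrite archi_boundP // divr_ge0 ?nr_ge0 ?divr_ge0 // ltW.
have d2 : 0 < d / 2 by rewrite divr_gt0.
rewrite (ltr_pdivrMr _ _ d2) in hN; clearbody N.
have step k : (k <= N)%N -> cycle_int G (fun l => (l - seg_pt (a, b) (k%:R / N%:R))^-1 : C) =
    cycle_int G (fun l => (l - a)^-1 : C).
  elim: k => [_|k IH kN].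
    by rewrite mul0r /seg_pt mul0r addr0.
  rewrite -IH; last exact: ltnW.
  clear IH; apply: (@cycle_int_subV_local _ _ _ _ d d0).
    move=> l; apply: hd; exists (k%:R / N%:R) => //.
    by rewrite divr_ge0 //= ler_pdivrMr // mul1r ler_nat ltnW.
  rewrite seg_pt_lip /= -mulrBl -natrB ?leqnSn // subSnn mul1r ger0_norm ?invr_ge0 ?ler0n //.
  by rewrite ler_pdivrMl //; exact: ltW.
have NN : N%:R / N%:R = 1 :> R by rewrite divff ?gt_eqF.
have := step N (leqnn N); rewrite NN.
by rewrite {1}/seg_pt mul1r /= [a + _]addrC subrK.
Qed.

Lemma square_winding p (s : R) z : square_in p s z ->
  cycle_int (square_cycle p s) (fun l => (l - z)^-1 : C) = two_pi_i R.
Proof.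
move=> [/andP[z1 z2] /andP[z3 z4]]; have s0 : 0 < s by lra.
rewrite -(square_winding_center p s0).
(* [m] is the distance of [z] to the nearest side. It is at most [s / 2], so it bounds the distance
   to the sides all along the segment from the centre to [z]. *)
set m := Num.min (Num.min (complex.Re (z - p)) (s - complex.Re (z - p)))
  (Num.min (complex.Im (z - p)) (s - complex.Im (z - p))).
have m0 : 0 < m by rewrite !lt_min z1 z3 !subr_gt0 z2 z4.
have m1 : m <= complex.Re (z - p) by rewrite /m !ge_min lexx.
have m2 : m <= s - complex.Re (z - p) by rewrite /m !ge_min lexx !orbT.
have m3 : m <= complex.Im (z - p) by rewrite /m !ge_min lexx !orbT.
have m4 : m <= s - complex.Im (z - p) by rewrite /m !ge_min lexx !orbT.
apply: (cycle_int_subV_path m0) => w l [t /andP[t0 t1] ->] /(square_trace (ltW s0))[_ hl].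
have -> : l - seg_pt (p + ((s / 2) +i* (s / 2)), z) t =
   (l - p) - ((1 - t)%:C * ((s / 2) +i* (s / 2)) + t%:C * (z - p)).
  by rewrite /seg_pt /= rmorphB /= rmorph1; ring.
move: m1 m2 m3 m4 hl; move: (z - p) (l - p) => [x y] [u v] /= m1 m2 m3 m4.
case=> e; [apply: le_trans (nr_Re _)|apply: le_trans (nr_Re _)|apply: le_trans (nr_Im _)|apply: le_trans (nr_Im _)];
  rewrite /= e !(mul0r, subr0, addr0) ?sub0r ?normrN;
  apply: le_trans (ler_norm _); nra.
Qed.

Variable V : normedModType C.
Hypothesis hV : nr_complete V.

Definition slope (F : C -> V) (z : C) (D : V) (w : C) : V :=
  if w == z then D else (w - z)^-1 *: (F w - F z).

Lemma slope_ccont (F : C -> V) (z : C) (D : V) : cderiv F z D -> ccont (slope F z D) z.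
Proof.
move=> hF e e0; have e2 : 0 < e / 2 by rewrite divr_gt0.
have [d d0 hd] := hF _ e2; exists d => // w wd.
rewrite /slope eqxx; case: eqP => [_|/eqP wz]; first by rewrite subrr nr0.
have wz' : w - z != 0 by rewrite subr_eq0.
have -> : (w - z)^-1 *: (F w - F z) - D = (w - z)^-1 *: (F w - F z - (w - z) *: D).
  by rewrite [RHS]scalerBr scalerA mulVf // scale1r.
rewrite nrZ nrV mulrC; apply: (@le_lt_trans _ _ (e / 2)); last by lra.
by rewrite ler_pdivrMr ?nr_gt0 //; exact: hd.
Qed.

Lemma slope_cderiv (F : C -> V) (z w : C) (D E : V) : w != z -> cderiv F w E ->
  exists E', cderiv (slope F z D) w E'.
Proof.
move=> wz hF.
have h := cderivZ (cderiv_subV wz) (cderivD hF (cderiv_cst (- F z) w)).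
eexists; apply: (@cderiv_ext _ _ _ _ _ _ (nr (w - z))) h; first by rewrite nr_gt0 subr_eq0.
move=> x xw; rewrite /slope ifF //; apply/negbTE; apply: contraTneq xw => ->.
by rewrite nrBC ltxx.
Qed.

(** The slope of [F] at [z] is differentiable off [z] and continuous at [z], which is exactly what
    [square_goursat_point] asks. Splitting the slope leaves the winding integral times [F z]. *)
Lemma square_cauchy p (s : R) (F : C -> V) z : square_in p s z ->
  (forall w, square p s w -> exists D, cderiv F w D) ->
  cycle_int (square_cycle p s) (fun w => (w - z)^-1 *: F w) = two_pi_i R *: F z.
Proof.
move=> hz hF; have [/andP[z1 z2] /andP[z3 z4]] := hz.
have s0 : 0 <= s by lra.
have sz : square p s z by split; apply/andP; split; exact: ltW.
have [D hD] := hF _ sz.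
have Gz l : cycle_trace (square_cycle p s) l -> l != z.
  move=> /(square_trace s0)[_ h]; apply/eqP => e; move: h; rewrite e => -[] h; lra.
have h0 : cycle_int (square_cycle p s) (slope F z D) = 0.
  apply: (square_goursat_point hV hz); last exact: slope_ccont.
  by move=> w /hF [E hE] wz; exact: slope_cderiv hE.
have c1 : edges_cont (cycle_edges (square_cycle p s)) (slope F z D).
  apply: edges_cont_ccont => l; rewrite -cycle_traceE => hl.
  have [E hE] := hF _ (square_trace s0 hl).1.
  by have [E' /cderiv_ccont] := slope_cderiv D (Gz _ hl) hE.
have c2 : edges_cont (cycle_edges (square_cycle p s)) (fun w => (w - z)^-1 : C).
  by apply: edges_cont_ccont => l; rewrite -cycle_traceE => /Gz h; exact: cderiv_ccont (cderiv_subV h).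
have bl := bounded_linear_scaler (F z).
rewrite -(square_winding hz) [in RHS]edges_intE -(edges_int_linear hC bl c2) -[LHS]addr0 -[in LHS]oppr0 -[in LHS]h0.
apply/eqP; rewrite subr_eq; apply/eqP.
rewrite !edges_intE -(edges_intD hV) //; last exact: (edges_cont_linear bl).
apply: edges_int_ext => l; rewrite -cycle_traceE => /Gz lz.
by rewrite /slope (negbTE lz) scalerBr [RHS]addrC subrK.
Qed.

End SquareCauchyFormula.

(** * Grid cycles around a compact set *)

Section PolygonDecomposition.
Variable R : realType.
Local Notation C := (R[i] : numFieldType).

Lemma poly_edges_closed (x : C) (s : seq C) : last x s = x ->
  poly_edges (belast x s) = zip (belast x s) s.
Proof.
case: s => [//|z s] /= hl; rewrite /poly_edges /= rot1_cons.
by rewrite -{2}hl -lastI.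
Qed.

(* The path y :: s is extended backwards, edge by edge, and closed into a polygon
   as soon as it is a loop; the degree condition makes the extension possible. *)
Lemma balanced_path n (E : seq (C * C)) (y : C) (s : seq C) : (size E <= n)%N ->
  perm_eq (y :: map fst E) (last y s :: map snd E) ->
  exists G : seq (seq C), perm_eq (cycle_edges G) (zip (belast y s) s ++ E).
Proof.
elim: n E y s => [|n IH] E y s hs hp.
  have E0 : E = [::] by case: E hs {hp}.
  rewrite E0 /= in hp *; have [yl] := perm_small_eq (isT : (size [:: last y s] <= 1)%N) hp.
  exists [:: belast y s]; rewrite /cycle_edges /= !cats0.
  by rewrite poly_edges_closed.
have [yl|yl] := eqVneq (last y s) y.
  case: E hs hp => [|[a b] E] hs hp.
    exists [:: belast y s]; rewrite /cycle_edges /= !cats0.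
    by rewrite poly_edges_closed.
  have [||G hG] := IH E a [:: b] => //.
    by move: hp; rewrite yl perm_cons.
  exists (belast y s :: G); rewrite /cycle_edges /= poly_edges_closed //.
  by rewrite perm_cat2l.
have : y \in last y s :: map snd E by rewrite -(perm_mem hp) mem_head.
rewrite inE eq_sym (negbTE yl) /= => /mapP[[w y'] he /= yE].
rewrite -yE in he.
have pE := perm_to_rem he.
have [||G hG] := IH (rem (w, y) E) w (y :: s).
- by rewrite size_rem //; case: (size E) hs.
- rewrite /= -(perm_cons y).
  have h1 : perm_eq (y :: map fst E) (y :: w :: map fst (rem (w, y) E)).
    by rewrite perm_cons; exact: (perm_map fst pE).
  have h2 : perm_eq (last y s :: map snd E) (last y s :: y :: map snd (rem (w, y) E)).
    by rewrite perm_cons; exact: (perm_map snd pE).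
  rewrite -(permPl h1) (permPl hp) (permPl h2).
  by apply/permP => P /=; rewrite addnCA.
exists G; rewrite (permPl hG) /=.
rewrite -(cat1s (w, y)) perm_catCA perm_cat2l /=.
by rewrite perm_sym.
Qed.

Lemma balanced_cycle (E : seq (C * C)) : perm_eq (map fst E) (map snd E) ->
  exists G : seq (seq C), perm_eq (cycle_edges G) E.
Proof.
case: E => [|[a b] E] hp; first by exists [::].
by have [//||G hG] := @balanced_path (size E) E a [:: b] => //; exists G.
Qed.

End PolygonDecomposition.

(** * Oriented edges of grid squares and their cancellation *)

Section Grid.
Local Open Scope int_scope.

(** Corners in counterclockwise order. The default case returns to corner 0, so that edge 3 closes
    the square. *)
Definition gvert (s : int * int) (k : nat) : int * int :=
  match k with
  | 0%N => s
  | 1%N => ((s.1 + 1)%R, s.2)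
  | 2%N => ((s.1 + 1)%R, (s.2 + 1)%R)
  | 3%N => (s.1, (s.2 + 1)%R)
  | _ => s
  end.

Definition gedge (s : int * int) (k : nat) := (gvert s k, gvert s k.+1).

Definition gneighbour (s : int * int) (k : nat) : int * int :=
  match k with
  | 0%N => (s.1, (s.2 - 1)%R)
  | 1%N => ((s.1 + 1)%R, s.2)
  | 2%N => (s.1, (s.2 + 1)%R)
  | _ => ((s.1 - 1)%R, s.2)
  end.

Definition eflip (T : Type) (e : T * T) := (e.2, e.1).

(** The edge shared with a neighbour has index [k + 2] modulo 4 there. *)
Definition gopp (k : nat) : nat := match k with 0%N => 2%N | 1%N => 3%N | 2%N => 0%N | _ => 1%N end.

Lemma gedge_neighbour s k : (k < 4)%N -> gedge (gneighbour s k) (gopp k) = eflip (gedge s k).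
Proof.
case: s => i j; case: k => [|[|[|[|//]]]] _; rewrite /gedge /eflip /=;
  by congr ((_, _), (_, _)); lia.
Qed.

Lemma gedge_inj s s' k k' : (k < 4)%N -> (k' < 4)%N -> gedge s k = gedge s' k' -> (s, k) = (s', k').
Proof.
case: s => i j; case: s' => i' j'.
case: k => [|[|[|[|//]]]] _; case: k' => [|[|[|[|//]]]] _; rewrite /gedge /= => -[] *;
  solve [exfalso; lia | congr ((_, _), _); lia].
Qed.

Variable S : seq (int * int).
Hypothesis uS : uniq S.

Definition gedges := [seq gedge s k | s <- S, k <- iota 0 4].
(** Edges whose reverse also occurs; their integrals cancel in pairs, and [gboundary] keeps the
    rest. *)
Definition gcancel := [seq e <- gedges | eflip e \in gedges].
Definition gboundary := [seq e <- gedges | eflip e \notin gedges].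

Lemma mem_iota4 k : (k \in iota 0 4) = (k < 4)%N.
Proof. by rewrite mem_iota. Qed.

Lemma gedgesP e : reflect (exists s k, [/\ s \in S, (k < 4)%N & e = gedge s k]) (e \in gedges).
Proof.
apply: (iffP allpairsP) => [[[s k] [hs + ->]]|[s [k [hs hk ->]]]].
  by rewrite mem_iota4 => hk; exists s, k.
by exists (s, k); rewrite mem_iota4.
Qed.

Lemma gedges_uniq : uniq gedges.
Proof.
apply: allpairs_uniq => //.
move=> [s k] [s' k'] /allpairsP[[s1 k1] [_ + [-> ->]]] /allpairsP[[s2 k2] [_ + [-> ->]]].
by rewrite !mem_iota4 => h1 h2 h; apply: gedge_inj.
Qed.

Lemma gcancel_flip : perm_eq (map (@eflip _) gcancel) gcancel.
Proof.
have ef : involutive (@eflip (int * int)) by case.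
apply: uniq_perm.
- by rewrite (map_inj_uniq (inv_inj ef)) filter_uniq // gedges_uniq.
- by rewrite filter_uniq // gedges_uniq.
move=> e; rewrite -[e in LHS]ef (mem_map (inv_inj ef)) !mem_filter ef.
by rewrite andbC.
Qed.

Lemma gedges_split : perm_eq (gcancel ++ gboundary) gedges.
Proof. by rewrite perm_filterC. Qed.

Lemma gedges_balanced : perm_eq (map fst gedges) (map snd gedges).
Proof.
rewrite /gedges; elim: S => [//|s s0 IH] /=.
apply: (perm_trans (permEl (perm_catCA [:: s] [:: gvert s 1; gvert s 2; gvert s 3] _))) => /=.
by rewrite !perm_cons.
Qed.

(** Starts and ends agree as multisets for all edges, because each square is closed, and for the
    cancelling edges, because reversal permutes them. The boundary is the difference. *)
Lemma gboundary_balanced : perm_eq (map fst gboundary) (map snd gboundary).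
Proof.
have h1 := perm_map fst gedges_split; have h2 := perm_map snd gedges_split.
have h3 : perm_eq (map fst gcancel) (map snd gcancel).
  by have := perm_map fst gcancel_flip; rewrite -map_comp perm_sym.
rewrite !map_cat in h1 h2.
rewrite -(perm_cat2l (map fst gcancel)) (permPl h1) (permPl gedges_balanced) perm_sym.
by rewrite -(permPr h2) perm_cat2r.
Qed.

End Grid.

(** * Differentiability of Cauchy integrals *)

Section CauchyTransform.
Variable R : realType.
Local Notation C := (R[i] : numFieldType).
Variable V : normedModType C.
Hypothesis hV : nr_complete V.

Lemma edges_trace_dist (E : seq (C * C)) (w : C) : ~ edges_trace E w ->
  exists2 d : R, 0 < d & forall l, edges_trace E l -> d <= nr (l - w).
Proof.
move=> hw; have [||d d0 hd] := compact_away (U := [set z | z != w]) (compact_edges_trace (E := E)).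
- apply/open_nrP => x /= xw; exists (nr (x - w)); first by rewrite nr_gt0 subr_eq0.
  by move=> y; apply: contraTneq => ->; rewrite nrBC ltxx.
- by move=> z /= Ez; apply/eqP => zw; rewrite zw in Ez.
exists d => // l El; rewrite leNgt; apply/negP => lw.
by have := hd _ El w; rewrite nrBC /= eqxx => /(_ lw).
Qed.

Lemma cauchy_kernel_cont (E : seq (C * C)) (f : C -> V) (w : C) n : ~ edges_trace E w ->
  (forall l, edges_trace E l -> ccont f l) ->
  forall l, edges_trace E l -> ccont (fun l => ((l - w)^-1 ^+ n : C) *: f l) l.
Proof.
move=> Ew hf l El.
have lw : l != w by apply/eqP => lw; rewrite lw in El.
have c1 := ccont_subV n lw; have c2 := hf _ El.
move=> e e0.
set k := fun l => (l - w)^-1 ^+ n : C in c1 *.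
have A0 : 0 < nr (f l) + 1 by rewrite ltr_wpDl ?nr_ge0.
have B0 : 0 < nr (k l) + 1 by rewrite ltr_wpDl ?nr_ge0.
have e2 : 0 < e / 2 by rewrite divr_gt0.
have [d1 d10 h1] := c1 _ (divr_gt0 e2 A0).
have [d2 d20 h2] := c1 _ ltr01.
have [d3 d30 h3] := c2 _ (divr_gt0 e2 B0).
exists (Num.min d1 (Num.min d2 d3)); first by rewrite !lt_min d10 d20.
move=> x; rewrite !lt_min => /and3P[/h1 {}h1 /h2 {}h2 /h3 {}h3].
have -> : k x *: f x - k l *: f l = k x *: (f x - f l) + (k x - k l) *: f l.
  by rewrite scalerBr scalerBl; zmod.
apply: (le_lt_trans (nrD _ _)); rewrite !nrZ.
have kx : nr (k x) <= nr (k l) + 1 by have := nr_lower (k x) (k l); lra.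
rewrite ltr_pdivlMr // in h1; rewrite ltr_pdivlMr // in h3.
have := nr_ge0 (f x - f l); have := nr_ge0 (k x - k l); have := nr_ge0 (f l); nra.
Qed.

(** The first-order remainder is itself an integral, with the explicit kernel
    [(w' - w)^2 / ((l - w)^2 (l - w'))], so a sup bound suffices. *)
Lemma cauchy_transform_cderiv (E : seq (C * C)) (f : C -> V) (w : C) : ~ edges_trace E w ->
  (forall l, edges_trace E l -> ccont f l) ->
  cderiv (fun w => edges_int E (fun l => (l - w)^-1 *: f l)) w
    (edges_int E (fun l => (l - w)^-1 ^+ 2 *: f l)).
Proof.
move=> Ew hf e e0.
have [d d0 hd] := edges_trace_dist Ew.
have [M M0 hM] := ccont_bounded (compact_edges_trace (E := E)) hf.
(* [1 / d] bounds the kernel at [w], and [2 / d] the one at [w'], which stays within [d / 2] of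
   [w]. *)
pose K := edges_length E * (2 / d ^+ 3 * M).
have K0 : 0 <= K by rewrite !mulr_ge0 ?edges_length_ge0 ?invr_ge0 ?exprn_ge0 // ltW.
have K1 : 0 < K + 1 by rewrite ltr_wpDl.
exists (Num.min (d / 2) (e / (K + 1))); first by rewrite lt_min !divr_gt0.
move=> w'; rewrite lt_min => /andP[w1 w2].
have hd' l : edges_trace E l -> d / 2 <= nr (l - w').
  by move=> /hd h; have := nr_tri w' l w; lra.
have Ew' : ~ edges_trace E w' by move=> /hd'; rewrite subrr nr0; lra.
have cont z n : ~ edges_trace E z -> edges_cont E (fun l => ((l - z)^-1 ^+ n : C) *: f l).
  by move=> hz; apply: edges_cont_ccont => l El; exact: (cauchy_kernel_cont n hz hf El).
pose r l : V := ((w' - w) ^+ 2 * ((l - w)^-1 ^+ 2 * (l - w')^-1) : C) *: f l.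
have ne l : edges_trace E l -> l != w /\ l != w'.
  by move=> El; split; apply/eqP => h; [apply: Ew|apply: Ew']; rewrite -h.
have bl := @bounded_linear_scale R V.
have cz z : ~ edges_trace E z -> edges_cont E (fun l => (l - z)^-1 *: f l).
  by move=> hz; have := cont z 1%N hz.
have I0 : edges_int E (fun l => (l - w')^-1 *: f l) = edges_int E r +
   (edges_int E (fun l => (l - w)^-1 *: f l) + (w' - w) *: edges_int E (fun l => (l - w)^-1 ^+ 2 *: f l)) /\ edges_cont E r.
  have cr : edges_cont E r.
    have c1 : edges_cont E (fun l => (((l - w')^-1 *: f l) + (-1 : C) *: ((l - w)^-1 *: f l))
         + (- (w' - w)) *: ((l - w)^-1 ^+ 2 *: f l)).
      apply: edges_contD; first apply: edges_contD.
      - exact: cz.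
      - by apply: (edges_cont_linear (bl _)); exact: cz.
      - by apply: (edges_cont_linear (bl _)); exact: cont.
    move=> ed hed; apply: (segc_ext _ (c1 _ hed)) => l hl.
    have [lw lw'] : l != w /\ l != w' by apply: ne; exists ed.
    rewrite /r !scalerA -!scalerDl; congr (_ *: _).
    by field; rewrite !subr_eq0 lw lw'.
  split=> //; rewrite -(edges_intZ hV _ (cont w 2%N Ew)).
  have c2 : edges_cont E (fun l => (w' - w) *: ((l - w)^-1 ^+ 2 *: f l)).
    by apply: (edges_cont_linear (bl _)); exact: cont.
  rewrite -(edges_intD hV (cz _ Ew) c2) -(edges_intD hV cr); last exact: edges_contD (cz _ Ew) c2.
  apply: edges_int_ext => l El; have [lw lw'] := ne _ El.
  rewrite /r !scalerA -!scalerDl; congr (_ *: _).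
  by field; rewrite !subr_eq0 lw lw'.
have [I1 cr] := I0.
have cancel (a b u v : V) : a = b + (u + v) -> a - u - v = b by move=> ->; zmod.
rewrite (cancel _ _ _ _ I1).
have : nr (edges_int E r) <= edges_length E * (nr (w' - w) ^+ 2 * (2 / d ^+ 3) * M).
  apply: (edges_int_bound hV cr) => l El; rewrite /r nrZ; apply: ler_pM; rewrite ?nr_ge0 //; last exact: hM.
  rewrite nrM nrX; apply: ler_wpM2l; first by rewrite exprn_ge0 ?nr_ge0.
  rewrite nrM nrX !nrV.
  have -> : 2 / d ^+ 3 = d^-1 ^+ 2 * (d / 2)^-1 by field; rewrite gt_eqF.
  apply: ler_pM; rewrite ?exprn_ge0 ?invr_ge0 ?nr_ge0 //.
    rewrite lerXn2r ?nnegrE ?invr_ge0 ?nr_ge0 ?(ltW d0) //.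
    by rewrite lef_pV2 ?posrE // ?hd //; exact: lt_le_trans (hd _ El).
  rewrite lef_pV2 ?posrE ?divr_gt0 ?hd' //.
  by apply: lt_le_trans (hd' _ El); rewrite divr_gt0.
move=> h; apply: (le_trans h).
have -> : edges_length E * (nr (w' - w) ^+ 2 * (2 / d ^+ 3) * M) = (K * nr (w' - w)) * nr (w' - w).
  by rewrite /K; ring.
apply: ler_wpM2r; first exact: nr_ge0.
rewrite ltr_pdivlMr // in w2; have := nr_ge0 (w' - w); nra.
Qed.

Lemma edges_int_perm (E E' : seq (C * C)) (f : C -> V) : perm_eq E E' -> edges_int E f = edges_int E' f.
Proof. by move=> h; exact: perm_big. Qed.

Lemma edges_trace_perm (E E' : seq (C * C)) : perm_eq E E' -> edges_trace E = edges_trace E'.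
Proof.
move=> h; apply/seteqP; split => z [e he hz]; exists e => //.
  by rewrite -(perm_mem h).
by rewrite (perm_mem h).
Qed.

End CauchyTransform.

(** * Grid squares in the plane *)

Section GridGeometry.
Variable R : realType.
Local Notation C := (R[i] : numFieldType).

Variable d : R.
Hypothesis d0 : 0 < d.

Definition gpt (s : int * int) : C := (d * s.1%:~R) +i* (d * s.2%:~R).
Definition gseg (e : (int * int) * (int * int)) : C * C := (gpt e.1, gpt e.2).

Lemma gpt_square_cycle s :
  cycle_edges (square_cycle (gpt s) d) = map gseg [seq gedge s k | k <- iota 0 4].
Proof.
have E (x y u v : R) : (x +i* y : C) + (u +i* v) = (x + u) +i* (y + v) by [].
have F (a : int) : d * (a + 1)%:~R = d * a%:~R + d :> R by rewrite intrD mulrDr mulr1.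
case: s => i j; rewrite /square_cycle /gpt /= !E !addr0 /cycle_edges /poly_edges /=.
by rewrite /gseg /gpt /= !F.
Qed.

Lemma sum_gedges (V : normedModType C) (S : seq (int * int)) (h : C -> V) :
  edges_int (map gseg (gedges S)) h = \sum_(s <- S) cycle_int (square_cycle (gpt s) d) h.
Proof.
elim: S => [|s S IH]; first by rewrite big_nil /edges_int big_nil.
rewrite big_cons -IH edges_intE gpt_square_cycle.
rewrite -[gedges (s :: S)]/([seq gedge s k | k <- iota 0 4] ++ gedges S).
by rewrite map_cat /edges_int big_cat.
Qed.

(** Reversal permutes these edges and negates each integral, so the sum equals its own opposite. *)
Lemma sum_gcancel (V : normedModType C) (S : seq (int * int)) (h : C -> V) : uniq S ->
  edges_int (map gseg (gcancel S)) h = 0.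
Proof.
move=> uS; rewrite /edges_int big_map.
set X := \sum_(_ <- _) _.
have XN : X = - X.
  rewrite {1}/X -(perm_big _ (gcancel_flip uS)) /= big_map -sumrN.
  by apply: eq_bigr => e _; exact: seg_int_rev.
have : (2 : C) *: X = 0 by rewrite scaler_nat mulr2n {1}XN addNr.
by move/eqP; rewrite scaler_eq0 pnatr_eq0 /= => /eqP.
Qed.

Lemma sum_gboundary (V : normedModType C) (S : seq (int * int)) (h : C -> V) : uniq S ->
  edges_int (map gseg (gboundary S)) h = \sum_(s <- S) cycle_int (square_cycle (gpt s) d) h.
Proof.
move=> uS; rewrite -sum_gedges -(edges_int_perm h (perm_map gseg (gedges_split S))).
by rewrite map_cat /edges_int big_cat /= -[X in X + _]/(edges_int _ h) sum_gcancel // add0r.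
Qed.

Lemma gedge_square s k : (k < 4)%N -> segment (gseg (gedge s k)) `<=` square (gpt s) d.
Proof.
move=> hk; have he : gseg (gedge s k) \in cycle_edges (square_cycle (gpt s) d).
  by rewrite gpt_square_cycle map_f // map_f // mem_iota4.
have [h1 h2] := square_edges (ltW d0) he.
by move: h1 h2; case: (gseg _) => a b; exact: convexC_square.
Qed.

Lemma segment_flip (a b : C) : segment (a, b) `<=` segment (b, a).
Proof.
move=> z [t /andP[t0 t1] ->]; exists (1 - t); first by apply/andP; split; lra.
by rewrite /seg_pt /= rmorphB rmorph1; ring.
Qed.

(** Makes the family of grid squares that meet a bounded set finite. *)
Lemma gsquare_range (s : int * int) z M (N : nat) : square (gpt s) d z -> nr z <= M -> M / d + 1 <= N%:R ->
  - N%:Z <= s.1 <= N%:Z /\ - N%:Z <= s.2 <= N%:Z.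
Proof.
move=> [] + + zM; rewrite -lerBrDr ler_pdivrMr // => hx hy hN.
have := nr_Re z; have := nr_Im z; rewrite !ler_norml => /andP[y1 y2] /andP[x1 x2].
move: hx hy; rewrite !raddfB /= => /andP[a1 a2] /andP[b1 b2].
have key (i : int) (x : R) : 0 <= x - d * i%:~R -> x - d * i%:~R <= d -> - M <= x -> x <= M -> - N%:Z <= i <= N%:Z.
  move=> h1 h2 h3 h4; apply/andP; split; rewrite -(ler_int R) ?mulrNz -[N%:Z%:~R]/(N%:R) -(ler_pM2l d0); lra.
by split; [apply: (key _ (complex.Re z))|apply: (key _ (complex.Im z))]; lra.
Qed.

Lemma gsquare_cover (z : C) : exists s, square (gpt s) d z.
Proof.
exists (Num.floor (complex.Re z / d), Num.floor (complex.Im z / d)).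
have key (x : R) : 0 <= x - d * (Num.floor (x / d))%:~R <= d.
  have := floor_itv (x / d); rewrite ler_pdivlMr // ltr_pdivrMr // intrD => /andP[h1 h2].
  by apply/andP; split; lra.
by rewrite /square /= !raddfB /=.
Qed.

End GridGeometry.

(** * The boundary cycle of the squares that meet a compact set *)

Section GridCycle.
Variable R : realType.
Local Notation C := (R[i] : numFieldType).
Local Notation hC := (@complex_nr_complete R).

Lemma square_in_unique (d : R) (s s' : int * int) w : 0 < d ->
  square_in (gpt d s) d w -> square (gpt d s') d w -> s = s'.
Proof.
move=> d0 [] + + [] + +; rewrite !raddfB /=.
move: s s' => [i j] [i' j'] /=.
have key (a b : int) (x : R) : 0 < x - d * a%:~R < d -> 0 <= x - d * b%:~R <= d -> a = b.
  move=> /andP[h1 h2] /andP[h3 h4].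
  have : a%:~R < (b + 1)%:~R :> R by rewrite intrD -(ltr_pM2l d0); lra.
  have : b%:~R < (a + 1)%:~R :> R by rewrite intrD -(ltr_pM2l d0); lra.
  by rewrite !ltr_int; lia.
by move=> h1 h2 h3 h4; rewrite (key i i' (complex.Re w)) // (key j j' (complex.Im w)).
Qed.

Lemma square_approx (p w : C) (s e : R) : 0 < s -> square p s w -> 0 < e ->
  exists2 w', square_in p s w' & nr (w' - w) < e.
Proof.
move=> s0 [/andP[a b] /andP[c h]] e0.
(* A move towards the centre [c0] enters the interior. The centre is at most [s] away from [w], so
   this [t] keeps the move below [e]. *)
pose t := Num.min 2^-1 (e / (4 * s)).
have t0 : 0 < t by rewrite lt_min invr_gt0 ltr0n divr_gt0 // mulr_gt0.
have t1 : t <= 2^-1 by rewrite /t ge_min lexx.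
have t2 : t * (4 * s) <= e by rewrite -ler_pdivlMr ?mulr_gt0 // /t ge_min lexx orbT.
pose c0 : C := (s / 2) +i* (s / 2).
exists (w + t%:C * (c0 - (w - p))).
  rewrite /square_in /=; have -> : w + t%:C * (c0 - (w - p)) - p = (w - p) + t%:C * (c0 - (w - p)) by ring.
  move: a b c h; rewrite /c0; case: (w - p) => x y /= a b c h.
  rewrite !mul0r !subr0 !addr0; split; nra.
rewrite [w + _]addrC addrK nrM nr_real (ger0_norm (ltW t0)).
have : nr (c0 - (w - p)) <= s.
  apply: (le_trans (nr_ReIm _)); move: a b c h; rewrite /c0; case: (w - p) => x y /= a b c h.
  have -> : s = s / 2 + s / 2 by field.
  by apply: lerD; rewrite ler_norml; apply/andP; split; lra.
have := nr_ge0 (c0 - (w - p)); nra.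
Qed.

(** The cycle is the oriented boundary of the union of the grid squares that meet [K]; interior
    edges cancel, and balance lets the others be strung into polygons. [V] is quantified inside, so
    that one cycle serves functions into any complete module. *)
Lemma grid_cycle (K Om : set C) : compact K -> open Om -> K `<=` Om ->
  exists G : seq (seq C), [/\ cycle_trace G `<=` Om, (forall w, K w -> ~ cycle_trace G w) &
    forall (V : normedModType C) (F : C -> V), nr_complete V ->
      (forall w, Om w -> exists D, cderiv F w D) ->
      cycle_int G F = 0 /\
      forall w, K w -> cycle_int G (fun l => (l - w)^-1 *: F l) = two_pi_i R *: F w].
Proof.
move=> cK oOm KOm.
have [r r0 hr] := compact_away cK oOm KOm.
have [M hM] := compact_nr_bounded cK.
(* Two points of one square are at most [4 * d], that is [r / 2], apart, so a square that meets [K]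
   stays inside [Om]. *)
pose d := r / 8; have d0 : 0 < d by rewrite divr_gt0.
pose N := Num.bound (`|M| / d + 1).
have hN : `|M| / d + 1 <= N%:R.
  by rewrite ltW // archi_boundP // addr_ge0 // divr_ge0 // ltW.
pose rg := [seq (k%:Z - N%:Z)%R | k <- iota 0 (2 * N).+1].
have rgP (i : int) : - N%:Z <= i <= N%:Z -> i \in rg.
  move=> hi; apply/mapP; exists `|(i + N%:Z)%R|%N; last by lia.
  by rewrite mem_iota; lia.
pose touch s := exists2 z, K z & square (gpt d s) d z.
pose S := [seq s <- [seq (i, j) | i <- rg, j <- rg] | `[< touch s >]].
have SP s : s \in S <-> touch s.
  rewrite mem_filter; split; first by move=> /andP[/asboolP].
  move=> ts; apply/andP; split; first exact/asboolP.
  have [z Kz hz] := ts.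
  have zM : nr z <= `|M| by apply: (le_trans (hM _ Kz)); exact: ler_norm.
  have [h1 h2] := gsquare_range d0 hz zM hN.
  by apply/allpairsP; exists s; split; [exact: rgP|exact: rgP|case: (s)].
have uS : uniq S.
  have urg : uniq rg by rewrite map_inj_uniq ?iota_uniq // => k k' /= h; lia.
  by rewrite filter_uniq // allpairs_uniq // => -[i j] [i' j'].
have sOm s w : s \in S -> square (gpt d s) d w -> Om w.
  move=> /SP[z Kz hz] hw; apply: (hr _ Kz).
  apply: le_lt_trans (nr_tri (gpt d s) _ _) _; rewrite [X in _ + X]nrBC.
  have := square_diam hz; have := square_diam hw; rewrite /d; lra.
have [G hG] : exists G, perm_eq (cycle_edges G) (map (gseg d) (gboundary S)).
  apply: balanced_cycle; rewrite -!map_comp.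
  by have := perm_map (gpt d) (gboundary_balanced uS); rewrite -!map_comp.
have GI (V : normedModType C) (h : C -> V) : cycle_int G h = \sum_(s <- S) cycle_int (square_cycle (gpt d s) d) h.
  by rewrite edges_intE (edges_int_perm h hG) sum_gboundary.
have GT z : cycle_trace G z -> exists s k, [/\ s \in S, (k < 4)%N, eflip (gedge s k) \notin gedges S & segment (gseg d (gedge s k)) z].
  rewrite cycle_traceE (edges_trace_perm hG) => -[e /mapP[e' + ->] hz].
  by rewrite mem_filter => /andP[he /gedgesP[s [k [hs hk ee]]]]; exists s, k; rewrite -ee.
(* If a point of [K] lay on a boundary edge, the square across that edge would meet [K] too, and the
   edge would have cancelled. *)
have GK z : K z -> ~ cycle_trace G z.
  move=> Kz /GT [s [k [hs hk nf hz]]]; move/negP: nf; apply.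
  apply/gedgesP; exists (gneighbour s k), (gopp k); split.
  - apply/SP; exists z => //.
    have hk' : (gopp k < 4)%N by case: k hk {hz} => [|[|[|[|]]]].
    by apply: (gedge_square d0 hk'); rewrite gedge_neighbour //; exact: segment_flip.
  - by case: k hk {hz} => [|[|[|[|]]]].
  - by rewrite gedge_neighbour.
exists G; split=> //.
  by move=> z /GT [s [k [hs hk _ hz]]]; apply: (sOm s) => //; exact: (gedge_square d0 hk).
move=> V F hV hF; split.
  rewrite GI big_seq big1 // => s hs; apply: (square_goursat hV (ltW d0)) => z hz.
  exact/hF/(sOm s).
(* Only the square around [w] contributes; on the closed squares of the rest the integrand is
   holomorphic. *)
have inner s w : s \in S -> square_in (gpt d s) d w ->
    cycle_int G (fun l => (l - w)^-1 *: F l) = two_pi_i R *: F w.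
  move=> hs hw; rewrite GI (bigD1_seq s) //= big_seq_cond big1 ?addr0.
    apply: (square_cauchy hV hw) => z hz; exact/hF/(sOm s).
  move=> s' /andP[hs' ns]; apply: (square_goursat hV (ltW d0)) => z hz.
  have zw : z != w.
    by apply: contraNneq ns => zw; rewrite -zw in hw; rewrite (square_in_unique d0 hw hz).
  have [D hD] := hF _ (sOm _ _ hs' hz).
  by exists ((z - w)^-1 *: D + - (z - w)^-1 ^+ 2 *: F z); exact: cderivZ (cderiv_subV zw) hD.
(* A point of [K] may lie on a grid line. Both sides of the formula are continuous there, and
   interior points of a square through [w] come arbitrarily close. *)
move=> w Kw; have [s hs] := gsquare_cover d0 w.
have sS : s \in S by apply/SP; exists w.
have cF l : edges_trace (cycle_edges G) l -> ccont F l.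
  rewrite -cycle_traceE => /GT [s' [k [hs' hk _ hz]]].
  have [D] := hF _ (sOm _ _ hs' (gedge_square d0 hk hz)); exact: cderiv_ccont.
have nw : ~ edges_trace (cycle_edges G) w by rewrite -cycle_traceE; exact: GK.
have c1 := cderiv_ccont (cauchy_transform_cderiv hV nw cF).
have [D /cderiv_ccont c2] := hF _ (KOm _ Kw).
apply: nr_small_eq => e e0; have e2 : 0 < e / 2 by rewrite divr_gt0.
have p0 : 0 < nr (two_pi_i R) + 1 by rewrite ltr_wpDl ?nr_ge0.
have [d1 d10 h1] := c1 _ e2.
have [d2 d20 h2] := c2 _ (divr_gt0 e2 p0).
have d12 : 0 < Num.min d1 d2 by rewrite lt_min d10.
have [w' w'in] := square_approx d0 hs d12; rewrite lt_min => /andP[/h1 {}h1 /h2 {}h2].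
apply: (le_trans (nr_tri (two_pi_i R *: F w') _ _)).
rewrite -{1}(inner _ _ sS w'in) edges_intE -scalerBr nrZ.
rewrite nrBC in h1; rewrite ltr_pdivlMr // in h2.
have : nr (two_pi_i R) * nr (F w' - F w) <= e / 2.
  have := nr_ge0 (F w' - F w); have := nr_ge0 (two_pi_i R); nra.
move=> h3; rewrite [leRHS]splitr; apply: lerD => //; exact: ltW.
Qed.

End GridCycle.

(** * The homology form of Cauchy's theorem *)

Section Quadrature.
Variable R : realType.
Local Notation C := (R[i] : numFieldType).
Local Notation hC := (@complex_nr_complete R).

(** Weights paired with sample points, kept as a list so that a linear map can be applied term by
    term to a Riemann sum. *)
Definition nodes (n : nat) (E : seq (C * C)) : seq (C * C) :=
  [seq ((e.2 - e.1) / n%:R, seg_pt e (k%:R / n%:R)) | e <- E, k <- iota 0 n].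

Definition nodes_sum (V : normedModType C) n E (h : C -> V) : V :=
  \sum_(p <- nodes n E) p.1 *: h p.2.

Lemma nodes_trace n E p : p \in nodes n E -> edges_trace E p.2.
Proof.
move=> /allpairsP[[e k] [/= he + ->]]; rewrite mem_iota add0n /= => hk.
exists e => //; exists (k%:R / n%:R) => //.
exact: (ord_div01 R (Ordinal hk)).
Qed.

Lemma nodes_sumE (V : normedModType C) n E (h : C -> V) :
  nodes_sum n E h = \sum_(e <- E) (e.2 - e.1) *: riem n (fun t => h (seg_pt e t)).
Proof.
rewrite /nodes_sum big_allpairs_dep; apply: eq_bigr => e _ /=.
rewrite /riem scalerA scaler_sumr -(big_mkord xpredT (fun k => ((e.2 - e.1) / n%:R) *: h (seg_pt e (k%:R / n%:R)))).
by rewrite /index_iota subn0.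
Qed.

(** Equicontinuity along the edges, uniform in the parameter [x]: it yields one mesh that is good
    for all parameters at once. *)
Definition family_ucont (V : normedModType C) (T : Type) (Z : set T) (E : seq (C * C)) (h : T -> C -> V) :=
  forall e : R, 0 < e -> exists2 d : R, 0 < d & forall x, Z x ->
     forall l l', edges_trace E l -> edges_trace E l' -> nr (l' - l) < d -> nr (h x l' - h x l) <= e.

Lemma quadrature (V : normedModType C) (T : Type) (Z : set T) E (h : T -> C -> V) :
  nr_complete V -> family_ucont Z E h ->
  forall e : R, 0 < e -> exists2 N, (0 < N)%N & forall n, (N <= n)%N -> forall x, Z x ->
    nr (nodes_sum n E (h x) - edges_int E (h x)) <= e.
Proof.
move=> hV hh e e0.
pose L := edges_length E.
have L0 : 0 < L + 1 by rewrite ltr_wpDl ?edges_length_ge0.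
have [d d0 hd] := hh _ (divr_gt0 e0 L0).
pose N := (Num.bound ((L + 1) / d)).+1.
have hN : (L + 1) / d < N%:R.
  apply: (@lt_trans _ _ (Num.bound ((L + 1) / d))%:R); last by rewrite ltr_nat.
  by apply: archi_boundP; rewrite divr_ge0 // ltW.
clearbody N; rewrite ltr_pdivrMr // in hN.
have N0 : (0 < N)%N.
  by rewrite -(ltr0n R) -(pmulr_lgt0 _ d0); apply: lt_trans hN.
exists N => // n Nn x Zx.
have segh ed : ed \in E -> segc (h x) ed.
  move=> hed; apply: segc_ucont => eps eps0; have [d' d'0 hd'] := hh _ eps0.
  by exists d' => // z w hz hw; apply: hd' => //; exists ed.
have mod_ ed : ed \in E -> modulus01 (fun t => h x (seg_pt ed t)) n (e / (L + 1)).
  move=> hed; apply: (@modulus01_le _ _ _ N) => // s t hs ht st.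
  apply: hd => //; [by exists ed => //; exists t|by exists ed => //; exists s|].
  rewrite seg_pt_lip; apply: (@le_lt_trans _ _ (N%:R^-1 * L)).
    apply: ler_pM; rewrite ?nr_ge0 //.
    rewrite /L /edges_length (big_rem ed hed) /= lerDl.
    by apply: sumr_ge0 => ? _; exact: nr_ge0.
  rewrite mulrC ltr_pdivrMr ?ltr0n //; lra.
rewrite nodes_sumE /edges_int -sumrB; apply: (le_trans (nr_sum _ _ _)).
apply: (@le_trans _ _ (\sum_(ed <- E) nr (ed.2 - ed.1) * (e / (L + 1)))).
  rewrite !big_seq; apply: ler_sum => ed hed; rewrite /seg_int -scalerBr nrZ.
  apply: ler_wpM2l; first exact: nr_ge0.
  by apply: (unit_int_err hV (segh _ hed)); [exact: leq_trans Nn|exact: mod_].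
rewrite -mulr_suml mulrC mulrAC ler_pdivrMr //.
by rewrite ler_wpM2l ?(ltW e0) // lerDl.
Qed.

Lemma quadrature1 (V : normedModType C) E (h : C -> V) : nr_complete V ->
  (forall l, edges_trace E l -> ccont h l) ->
  forall e : R, 0 < e -> exists2 N, (0 < N)%N & forall n, (N <= n)%N ->
    nr (nodes_sum n E h - edges_int E h) <= e.
Proof.
move=> hV hh e e0; have [|N N0 hN] := @quadrature V unit setT E (fun _ => h) hV _ e e0.
  move=> eps eps0; have [d d0 hd] := ccont_uniform (compact_edges_trace (E := E)) hh eps0.
  by exists d => // _ _ l l' hl _ ll'; apply/ltW/hd.
by exists N => // n Nn; exact: (hN n Nn tt).
Qed.

Lemma compact_nr_closed (K : set C) : compact K -> nr_closed K.
Proof.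
by move=> cK; apply/closed_nrP; apply: compact_closed => //; exact: norm_hausdorff.
Qed.

Lemma compact_dist (E : seq (C * C)) (K : set C) : compact K -> (forall w, K w -> ~ edges_trace E w) ->
  exists2 d : R, 0 < d & forall l w, edges_trace E l -> K w -> d <= nr (l - w).
Proof.
move=> cK EK; have [||d d0 hd] := compact_away (U := ~` K) (compact_edges_trace (E := E)).
- by apply: closed_openC; apply/closed_nrP; exact: compact_nr_closed.
- by move=> l El Kl; exact: (EK _ Kl).
exists d => // l w El Kw; rewrite leNgt; apply/negP => lw.
by apply: (hd _ El w) => //; rewrite nrBC.
Qed.

Lemma cauchy_family_ucont (V : normedModType C) (E : seq (C * C)) (K : set C) (f : C -> V) :
  compact K -> (forall w, K w -> ~ edges_trace E w) ->
  (forall l, edges_trace E l -> ccont f l) ->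
  family_ucont K E (fun z l => (l - z)^-1 *: f l).
Proof.
move=> cK EK hf e e0.
have [d d0 hd] := compact_dist cK EK.
have [M M0 hM] := ccont_bounded (compact_edges_trace (E := E)) hf.
have e1 : 0 < e / 2 * d by rewrite mulr_gt0 // divr_gt0.
have [r r0 hr] := ccont_uniform (compact_edges_trace (E := E)) hf e1.
exists (Num.min r (e / 2 * d ^+ 2 / M)).
  by rewrite lt_min r0 divr_gt0 // mulr_gt0 ?exprn_gt0 // divr_gt0.
move=> z Kz l l' El El'; rewrite lt_min => /andP[l1]; rewrite ltr_pdivlMr // => l2.
have dl := hd _ _ El Kz; have dl' := hd _ _ El' Kz.
have n1 : l - z != 0 by rewrite -nr_gt0; exact: lt_le_trans dl.
have n2 : l' - z != 0 by rewrite -nr_gt0; exact: lt_le_trans dl'.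
have -> : (l' - z)^-1 *: f l' - (l - z)^-1 *: f l =
   (l' - z)^-1 *: (f l' - f l) + ((l - l') * ((l' - z)^-1 * (l - z)^-1)) *: f l.
  have -> : (l - l') * ((l' - z)^-1 * (l - z)^-1) = (l' - z)^-1 - (l - z)^-1 by field; rewrite n1 n2.
  by rewrite scalerBr scalerBl; zmod.
have i1 : nr (l' - z)^-1 <= d^-1 by rewrite nrV lef_pV2 ?posrE ?nr_gt0.
have i2 : nr (l - z)^-1 <= d^-1 by rewrite nrV lef_pV2 ?posrE ?nr_gt0.
apply: (le_trans (nrD _ _)); rewrite !nrZ [leRHS]splitr; apply: lerD.
  apply: (@le_trans _ _ (d^-1 * (e / 2 * d))).
    by apply: ler_pM; rewrite ?nr_ge0 //; exact: ltW (hr _ El _ l1).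
  by rewrite mulrC mulfK // gt_eqF.
apply: (@le_trans _ _ (nr (l' - l) * (d^-1 * d^-1) * M)).
  apply: ler_pM; [by rewrite !mulr_ge0 ?nr_ge0|exact: nr_ge0| |exact: hM].
  rewrite (nrBC l l'); apply: ler_wpM2l; first exact: nr_ge0.
  by apply: ler_pM; rewrite ?nr_ge0.
have -> : nr (l' - l) * (d^-1 * d^-1) * M = (nr (l' - l) * M) / d ^+ 2 by field; rewrite gt_eqF.
by rewrite ler_pdivrMr ?exprn_gt0 // ltW.
Qed.

Lemma two_pi_i_neq0 : two_pi_i R != 0.
Proof.
rewrite /two_pi_i mulf_neq0 //; first by rewrite eq_complex /= eqxx andbT mulf_neq0 // gt_eqF // pi_gt0.
by rewrite eq_complex /= oner_eq0 andbF.
Qed.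

Lemma edges_int_sum (V : normedModType C) (E : seq (C * C)) (I : eqType) (s : seq I) (f : I -> C -> V) :
  nr_complete V -> (forall i, i \in s -> edges_cont E (f i)) ->
  edges_cont E (fun l => \sum_(i <- s) f i l) /\
  edges_int E (fun l => \sum_(i <- s) f i l) = \sum_(i <- s) edges_int E (f i).
Proof.
move=> hV; elim: s => [|i s IH] hs.
  have z0 : (fun l : C => \sum_(i <- [::]) f i l) = fun=> (0 : V) by apply/funext => l; rewrite big_nil.
  rewrite z0 big_nil; split; first by move=> e _; exact: ucont01_cst.
  by rewrite /edges_int big1 // => e _; rewrite /seg_int unit_int_cst scaler0.
have [c1 i1] := IH (fun j hj => hs j (mem_behead (s := i :: s) hj)).
have ci := hs i (mem_head _ _).
have z1 : (fun l : C => \sum_(j <- i :: s) f j l) = fun l => f i l + \sum_(j <- s) f j l.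
  by apply/funext => l; rewrite big_cons.
rewrite z1 big_cons; split; first exact: edges_contD.
by rewrite (edges_intD hV ci c1) i1.
Qed.

Lemma cycle_int_far (G : seq (seq C)) : exists M : R, forall w, M <= nr w ->
  cycle_int G (fun l => (l - w)^-1 : C) = 0.
Proof.
have [M hM] := compact_nr_bounded (compact_edges_trace (E := cycle_edges G)).
exists (2 * `|M| + 1) => w hw; apply: (cycle_int_subV_far (M := `|M|)).
- by move=> l; rewrite cycle_traceE => /hM h; apply: (le_trans h); exact: ler_norm.
- lra.
- by have := normr_ge0 M; lra.
Qed.

(** Closed because the winding number is locally constant off the trace; bounded because it vanishes
    far away. *)
Lemma compact_winding (G : seq (seq C)) :
  compact [set w | cycle_trace G w \/ cycle_int G (fun l => (l - w)^-1 : C) != 0].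
Proof.
apply: compact_of_closed_bounded.
  move=> x hx; have [Gx|Gx] := pselect (cycle_trace G x); [by left|right].
  have Ex : ~ edges_trace (cycle_edges G) x by rewrite -cycle_traceE.
  have [d d0 hd] := edges_trace_dist Ex.
  have d2 : 0 < d / 2 by rewrite divr_gt0.
  have [y hy yx] := hx _ d2.
  rewrite -(cycle_int_subV_local (w' := y) d0); first last.
  - exact: ltW.
  - by move=> l; rewrite cycle_traceE; exact: hd.
  case: hy => // Gy; exfalso.
  have : d <= nr (y - x) by apply: hd; rewrite -cycle_traceE.
  by move: yx; lra.
have [M hM] := cycle_int_far G.
have [M' hM'] := compact_nr_bounded (compact_edges_trace (E := cycle_edges G)).
exists (Num.max M M') => w /= [|].
  by rewrite cycle_traceE => /hM' h; rewrite le_max h orbT.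
by rewrite le_max; case: (leP (nr w) M) => // /ltW /hM ->; rewrite eqxx.
Qed.

(* F is reproduced on K (the trace of G and the points with nonzero winding) by
   a cycle H around K, hence approximated there by finite sums of simple
   fractions with poles off K, whose integrals over G vanish. *)
Theorem homology_cauchy (V : normedModType C) (Om : set C) (G : seq (seq C)) (F : C -> V) :
  nr_complete V -> open Om -> (forall w, Om w -> exists D, cderiv F w D) ->
  cycle_trace G `<=` Om -> (forall w, ~ Om w -> cycle_int G (fun l => (l - w)^-1 : C) = 0) ->
  cycle_int G F = 0.
Proof.
move=> hV oOm hF GOm hG.
pose K := [set w | cycle_trace G w \/ cycle_int G (fun l => (l - w)^-1 : C) != 0].
have KOm : K `<=` Om.
  move=> w [/GOm //|]; apply: contraPP => /hG ->; by rewrite eqxx.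
have cK : compact K by exact: compact_winding.
have [H [HOm HK hH]] := grid_cycle cK oOm KOm.
have [_ hHF] := hH V F hV hF.
have cF E z : edges_trace E `<=` Om -> edges_trace E z -> ccont F z.
  by move=> EO /EO/hF[D]; exact: cderiv_ccont.
have HOm' : edges_trace (cycle_edges H) `<=` Om by rewrite -cycle_traceE.
have GOm' : edges_trace (cycle_edges G) `<=` Om by rewrite -cycle_traceE.
have HK' w : K w -> ~ edges_trace (cycle_edges H) w by rewrite -cycle_traceE; exact: HK.
have fu := cauchy_family_ucont cK HK' (fun l hl => cF _ l HOm' hl).
suff h : cycle_int G (fun z => two_pi_i R *: F z) = 0.
  have cFG : edges_cont (cycle_edges G) F by apply: edges_cont_ccont => z; exact: cF.
  move/eqP: h; rewrite edges_intE (edges_intZ hV _ cFG) scaler_eq0 (negbTE two_pi_i_neq0) /=.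
  by move/eqP.
apply: nr_small0 => e e0.
have L0 : 0 < edges_length (cycle_edges G) + 1 by rewrite ltr_wpDl ?edges_length_ge0.
have [N N0 /(_ _ (leqnn N)) hN] := quadrature hV fu (divr_gt0 e0 L0).
pose A (z : C) : V := nodes_sum N (cycle_edges H) (fun l => (l - z)^-1 *: F l).
have cA1 p : p \in nodes N (cycle_edges H) ->
    edges_cont (cycle_edges G) (fun z => p.1 *: ((p.2 - z)^-1 *: F p.2)) /\
    edges_int (cycle_edges G) (fun z => p.1 *: ((p.2 - z)^-1 *: F p.2)) = 0.
  move=> /nodes_trace hp.
  have np : ~ K p.2 by move=> /HK'; exact.
  have npG : ~ edges_trace (cycle_edges G) p.2 by rewrite -cycle_traceE => h; apply: np; left.
  have c1 : edges_cont (cycle_edges G) (fun z => (z - p.2)^-1 : C).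
    apply: edges_cont_ccont => z hz; apply: cderiv_ccont; apply: cderiv_subV.
    by apply/eqP => zp; rewrite zp in hz.
  pose L (c : C) : V := (- p.1 * c) *: F p.2.
  have bL : bounded_linear L.
    split; [by move=> u v; rewrite /L mulrDr scalerDl| |].
      by move=> a v; rewrite /L scalerA; congr (_ *: _); rewrite -[_ *: _]/(_ * _); ring.
    by exists (nr (- p.1) * nr (F p.2)); [rewrite mulr_ge0 ?nr_ge0|move=> v; rewrite /L nrZ nrM mulrAC].
  have LE z : L ((z - p.2)^-1) = p.1 *: ((p.2 - z)^-1 *: F p.2).
    by rewrite /L scalerA; congr (_ *: _); rewrite -(opprB z) invrN; ring.
  split.
    move=> ed hed; apply: (segc_ext (f := fun z => L ((z - p.2)^-1))) => //.
    exact: (edges_cont_linear bL c1).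
  rewrite -(edges_int_ext (f := fun z => L ((z - p.2)^-1))) // (edges_int_linear (@complex_nr_complete R) bL c1).
  have W0 : edges_int (cycle_edges G) (fun z => (z - p.2)^-1 : C) = 0.
    by apply/eqP; apply: contra_notT np => h; right.
  by rewrite W0 /L mulr0 scale0r.
have [cA iA] := edges_int_sum hV (fun p hp => (cA1 p hp).1).
have A0 : edges_int (cycle_edges G) A = 0.
  by rewrite [LHS]iA big_seq big1 // => p hp; exact: (cA1 p hp).2.
have c2 : edges_cont (cycle_edges G) (fun z => two_pi_i R *: F z).
  by apply: (edges_cont_linear (bounded_linear_scale V (two_pi_i R))); apply: edges_cont_ccont => z; exact: cF.
have c3 : edges_cont (cycle_edges G) (fun z => (-1 : C) *: A z).
  exact: (edges_cont_linear (bounded_linear_scale V (-1 : C)) cA).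
have -> : cycle_int G (fun z => two_pi_i R *: F z) =
   edges_int (cycle_edges G) (fun z => two_pi_i R *: F z + (-1 : C) *: A z).
  by rewrite (edges_intD hV c2 c3) (edges_intZ hV _ cA) A0 scaler0 addr0.
apply: (@le_trans _ _ (edges_length (cycle_edges G) * (e / (edges_length (cycle_edges G) + 1)))).
  apply: (edges_int_bound hV); first exact: edges_contD.
  move=> z hz; have Kz : K z by left; rewrite cycle_traceE.
  by rewrite -hHF // scaleN1r nrBC; exact: hN.
by rewrite mulrC mulrAC ler_pdivrMr // ler_wpM2l ?(ltW e0) // lerDl.
Qed.

End Quadrature.

(** * Resolvents and the holomorphic functional calculus *)

Section BanachAlgebraTheory.
Variable R : realType.
Local Notation C := (R[i] : numFieldType).
Variable B : banachAlgType C.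
Implicit Types a b x y : B.

Lemma banach_complete : nr_complete B.
Proof. exact: completeNormedModule_nr_complete. Qed.

Lemma nr_bmul x y : nr (x *b y) <= nr x * nr y.
Proof. by have := bnormM x y; rewrite !normE -rmorphM lecR. Qed.

Lemma nr_bone : nr (\1b : B) = 1.
Proof. by apply: complexI; rewrite -normE bnorm1. Qed.

Lemma bounded_linear_mull a : bounded_linear (fun x => a *b x).
Proof.
by split; [move=> u v; rewrite bmulDr|move=> c v; rewrite bmulZr|exists (nr a); [exact: nr_ge0|move=> v; exact: nr_bmul]].
Qed.

Lemma bounded_linear_mulr a : bounded_linear (fun x => x *b a).
Proof.
split; [by move=> u v; rewrite bmulDl|by move=> c v; rewrite bmulZl|exists (nr a); [exact: nr_ge0|]].
by move=> v; rewrite mulrC; exact: nr_bmul.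
Qed.

Lemma bmulBr a x y : a *b (x - y) = a *b x - a *b y.
Proof. exact: bounded_linearB (bounded_linear_mull a) _ _. Qed.

Lemma bmulBl a x y : (x - y) *b a = x *b a - y *b a.
Proof. exact: bounded_linearB (bounded_linear_mulr a) _ _. Qed.

Lemma bmul0l a : 0 *b a = 0 :> B.
Proof. by rewrite -[X in X *b a](subrr (0 : B)) bmulBl subrr. Qed.

Lemma bmul0r a : a *b 0 = 0 :> B.
Proof. by rewrite -[X in a *b X](subrr (0 : B)) bmulBr subrr. Qed.

Lemma bmul_suml I (s : seq I) (P : pred I) (F : I -> B) a :
  (\sum_(i <- s | P i) F i) *b a = \sum_(i <- s | P i) F i *b a.
Proof. exact: bounded_linear_sum (bounded_linear_mulr a) _ _ _ _. Qed.

Lemma binvP a : invertible a -> a *b binv a = \1b /\ binv a *b a = \1b.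
Proof. by move=> [b hb]; have := @xgetPex _ 0 [set b | a *b b = \1b /\ b *b a = \1b] (ex_intro _ b hb). Qed.

Lemma bexpS a n : a ^b n.+1 = a *b a ^b n.
Proof. by []. Qed.

Lemma bexp_addn a n m : a ^b (n + m) = a ^b n *b a ^b m.
Proof. by elim: n => [|n IH]; rewrite ?bmul1l // addSn !bexpS IH bmulA. Qed.

Lemma nr_bexp a n : nr (a ^b n) <= nr a ^+ n.
Proof.
elim: n => [|n IH]; first by rewrite expr0 nr_bone.
rewrite bexpS exprS; apply: (le_trans (nr_bmul _ _)).
by apply: ler_wpM2l => //; exact: nr_ge0.
Qed.

Lemma geometric_sum a n : (\1b - a) *b (\sum_(k < n) a ^b k) = \1b - a ^b n /\
  (\sum_(k < n) a ^b k) *b (\1b - a) = \1b - a ^b n.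
Proof.
have ca k : a ^b k *b a = a *b a ^b k.
  by have := bexp_addn a k 1; rewrite addn1 !bexpS bmul1r => <-.
elim: n => [|n [IH1 IH2]]; first by rewrite big_ord0 bmul0r bmul0l subrr.
split; rewrite big_ord_recr /=.
  by rewrite bmulDr IH1 bmulBl bmul1l -bexpS; zmod.
by rewrite bmulDl IH2 bmulBr bmul1r ca -bexpS; zmod.
Qed.

Lemma neumann_half a : nr a <= 2^-1 -> invertible (\1b - a).
Proof.
move=> ha; pose s n := \sum_(k < n) a ^b k.
have step n : nr (a ^b n) <= (2 ^+ n)^-1.
  by apply: (le_trans (nr_bexp _ _)); rewrite -exprVn lerXn2r ?nnegrE ?nr_ge0 ?invr_ge0.
have dist n k : nr (s (n + k)%N - s n) <= 2 / 2 ^+ n - 2 / 2 ^+ (n + k).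
  elim: k => [|k IH]; first by rewrite addn0 !subrr nr0.
  rewrite addnS /s big_ord_recr /= -/(s (n + k)%N).
  have -> : s (n + k)%N + a ^b (n + k) - s n = (s (n + k)%N - s n) + a ^b (n + k) by zmod.
  apply: (le_trans (nrD _ _)); have := step (n + k)%N.
  have -> : 2 / 2 ^+ (n + k).+1 = (2 ^+ (n + k))^-1 :> R.
    by rewrite exprS invfM mulrA divff ?mul1r.
  lra.
have hc : nr_cauchy s.
  move=> e e0; have [N hN] := exp2_small 4 e0; exists N => m n Nm Nn.
  apply: le_lt_trans (nr_tri (s N) _ _) _; rewrite -(subnKC Nm) -(subnKC Nn) [X in _ + X]nrBC.
  have := dist N (m - N)%N; have := dist N (n - N)%N.
  have p k : 0 <= 2 / 2 ^+ k :> R by rewrite divr_ge0 // exprn_ge0.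
  have := p (N + (m - N))%N; have := p (N + (n - N))%N; lra.
have /cvg_nrP hl := banach_complete hc.
set l := lim _ in hl.
have sl n : (\1b - a) *b s n = \1b - a ^b n := (geometric_sum a n).1.
have sr n : s n *b (\1b - a) = \1b - a ^b n := (geometric_sum a n).2.
pose M := nr (\1b - a) + 1.
have M0 : 0 < M by rewrite ltr_wpDl ?nr_ge0.
have small (y : B) : (forall n, nr (y - \1b) <= M * nr (l - s n) + (2 ^+ n)^-1) -> y = \1b.
  move=> hy; apply: nr_small_eq => e e0; have e2 : 0 < e / 2 by rewrite divr_gt0.
  have [N hN] := hl _ (divr_gt0 e2 M0); have [N' hN'] := exp2_small 1 e2.
  apply: (le_trans (hy (N + N')%N)); have := hN _ (leq_addr N' N).
  rewrite ltr_pdivlMr // nrBC => h1.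
  have h2 : (2 ^+ (N + N') : R)^-1 <= (2 ^+ N')^-1.
    by rewrite lef_pV2 ?posrE ?exprn_gt0 // exprD ler_peMl ?exprn_ge0 // exprn_ege1 // ler1n.
  rewrite mulrC; lra.
have Mle : nr (\1b - a) <= M by rewrite /M lerDl.
exists l; split; apply: small => n.
  have -> : (\1b - a) *b l - \1b = (\1b - a) *b (l - s n) - a ^b n by rewrite bmulBr sl; zmod.
  apply: (le_trans (nrB _ _)); apply: lerD; last exact: step.
  by apply: (le_trans (nr_bmul _ _)); apply: ler_wpM2r => //; exact: nr_ge0.
have -> : l *b (\1b - a) - \1b = (l - s n) *b (\1b - a) - a ^b n by rewrite bmulBl sr; zmod.
apply: (le_trans (nrB _ _)); apply: lerD; last exact: step.
by apply: (le_trans (nr_bmul _ _)); rewrite mulrC; apply: ler_wpM2r => //; exact: nr_ge0.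
Qed.

Lemma invertibleM a b : invertible a -> invertible b -> invertible (a *b b).
Proof.
move=> [a' [h1 h2]] [b' [h3 h4]]; exists (b' *b a'); split.
  by rewrite bmulA -(bmulA a) h3 bmul1r.
by rewrite bmulA -(bmulA b') h2 bmul1r.
Qed.

(** Some power [a ^b n] has norm at most 1/2, and [\1b - a] is a factor of [\1b - a ^b n], so the
    case of ratio 1/2 suffices. *)
Lemma neumann a : nr a < 1 -> invertible (\1b - a).
Proof.
move=> ha; have [n hn] : exists n, nr a ^+ n <= 2^-1.
  have [a0|a0] := eqVneq (nr a) 0; first by exists 1%N; rewrite a0 expr1 invr_ge0.
  have := cvg_expr (_ : `|nr a| < 1); rewrite ger0_norm ?nr_ge0 // => /(_ ha).
  move=> /cvgrPdist_lt/(_ 2^-1); rewrite invr_gt0 ltr0n => /(_ isT) [n _ /(_ n (leqnn n))].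
  by rewrite sub0r normrN ger0_norm ?exprn_ge0 ?nr_ge0 // => h; exists n; exact: ltW.
have [s1 s2] := geometric_sum a n; set s := \sum_(k < n) _ in s1 s2.
have [b [h1 h2]] : invertible (\1b - a ^b n).
  by apply: neumann_half; apply: le_trans hn; exact: nr_bexp.
exists (s *b b); split; first by rewrite bmulA s1.
(* [s] commutes with [\1b - a ^b n], hence with the inverse [b]; this turns the right inverse into a
   left one. *)
have eq : s *b b = b *b s.
  have c : (\1b - a ^b n) *b s = s *b (\1b - a ^b n) by rewrite -{1}s2 -{1}s1 bmulA.
  by rewrite -[LHS]bmul1l -h2 -bmulA (bmulA _ s) c -(bmulA s) h1 bmul1r.
by rewrite eq -bmulA s2.
Qed.

Lemma invertible_near a x : invertible a -> nr (x - a) * nr (binv a) <= 2^-1 -> invertible x.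
Proof.
move=> ia h; have [h1 h2] := binvP ia.
have -> : x = a *b (\1b - binv a *b (a - x)).
  by rewrite bmulBr bmul1r bmulA h1 bmul1l; zmod.
apply: invertibleM => //; apply: neumann_half; apply: le_trans h.
by rewrite mulrC nrBC; exact: nr_bmul.
Qed.

Definition resolvent (a : B) (l : C) : B := binv (l *: \1b - a).

Lemma resolventP a l : ~ spectrum a l ->
  (l *: \1b - a) *b resolvent a l = \1b /\ resolvent a l *b (l *: \1b - a) = \1b.
Proof. by move/contrapT; exact: binvP. Qed.

Lemma scale_bone_subB a l l' : (l' *: \1b - a) - (l *: \1b - a) = (l' - l) *: (\1b : B).
Proof. by rewrite scalerBl; zmod. Qed.

(** The first resolvent identity. Used twice, it gives the quadratic remainder in
    [resolvent_cderiv]. *)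
Lemma resolvent_eq a l l' : ~ spectrum a l -> ~ spectrum a l' ->
  resolvent a l' = resolvent a l - (l' - l) *: (resolvent a l' *b resolvent a l).
Proof.
move=> /resolventP[h1 h2] /resolventP[h3 h4].
have -> : (l' - l) *: (resolvent a l' *b resolvent a l) =
   resolvent a l' *b ((l' - l) *: \1b *b resolvent a l) by rewrite bmulZl bmul1l bmulZr.
rewrite -(scale_bone_subB a) bmulBl h1 bmulBr bmulA h4 bmul1l bmul1r; zmod.
Qed.

Lemma resolvent_near a l l' : ~ spectrum a l -> nr (l' - l) * nr (resolvent a l) <= 2^-1 ->
  ~ spectrum a l' /\ nr (resolvent a l') <= 2 * nr (resolvent a l).
Proof.
move=> hl h; have il : invertible (l *: \1b - a) by exact: contrapT.
have il' : invertible (l' *: \1b - a).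
  by apply: (invertible_near il); rewrite scale_bone_subB nrZ nr_bone mulr1.
have hl' : ~ spectrum a l' by move=> /(_ il').
split=> //; have E := resolvent_eq hl hl'.
have := nrB (resolvent a l) ((l' - l) *: (resolvent a l' *b resolvent a l)); rewrite -E nrZ.
have := nr_bmul (resolvent a l') (resolvent a l).
have := nr_ge0 (resolvent a l'); have := nr_ge0 (resolvent a l); have := nr_ge0 (l' - l); nra.
Qed.

Lemma open_resolvent_set a : open (~` spectrum a).
Proof.
apply/open_nrP => l hl.
have p0 : 0 < 2 * (nr (resolvent a l) + 1) by rewrite mulr_gt0 // ltr_wpDl ?nr_ge0.
exists (2 * (nr (resolvent a l) + 1))^-1; first by rewrite invr_gt0.
move=> l' hl'; apply: (resolvent_near hl _).1.
have := hl'; rewrite -[(_ * _)^-1]mul1r ltr_pdivlMr //.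
have := nr_ge0 (l' - l); have := nr_ge0 (resolvent a l); nra.
Qed.

Lemma resolvent_cderiv a l : ~ spectrum a l ->
  cderiv (resolvent a) l (- (resolvent a l *b resolvent a l)).
Proof.
move=> hl e e0; set r := nr (resolvent a l).
have r0 : 0 <= r := nr_ge0 _.
have p0 : 0 < 2 * (r + 1) by rewrite mulr_gt0 // ltr_wpDl.
have p1 : 0 < 2 * r ^+ 3 + 1 by rewrite ltr_wpDl // mulr_ge0 // exprn_ge0.
(* The first radius keeps the norm of [resolvent a l'] below [2 * r]; the remainder is then at most
   [2 * r ^+ 3] times the square of [nr (l' - l)], which the second radius controls. *)
exists (Num.min (2 * (r + 1))^-1 (e / (2 * r ^+ 3 + 1))); first by rewrite lt_min invr_gt0 p0 divr_gt0.
move=> l'; rewrite lt_min -[(_ * _)^-1]mul1r !ltr_pdivlMr // => /andP[k1 k2].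
have n0 := nr_ge0 (l' - l).
have [hl' rl'] : ~ spectrum a l' /\ nr (resolvent a l') <= 2 * r.
  by apply: resolvent_near => //; rewrite -/r; nra.
have E1 := resolvent_eq hl hl'.
have -> : resolvent a l' - resolvent a l - (l' - l) *: - (resolvent a l *b resolvent a l) =
   (l' - l) *: ((l' - l) *: (resolvent a l' *b resolvent a l *b resolvent a l)).
  have -> : (l' - l) *: (resolvent a l' *b resolvent a l *b resolvent a l) =
      (resolvent a l - resolvent a l') *b resolvent a l.
    by rewrite {2}E1 opprB addrCA subrr addr0 bmulZl.
  by rewrite scalerN bmulBl scalerBr {1}E1; zmod.
rewrite !nrZ mulrC; apply: ler_wpM2r => //.
apply: (@le_trans _ _ (nr (l' - l) * (2 * r * r * r))).
  apply: ler_wpM2l => //; apply: (le_trans (nr_bmul _ _)); apply: ler_wpM2r => //.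
  by apply: (le_trans (nr_bmul _ _)); apply: ler_wpM2r.
have -> : 2 * r * r * r = 2 * r ^+ 3 by ring.
have : 0 <= r ^+ 3 by rewrite exprn_ge0.
nra.
Qed.

Lemma spectrum_bound_strict a l : nr a < nr l -> ~ spectrum a l /\ nr (resolvent a l) <= (nr l - nr a)^-1.
Proof.
move=> hl; have bound : ~ spectrum a l -> nr (resolvent a l) <= (nr l - nr a)^-1.
  move=> /resolventP[h1 _].
  have E : l *: resolvent a l = \1b + a *b resolvent a l.
    by rewrite -h1 bmulBl bmulZl bmul1l; zmod.
  have := nrD \1b (a *b resolvent a l); rewrite -E nrZ nr_bone.
  have := nr_bmul a (resolvent a l) => k1 k2.
  rewrite -[_^-1]mul1r ler_pdivlMr ?subr_gt0 //; lra.
suff hn : ~ spectrum a l by split=> //; exact: bound.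
have l0 : 0 < nr l by apply: le_lt_trans hl; exact: nr_ge0.
have l0' : l != 0 by rewrite -nr_gt0.
move=> /(_ _); apply.
have -> : l *: \1b - a = (l *: \1b) *b (\1b - l^-1 *: a).
  by rewrite bmulZl bmul1l scalerBr scalerA divff // scale1r.
apply: invertibleM.
  by exists (l^-1 *: \1b); rewrite !bmulZl !bmulZr !bmul1l !scalerA divff // mulVf // !scale1r.
by apply: neumann; rewrite nrZ nrV ltr_pdivrMl // mulr1.
Qed.

Lemma compact_spectrum a : compact (spectrum a).
Proof.
apply: compact_of_closed_bounded.
  apply/closed_nrP; rewrite -[spectrum a]setCK; apply: open_closedC; exact: open_resolvent_set.
exists (nr a) => l hl; rewrite leNgt; apply/negP => h.
by have [] := spectrum_bound_strict h.
Qed.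

End BanachAlgebraTheory.

(** * Reversed and concatenated cycles, and the integral of the resolvent *)

Section FunctionalCalculus.
Variable R : realType.
Local Notation C := (R[i] : numFieldType).
Local Notation hC := (@complex_nr_complete R).

(** Reversing the vertices flips every edge, but the closing edge changes its place, so the lists
    agree only up to a permutation. *)
Lemma poly_edges_rev (p : seq C) :
  perm_eq (poly_edges (rev p)) (map (@eflip C) (poly_edges p)).
Proof.
have zip_flip (s t : seq C) : map (@eflip C) (zip s t) = zip t s.
  by elim: s t => [|x s IH] [|y t] //=; rewrite IH.
rewrite /poly_edges zip_flip -rev_rotr -rev_zip ?size_rotr // perm_rev.
rewrite -(perm_rot 1); apply: (perm_trans _ (perm_refl _)).
have rz (s t : seq C) : size s = size t -> rot 1 (zip s t) = zip (rot 1 s) (rot 1 t).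
  by case: s t => [|x s] [|y t] //= [st]; rewrite !rot1_cons zip_rcons.
by rewrite rz ?size_rotr // rotrK.
Qed.

Definition cycle_opp (G : seq (seq C)) := map rev G.

Lemma cycle_opp_edges G : perm_eq (cycle_edges (cycle_opp G)) (map (@eflip C) (cycle_edges G)).
Proof.
elim: G => [//|p G IH]; rewrite /cycle_edges /= map_cat.
by apply: perm_cat => //; exact: poly_edges_rev.
Qed.

Lemma cycle_opp_int (V : normedModType C) G (h : C -> V) : cycle_int (cycle_opp G) h = - cycle_int G h.
Proof.
rewrite !edges_intE (edges_int_perm h (cycle_opp_edges G)) /edges_int big_map -sumrN.
by apply: eq_bigr => -[a b] _; exact: seg_int_rev.
Qed.

Lemma cycle_opp_trace G : cycle_trace (cycle_opp G) `<=` cycle_trace G.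
Proof.
rewrite !cycle_traceE (edges_trace_perm (cycle_opp_edges G)) => z [e /mapP[[a b] he ->] hz].
by exists (a, b) => //; exact: segment_flip.
Qed.

Lemma cycle_cat_int (V : normedModType C) G H (h : C -> V) :
  cycle_int (G ++ H) h = cycle_int G h + cycle_int H h.
Proof. by rewrite /cycle_int /cycle_edges map_cat flatten_cat big_cat. Qed.

Lemma cycle_cat_trace (G H : seq (seq C)) : cycle_trace (G ++ H) `<=` cycle_trace G `|` cycle_trace H.
Proof.
rewrite !cycle_traceE /cycle_edges map_cat flatten_cat => z [e]; rewrite mem_cat => /orP[he hz|he hz].
  by left; exists e.
by right; exists e.
Qed.

(** [G] followed by the reversed [H] has winding number 0 around every point off [Om], so the
    homology form applies to it. *)
Lemma homologous_cycles (V : normedModType C) (Om : set C) (G H : seq (seq C)) (F : C -> V) :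
  nr_complete V -> open Om -> (forall w, Om w -> exists D, cderiv F w D) ->
  cycle_trace G `<=` Om -> cycle_trace H `<=` Om ->
  (forall w, ~ Om w -> cycle_int G (fun l => (l - w)^-1 : C) = cycle_int H (fun l => (l - w)^-1 : C)) ->
  cycle_int G F = cycle_int H F.
Proof.
move=> hV oOm hF GOm HOm GH; apply/eqP; rewrite -subr_eq0 -cycle_opp_int -cycle_cat_int; apply/eqP.
apply: (homology_cauchy hV oOm hF).
  by move=> z /cycle_cat_trace[/GOm //|/cycle_opp_trace/HOm].
by move=> w /GH h; rewrite cycle_cat_int cycle_opp_int h subrr.
Qed.

Variable B : banachAlgType C.
Local Notation hB := (@banach_complete R B).

(* On a large square the resolvent differs from l^-1 by O(|l|^-2). *)
Lemma resolvent_square_int (T : B) (M : R) : nr T < M ->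
  nr (cycle_int (square_cycle ((- M) +i* (- M) : C) (2 * M)) (resolvent T) - two_pi_i R *: \1b) <=
  16 * (nr T + 1) / (M - nr T).
Proof.
move=> TM; have T0 := nr_ge0 T; have M0 : 0 < M by lra.
set p : C := (- M) +i* (- M); set G := square_cycle p (2 * M).
have far l : cycle_trace G l -> M <= nr l /\ square p (2 * M) l.
  move=> hl; have M20 : 0 <= 2 * M by lra.
  have [sq h] := square_trace M20 hl; split=> //; move: h; rewrite !raddfB /= => h.
  have k (x : R) : x - - M = 0 \/ x - - M = 2 * M -> M <= `|x|.
    by case=> e; [rewrite -normrN|]; apply: le_trans (ler_norm _); lra.
  case: h => e; [apply: le_trans (nr_Re _)|apply: le_trans (nr_Re _)|apply: le_trans (nr_Im _)|apply: le_trans (nr_Im _)];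
    apply: k; auto.
have nsp l : cycle_trace G l -> ~ spectrum T l /\ nr (resolvent T l) <= (M - nr T)^-1.
  move=> /far[h _]; have TL : nr T < nr l by lra.
  have [h1 h2] := spectrum_bound_strict TL; split=> //; apply: (le_trans h2).
  by rewrite lef_pV2 ?posrE ?subr_gt0 //; lra.
have ne0 l : cycle_trace G l -> l != 0 by move=> /far[h _]; rewrite -nr_gt0; lra.
have c1 : edges_cont (cycle_edges G) (resolvent T).
  by apply: edges_cont_ccont => l; rewrite -cycle_traceE => /nsp[h _]; exact: cderiv_ccont (resolvent_cderiv h).
have ci : edges_cont (cycle_edges G) (fun l => (l - 0)^-1 : C).
  by apply: edges_cont_ccont => l; rewrite -cycle_traceE => /ne0 h; exact: cderiv_ccont (cderiv_subV h).
have bl : bounded_linear (fun c : C => c *: (\1b : B)) := bounded_linear_scaler (\1b : B).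
have c2 := edges_cont_linear bl ci.
have c3 := edges_cont_linear (bounded_linear_scale B (-1 : C)) c2.
have z0 : square_in p (2 * M) 0.
  by split; apply/andP; split; rewrite /=; lra.
have W := square_winding z0.
have E2 : cycle_int G (fun l => (l - 0)^-1 *: (\1b : B)) = two_pi_i R *: \1b.
  by rewrite -W; exact: (edges_int_linear hC bl ci).
have -> : cycle_int G (resolvent T) - two_pi_i R *: \1b =
    edges_int (cycle_edges G) (fun l => resolvent T l + (-1 : C) *: ((l - 0)^-1 *: \1b)).
  by rewrite -E2 !edges_intE (edges_intD hB c1 c3) (edges_intZ hB _ c2) scaleN1r.
(* Four sides of length [2 * M], each bounded crudely by [4 * M]. *)
have len : edges_length (cycle_edges G) <= 16 * M.
  rewrite /edges_length /G /cycle_edges /= !big_cons big_nil /=.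
  have E (x y : C) : p + x - (p + y) = x - y by ring.
  have E0 (x : C) : p + x - p = x by rewrite addrC addKr.
  have E1 (x : C) : p - (p + x) = - x by ring.
  rewrite !E E0 E1.
  have b (x : C) : `|complex.Re x| + `|complex.Im x| <= 4 * M -> nr x <= 4 * M by exact: le_trans (nr_ReIm _).
  have n (x : R) : `|x - x| = 0 by rewrite subrr normr0.
  have := @b ((2 * M) +i* 0 : C); have := @b (((2 * M) +i* (2 * M) : C) - ((2 * M) +i* 0 : C)).
  have := @b ((0 +i* (2 * M) : C) - ((2 * M) +i* (2 * M) : C)); have := @b (- (0 +i* (2 * M) : C)).
  rewrite !raddfB !raddfN /= ?n !subr0 ?sub0r !normrN ?oppr0 normr0 (ger0_norm (_ : 0 <= 2 * M)); last by lra.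
  lra.
apply: (@le_trans _ _ (edges_length (cycle_edges G) * (M^-1 * (nr T * (M - nr T)^-1)))).
  apply: (edges_int_bound hB); first exact: edges_contD.
  move=> l; rewrite -cycle_traceE => hl; have [h1 h2] := nsp _ hl; have [h3 _] := far _ hl.
  have l0 := ne0 _ hl; have [k1 _] := resolventP h1.
  have -> : resolvent T l + (-1 : C) *: ((l - 0)^-1 *: \1b) = l^-1 *: (T *b resolvent T l).
    rewrite subr0 scaleN1r -k1 bmulBl bmulZl bmul1l scalerBr scalerA mulVf // scale1r; zmod.
  rewrite nrZ nrV; apply: ler_pM; rewrite ?invr_ge0 ?nr_ge0 //.
    by rewrite lef_pV2 ?posrE //; lra.
  by apply: (le_trans (nr_bmul _ _)); apply: ler_wpM2l.
have p0 : 0 < M - nr T by lra.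
have q0 : 0 <= (M - nr T)^-1 by rewrite invr_ge0 ltW.
apply: (@le_trans _ _ (16 * M * (M^-1 * (nr T * (M - nr T)^-1)))).
  by apply: ler_wpM2r => //; rewrite mulr_ge0 ?invr_ge0 ?mulr_ge0 // ltW.
have -> : 16 * M * (M^-1 * (nr T * (M - nr T)^-1)) = 16 * nr T / (M - nr T).
  by field; rewrite !gt_eqF.
by apply: ler_wpM2r => //; lra.
Qed.

(** Off the spectrum [G] is homologous to every large square centred at 0. The size [M] is chosen so
    that the bound of [resolvent_square_int] drops to [e]. *)
Lemma resolvent_int (T : B) G : (forall l, cycle_trace G l -> ~ spectrum T l) ->
  (forall w, spectrum T w -> cycle_int G (fun l => (l - w)^-1 : C) = two_pi_i R) ->
  cycle_int G (resolvent T) = two_pi_i R *: \1b.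
Proof.
move=> hG hW; apply: nr_small_eq => e e0.
have T0 := nr_ge0 T; have p0 : 0 < 16 * (nr T + 1) by lra.
pose M := nr T + 1 + 16 * (nr T + 1) / e.
have q0 : 0 < 16 * (nr T + 1) / e by rewrite divr_gt0.
have TM : nr T < M by rewrite /M; lra.
have -> : cycle_int G (resolvent T) = cycle_int (square_cycle ((- M) +i* (- M) : C) (2 * M)) (resolvent T).
  apply: (homologous_cycles (Om := ~` spectrum T) hB).
  - exact: open_resolvent_set.
  - by move=> w hw; eexists; exact: resolvent_cderiv.
  - by [].
  - move=> l hl; have M20 : 0 <= 2 * M by rewrite /M; lra.
    have [_ h] := square_trace M20 hl; apply: (spectrum_bound_strict _).1; apply: (lt_le_trans TM).
    have k (x : R) : x - - M = 0 \/ x - - M = 2 * M -> M <= `|x|.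
      by case=> ee; [rewrite -normrN|]; apply: le_trans (ler_norm _); lra.
    move: h; rewrite !raddfB /= => h.
    case: h => ee; [apply: le_trans (nr_Re _)|apply: le_trans (nr_Re _)|apply: le_trans (nr_Im _)|apply: le_trans (nr_Im _)];
      apply: k; auto.
  - move=> w /contrapT hw; rewrite hW //; symmetry; apply: square_winding.
    have wT : nr w <= nr T by rewrite leNgt; apply/negP => /spectrum_bound_strict[].
    have := nr_Re w; have := nr_Im w; rewrite !ler_norml => /andP[a1 a2] /andP[b1 b2].
    by rewrite /square_in /= !raddfB /=; split; apply/andP; split; lra.
apply: (le_trans (resolvent_square_int TM)).
rewrite ler_pdivrMr ?subr_gt0 // /M.
have -> : e * (nr T + 1 + 16 * (nr T + 1) / e - nr T) = e + 16 * (nr T + 1) by field; rewrite gt_eqF.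
lra.
Qed.

End FunctionalCalculus.

(** * The calculus along a fixed cycle and the rigidity principle *)

Section HolomorphicCalculus.
Variable R : realType.
Local Notation C := (R[i] : numFieldType).
Local Notation hC := (@complex_nr_complete R).

Definition hol (U : set C) (f : C -> C) := forall z, U z -> exists D, cderiv f z D.

Lemma holP (U : set C) f : holomorphic_on U f <-> hol U f.
Proof. by split=> h z Uz; apply/derivable_cderivP; exact: h. Qed.

Lemma hol_cst (U : set C) c : hol U (fun=> c).
Proof. by move=> z _; exists 0; exact: cderiv_cst. Qed.

Lemma hol_id (U : set C) : hol U id.
Proof. by move=> z _; exists 1; exact: cderiv_id. Qed.

Lemma holD (U : set C) f g : hol U f -> hol U g -> hol U (fun z => f z + g z).
Proof. by move=> hf hg z Uz; have [D hD] := hf _ Uz; have [E hE] := hg _ Uz; exists (D + E); exact: cderivD. Qed.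

Lemma holM (U : set C) f g : hol U f -> hol U g -> hol U (fun z => f z * g z).
Proof.
move=> hf hg z Uz; have [D hD] := hf _ Uz; have [E hE] := hg _ Uz.
by eexists; exact: (cderivZ hD hE).
Qed.

Lemma holZ (U : set C) c f : hol U f -> hol U (fun z => c * f z).
Proof. exact/holM/hol_cst. Qed.

Lemma hol_sum (U : set C) (I : Type) (s : seq I) (f : I -> C -> C) : (forall i, hol U (f i)) ->
  hol U (fun z => \sum_(i <- s) f i z).
Proof.
move=> hf; elim: s => [|i s IH].
  rewrite (_ : (fun z => _) = fun=> 0); first exact: hol_cst.
  by apply/funext => z; rewrite big_nil.
rewrite (_ : (fun z => _) = fun z => f i z + \sum_(j <- s) f j z); first exact: holD.
by apply/funext => z; rewrite big_cons.
Qed.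

Lemma closed_ball_compact (c : C) (r : R) : compact [set z | nr (z - c) <= r].
Proof.
apply: compact_of_closed_bounded.
  move=> x hx /=; apply/ler_addgt0Pr => e e0; have [y /= hy yx] := hx _ e0.
  by apply: (le_trans (nr_tri y _ _)); rewrite nrBC; lra.
by exists (r + nr c) => z /= hz; have := nr_lower z c; lra.
Qed.

Lemma ccont_eq_at (V : normedModType C) (F G : C -> V) (l : C) (r : R) : 0 < r ->
  (forall w, nr (w - l) < r -> w != l -> F w = G w) -> ccont F l -> ccont G l -> F l = G l.
Proof.
move=> r0 FG cF cG; apply: nr_small_eq => e e0; have e2 : 0 < e / 2 by rewrite divr_gt0.
have [d1 d10 h1] := cF _ e2; have [d2 d20 h2] := cG _ e2.
pose m := Num.min r (Num.min d1 d2).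
have m0 : 0 < m by rewrite !lt_min r0 d10.
have t0 : 0 < m / 2 by rewrite divr_gt0.
have tm : m / 2 < m by lra.
have wl : nr (l + (m / 2)%:C - l) = m / 2 by rewrite [l + _]addrC addrK nr_real ger0_norm // ltW.
move: (l + (m / 2)%:C) wl => w wl.
have wnl : w != l by rewrite -subr_eq0 -nr_gt0 wl.
have k1 : nr (F w - F l) < e / 2 by apply: h1; rewrite wl; apply: (lt_le_trans tm); rewrite /m !ge_min lexx orbT.
have k2 : nr (G w - G l) < e / 2 by apply: h2; rewrite wl; apply: (lt_le_trans tm); rewrite /m !ge_min lexx !orbT.
rewrite FG // in k1; last by rewrite wl; apply: (lt_le_trans tm); rewrite /m ge_min lexx.
by apply: (le_trans (nr_tri (G w) _ _)); rewrite (nrBC (F l)); lra.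
Qed.

(** The issue is differentiability at [l] itself, a removable singularity. Around [l] the quotient
    is the Cauchy integral of [f x / (x - l)] over a cycle around a ball, and such integrals are
    differentiable. The rigidity principle needs these quotients as elements of O(U). *)
Lemma slope_hol (U : set C) f l : open U -> hol U f -> U l ->
  exists2 g, hol U g & forall z, (l - z) * g z = f l - f z.
Proof.
move=> oU hf Ul; have [D hD] := hf _ Ul.
exists (slope f l D); last first.
  move=> z; rewrite /slope; case: eqVneq => [->|zl]; first by rewrite !subrr mul0r.
  by rewrite -[_ *: _]/(_ * _); field; rewrite subr_eq0.
move=> z Uz; have [->|zl] := eqVneq z l; last by have [E /slope_cderiv] := hf _ Uz; exact.
have [r r0 hr] := (open_nrP U).1 oU _ Ul.
pose K := [set z | nr (z - l) <= r / 2].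
have KU : K `<=` U by move=> w /= hw; apply: hr; apply: le_lt_trans hw _; lra.
have r2 : 0 < r / 2 by rewrite divr_gt0.
have [G [GU GK hG]] := grid_cycle (@closed_ball_compact l (r / 2)) oU KU.
have [_ hGf] := hG _ f hC hf.
have Kl : K l by rewrite /K /= subrr nr0 ltW.
have GK' w : K w -> ~ edges_trace (cycle_edges G) w by rewrite -cycle_traceE; exact: GK.
have ne w x : K w -> edges_trace (cycle_edges G) x -> x != w.
  by move=> Kw hx; apply/eqP => xw; rewrite xw in hx; exact: (GK' _ Kw).
have cf x : edges_trace (cycle_edges G) x -> ccont f x.
  by rewrite -cycle_traceE => /GU/hf[E]; exact: cderiv_ccont.
pose phi x : C := (x - l)^-1 *: f x.
have cphi x : edges_trace (cycle_edges G) x -> ccont phi x.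
  move=> hx; have [E hE] : exists E, cderiv f x E by apply: hf; apply: GU; rewrite cycle_traceE.
  exact: cderiv_ccont (cderivZ (cderiv_subV (ne _ _ Kl hx)) hE).
pose H w : C := (two_pi_i R)^-1 *: edges_int (cycle_edges G) (fun x => (x - w)^-1 *: phi x).
have cc w (n : nat) F : (forall x, edges_trace (cycle_edges G) x -> ccont F x) -> K w ->
    edges_cont (cycle_edges G) (fun x => (x - w)^-1 *: F x : C).
  move=> hF Kw; apply: edges_cont_ccont => x hx.
  by have := @cauchy_kernel_cont R _ _ F w 1 (GK' _ Kw) hF x hx.
have Heq w : K w -> w != l -> H w = slope f l D w.
  move=> Kw wl; rewrite /slope (negbTE wl).
  have wl' : w - l != 0 by rewrite subr_eq0.
  have e1 : f w = (two_pi_i R)^-1 *: edges_int (cycle_edges G) (fun x => (x - w)^-1 *: f x).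
    by rewrite -edges_intE hGf // scalerA mulVf ?scale1r // two_pi_i_neq0.
  have e2 : f l = (two_pi_i R)^-1 *: edges_int (cycle_edges G) (fun x => (x - l)^-1 *: f x).
    by rewrite -edges_intE hGf // scalerA mulVf ?scale1r // two_pi_i_neq0.
  have c1 := cc w 0%N f cf Kw; have c2 := cc l 0%N f cf Kl.

  have e3 : edges_int (cycle_edges G) (fun x => (x - w)^-1 *: f x) - edges_int (cycle_edges G) (fun x => (x - l)^-1 *: f x)
     = (w - l) *: edges_int (cycle_edges G) (fun x => (x - w)^-1 *: phi x).
    have c4 := cc w 0%N phi cphi Kw.
    apply/eqP; rewrite subr_eq; apply/eqP.
    rewrite -(edges_intZ hC _ c4) -(edges_intD hC (edges_cont_linear (bounded_linear_scale C (w - l)) c4) c2).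
    apply: edges_int_ext => x hx; rewrite /phi -![_ *: _]/(_ * _).
    have := ne _ _ Kw hx; have := ne _ _ Kl hx; rewrite -[x == l]subr_eq0 -[x == w]subr_eq0 => n1 n2.
    by field; rewrite n1 n2.
  rewrite {1}e1 {1}e2 -scalerBr e3 /H !scalerA; congr (_ *: _).
  by rewrite [RHS]mulrC mulVKf.
have cH := cauchy_transform_cderiv hC (GK' _ Kl) cphi.
have dH := cderivZ (cderiv_cst (two_pi_i R)^-1 l) cH.
have Hl : H l = slope f l D l.
  apply: (ccont_eq_at r2 _ (cderiv_ccont dH) (slope_ccont hD)) => w wr wl.
  by apply: Heq => //; exact: ltW.
eexists; apply: (@cderiv_ext _ _ H _ _ _ (r / 2) r2 _ dH) => w hw.
have [->//|wl] := eqVneq w l.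
by apply: Heq => //; exact: ltW.
Qed.

Variable B : banachAlgType C.
Local Notation hB := (@banach_complete R B).

(** The conditions of [holo_calc_rel] on the cycle, with the winding integral not divided by 2 pi
    i. *)
Definition surrounds (G : seq (seq C)) (U : set C) (A : B) :=
  [/\ cycle_trace G `<=` U `\` spectrum A,
      (forall w, spectrum A w -> cycle_int G (fun l => (l - w)^-1 : C) = two_pi_i R) &
      (forall w, ~ U w -> cycle_int G (fun l => (l - w)^-1 : C) = 0)].

(** The calculus for a named cycle. [holo_calc] selects a value by choice, so identities are proved
    for [calc] and transferred by [holo_calcE]. *)
Definition calc (A : B) (G : seq (seq C)) (f : C -> C) : B :=
  (two_pi_i R)^-1 *: cycle_int G (fun l => f l *: resolvent A l).

Lemma calc_integrand_cderiv (U : set C) (A : B) f l : hol U f -> U l -> ~ spectrum A l ->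
  exists D, cderiv (fun l => f l *: resolvent A l) l D.
Proof.
move=> hf Ul hl; have [D hD] := hf _ Ul.
by eexists; exact: (cderivZ hD (resolvent_cderiv hl)).
Qed.

Lemma calc_edges_cont (U : set C) (A : B) G f : surrounds G U A -> hol U f ->
  edges_cont (cycle_edges G) (fun l => f l *: resolvent A l).
Proof.
move=> [GU _ _] hf; apply: edges_cont_ccont => l; rewrite -cycle_traceE => /GU[Ul hl].
by have [D /cderiv_ccont] := calc_integrand_cderiv hf Ul hl.
Qed.

(** The integrand is holomorphic on [U] minus the spectrum. A point off this set is either off [U],
    where both cycles wind 0 times, or in the spectrum, where both wind once. *)
Lemma calc_indep (U : set C) (A : B) G H f : open U -> surrounds G U A -> surrounds H U A ->
  hol U f -> calc A G f = calc A H f.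
Proof.
move=> oU [GU G1 G0] [HU H1 H0] hf; congr (_ *: _).
apply: (homologous_cycles (Om := U `\` spectrum A) hB) => //.
- by rewrite setDE; apply: openI => //; exact: open_resolvent_set.
- by move=> w [Uw hw]; exact: (calc_integrand_cderiv hf).
move=> w hw; have [Uw|nUw] := pselect (U w); last by rewrite G0 ?H0.
have sw : spectrum A w by apply: contrapT => h; apply: hw.
by rewrite G1 ?H1.
Qed.

(** [K] is joined to the spectrum before the grid is drawn, so that one cycle carries both the
    resolvent integrals and Cauchy's formula on [K]. *)
Lemma surrounds_exists (U K : set C) (A : B) : open U -> spectrum A `<=` U -> compact K -> K `<=` U ->
  exists G, [/\ surrounds G U A, (forall w, K w -> ~ cycle_trace G w) &
    forall f, hol U f -> forall w, K w -> cycle_int G (fun l => (l - w)^-1 *: f l) = two_pi_i R *: f w].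
Proof.
move=> oU AU cK KU.
have cKA : compact (K `|` spectrum A) by apply: compactU => //; exact: compact_spectrum.
have KAU : K `|` spectrum A `<=` U by move=> w [/KU|/AU].
have [G [GU GK hG]] := grid_cycle cKA oU KAU.
exists G; split.
- split.
  + by move=> w hw; split; [exact: GU|move=> sw; apply: (GK w) => //; right].
  + move=> w sw; have [_ /(_ w (or_intror sw))] := hG _ (fun=> 1 : C) hC (@hol_cst U 1).
    rewrite -[_ *: 1]/(_ * 1) mulr1 => <-; apply: edges_int_ext => l _.
    by rewrite -[_ *: 1]/(_ * 1) mulr1.
  (* For [w] off [U] the function [(l - w)^-1] is holomorphic on [U], so its integral is 0. *)
  + move=> w hw; have [] := hG _ (fun l => (l - w)^-1 : C) hC _ => // z Uz.
    by eexists; apply: cderiv_subV; apply/eqP => zw; rewrite zw in Uz.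
- by move=> w Kw; apply: GK; left.
- by move=> f hf w Kw; have [_ h] := hG _ f hC hf; apply: h; left.
Qed.

Lemma calc_resolvent_int (U : set C) (A : B) G : surrounds G U A ->
  cycle_int G (resolvent A) = two_pi_i R *: \1b.
Proof. by move=> [GU G1 _]; apply: resolvent_int => // l /GU[]. Qed.

Lemma calc1 (U : set C) (A : B) G : surrounds G U A -> calc A G (fun=> 1) = \1b.
Proof.
move=> hG; rewrite /calc (_ : (fun l => 1 *: resolvent A l) = resolvent A).
  by rewrite (calc_resolvent_int hG) scalerA mulVf ?scale1r // two_pi_i_neq0.
by apply/funext => l; rewrite scale1r.
Qed.

Lemma calcD (U : set C) (A : B) G f g : surrounds G U A -> hol U f -> hol U g ->
  calc A G (fun z => f z + g z) = calc A G f + calc A G g.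
Proof.
move=> hG hf hg; rewrite /calc -scalerDr; congr (_ *: _).
rewrite !edges_intE -(edges_intD hB (calc_edges_cont hG hf) (calc_edges_cont hG hg)).
by apply: edges_int_ext => l _; rewrite scalerDl.
Qed.

Lemma calcZ (U : set C) (A : B) G c f : surrounds G U A -> hol U f ->
  calc A G (fun z => c * f z) = c *: calc A G f.
Proof.
move=> hG hf; rewrite /calc scalerA mulrC -scalerA; congr (_ *: _).
rewrite !edges_intE -(edges_intZ hB _ (calc_edges_cont hG hf)).
by apply: edges_int_ext => l _; rewrite scalerA.
Qed.

Lemma calc_sum (U : set C) (A : B) G (I : Type) (s : seq I) (f : I -> C -> C) : surrounds G U A ->
  (forall i, hol U (f i)) -> calc A G (fun z => \sum_(i <- s) f i z) = \sum_(i <- s) calc A G (f i).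
Proof.
move=> hG hf; elim: s => [|i s IH].
  rewrite big_nil /calc (_ : cycle_int _ _ = 0) ?scaler0 //.
  rewrite /cycle_int big1 // => e _; rewrite /seg_int (_ : (fun t => _) = fun=> 0).
    by rewrite unit_int_cst scaler0.
  by apply/funext => t; rewrite big_nil scale0r.
rewrite big_cons -IH -(calcD hG) //; last exact: hol_sum.
by congr (calc A G _); apply/funext => z; rewrite big_cons.
Qed.

Lemma calc_bound (U : set C) (A : B) G : surrounds G U A ->
  exists2 c : R, 0 <= c & forall f (M : R), hol U f -> (forall z, cycle_trace G z -> nr (f z) <= M) ->
    nr (calc A G f) <= c * M.
Proof.
move=> hG; have [GU _ _] := hG.
have [m m0 hm] : exists2 m : R, 0 < m & forall z, edges_trace (cycle_edges G) z -> nr (resolvent A z) <= m.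
  apply: (ccont_bounded (compact_edges_trace (E := cycle_edges G))) => l.
  by rewrite -cycle_traceE => /GU[_ h]; exact: cderiv_ccont (resolvent_cderiv h).
exists (nr (two_pi_i R)^-1 * (edges_length (cycle_edges G) * m)).
  by rewrite !mulr_ge0 ?nr_ge0 ?edges_length_ge0 // ltW.
move=> f M hf hM; rewrite /calc nrZ -mulrA; apply: ler_wpM2l; first exact: nr_ge0.
rewrite -mulrA; apply: (edges_int_bound hB (calc_edges_cont hG hf)) => z hz.
rewrite nrZ mulrC; apply: ler_pM; rewrite ?nr_ge0 //; [exact: hm|apply: hM].
by rewrite cycle_traceE.
Qed.

(** Under the integral, [l - A] times the resolvent at [w] is [l - w] times that resolvent plus
    [\1b]. The extra term [g w *: \1b] integrates to 0 by Cauchy's theorem. *)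
Lemma calc_module (U : set C) (A : B) G l g : open U -> surrounds G U A -> hol U g ->
  calc A G (fun z => (l - z) * g z) = (l *: \1b - A) *b calc A G g.
Proof.
move=> oU hG hg; have [GU _ G0] := hG.
rewrite /calc bmulZr; congr (_ *: _).
have cg := calc_edges_cont hG hg.
have hlg : hol U (fun z => (l - z) * g z).
  apply: holM => // z _; have := cderivD (cderiv_cst l z) (cderivZ (cderiv_cst (-1 : C) z) (cderiv_id z)).
  move=> h; eexists; apply: (@cderiv_ext _ _ _ _ _ _ 1) h => // w _.
  by rewrite scaleN1r.
have clg := calc_edges_cont hG hlg.
have cg' : edges_cont (cycle_edges G) (fun w => g w *: (\1b : B)).
  apply: (edges_cont_linear (bounded_linear_scaler (\1b : B))).
  by apply: edges_cont_ccont => w; rewrite -cycle_traceE => /GU[Uw _]; have [D /cderiv_ccont] := hg _ Uw.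
have g0 : edges_int (cycle_edges G) (fun w => g w *: (\1b : B)) = 0.
  apply: (homology_cauchy hB oU _ _ G0).
    move=> w Uw; have [D hD] := hg _ Uw; eexists; exact: (cderivZ hD (cderiv_cst _ w)).
  by move=> w /GU[].
rewrite edges_intE -[LHS]addr0 -g0 -(edges_intD hB clg cg').
rewrite -(edges_int_linear hB (bounded_linear_mull (l *: \1b - A)) cg).
apply: edges_int_ext => w; rewrite -cycle_traceE => /GU[_ hw].
have [k1 _] := resolventP hw.
rewrite bmulZr -[X in _ + g w *: X]k1 [(l - w) * g w]mulrC -scalerA -scalerDr; congr (_ *: _).
by rewrite !bmulBl !bmulZl !bmul1l scalerBl; zmod.
Qed.

(** Instead of integrating [D] of the quotients, one applies [D] to a finite Riemann sum of
    quotients. On [K] this sum is uniformly small, because Cauchy's formula for [f] and for 1 makes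
    its limit [f z - f z] up to a factor; the bound on [D] then makes the image small. Expanded term
    by term, the same image is nearly the difference of the two sides, up to 2 pi i. *)
Lemma functional_principle (U K : set C) (A : B) (D : (C -> C) -> B) (c : R) :
  open U -> spectrum A `<=` U -> compact K -> K `<=` U -> 0 <= c ->
  (forall f g, hol U f -> hol U g -> D (fun z => f z + g z) = D f + D g) ->
  (forall a f, hol U f -> D (fun z => a * f z) = a *: D f) ->
  (forall f (M : R), hol U f -> (forall z, K z -> nr (f z) <= M) -> 0 <= M -> nr (D f) <= c * M) ->
  (forall l g, hol U g -> D (fun z => (l - z) * g z) = (l *: \1b - A) *b D g) ->
  forall G f, surrounds G U A -> hol U f -> D f = calc A G f *b D (fun=> 1).
Proof.
move=> oU AU cK KU c0 DD DZ Dbound Dmod G f hG hf.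
have [H [hH HK hHC]] := surrounds_exists oU AU cK KU.
(* [G] may cross [K]; it is exchanged for the cycle [H], which carries Cauchy's formula on [K]. *)
rewrite (calc_indep oU hG hH hf); have [HU _ _] := hH.
have HKe w : K w -> ~ edges_trace (cycle_edges H) w by rewrite -cycle_traceE; exact: HK.
have HUe l : edges_trace (cycle_edges H) l -> U l /\ ~ spectrum A l by rewrite -cycle_traceE => /HU[].
have [g hg] : exists g : C -> C -> C, forall l, U l -> hol U (g l) /\ forall z, (l - z) * g l z = f l - f z.
  have /choice[g hg] : forall l, exists gl : C -> C, U l -> hol U gl /\ forall z, (l - z) * gl z = f l - f z.
    move=> l; have [Ul|nUl] := pselect (U l); last by exists (fun=> 0).
    by have [gl h1 h2] := slope_hol oU hf Ul; exists gl.
  by exists g.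
have D1 := @hol_cst U 1.
have Dg l : U l -> ~ spectrum A l -> D (g l) = resolvent A l *b (f l *: D (fun=> 1) - D f).
  move=> Ul sl; have [hgl gE] := hg _ Ul; have [_ r2] := resolventP sl.
  rewrite -[LHS]bmul1l -r2 -bmulA -(Dmod l _ hgl); congr (_ *b _).
  rewrite -[- D f]scaleN1r -(DZ _ _ D1) -(DZ _ _ hf) -DD; [|exact: holZ|exact: holZ].
  by congr D; apply/funext => z; rewrite gE mulr1 mulN1r.
have Dsum (s : seq (C * C)) : (forall p, p \in s -> U p.2) ->
    hol U (fun z => \sum_(p <- s) p.1 * g p.2 z) /\
    D (fun z => \sum_(p <- s) p.1 * g p.2 z) = \sum_(p <- s) p.1 *: D (g p.2).
  elim: s => [|p s IH] hs.
    have e0 : (fun z : C => \sum_(p <- [::]) p.1 * g p.2 z) = fun z => 0 * 1.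
      by apply/funext => z; rewrite big_nil mul0r.
    rewrite e0 big_nil (DZ _ _ D1) scale0r; split=> //; exact: holZ.
  have [h1 h2] := IH (fun q hq => hs q (mem_behead (s := p :: s) hq)).
  have [hp _] := hg _ (hs p (mem_head _ _)).
  have e1 : (fun z : C => \sum_(p <- p :: s) p.1 * g p.2 z) = fun z => p.1 * g p.2 z + \sum_(p <- s) p.1 * g p.2 z.
    by apply/funext => z; rewrite big_cons.
  rewrite e1 big_cons -h2 -(DZ _ _ hp) -DD //; [split=> //; apply: holD => //|]; exact: holZ.
suff h : two_pi_i R *: (calc A H f *b D (fun=> 1)) - two_pi_i R *: D f = 0.
  move/eqP: h; rewrite -scalerBr scaler_eq0 (negbTE (two_pi_i_neq0 R)) /= subr_eq0.
  by move/eqP => ->.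
have -> : two_pi_i R *: (calc A H f *b D (fun=> 1)) = cycle_int H (fun l => f l *: resolvent A l) *b D (fun=> 1).
  by rewrite /calc bmulZl scalerA divff ?scale1r // two_pi_i_neq0.
have -> : two_pi_i R *: D f = cycle_int H (resolvent A) *b D f.
  by rewrite (calc_resolvent_int hH) bmulZl bmul1l.
have [Mf Mf0 hMf] : exists2 M : R, 0 < M & forall z, K z -> nr (f z) <= M.
  by apply: ccont_bounded => // z /KU/hf[E]; exact: cderiv_ccont.
have cf l : edges_trace (cycle_edges H) l -> ccont f l.
  by move=> /HUe[/hf[E /cderiv_ccont]].
have c1 l : edges_trace (cycle_edges H) l -> ccont (fun=> 1 : C) l.
  by move=> _; exact: cderiv_ccont (cderiv_cst _ _).
have cR l : edges_trace (cycle_edges H) l -> ccont (resolvent A) l.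
  by move=> /HUe[_ h]; exact: cderiv_ccont (resolvent_cderiv h).
have cfR l : edges_trace (cycle_edges H) l -> ccont (fun l => f l *: resolvent A l) l.
  by move=> /HUe[h1 h2]; have [E /cderiv_ccont] := calc_integrand_cderiv hf h1 h2.
(* [T] collects the factors of the mesh error [e]: two quadrature errors in [B] and the bound on [D]
   of the sum of quotients. *)
pose T := nr (D (fun=> 1)) + nr (D f) + c * (1 + Mf).
have T0 : 0 <= T by rewrite !addr_ge0 ?nr_ge0 ?mulr_ge0 ?addr_ge0 // ltW.
apply: nr_small0 => eps eps0; have T1 : 0 < T + 1 by rewrite ltr_wpDl.
pose e := eps / (T + 1); have e0 : 0 < e by rewrite divr_gt0.
have [N1 _ hN1] := quadrature hC (cauchy_family_ucont cK HKe cf) e0.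
have [N2 _ hN2] := quadrature hC (cauchy_family_ucont cK HKe c1) e0.
have [N3 _ hN3] := quadrature1 hB cfR e0.
have [N4 _ hN4] := quadrature1 hB cR e0.
pose n := (N1 + N2 + N3 + N4)%N.
have {}hN1 := hN1 n ltac:(rewrite /n; lia); have {}hN2 := hN2 n ltac:(rewrite /n; lia).
have {}hN3 := hN3 n ltac:(rewrite /n; lia); have {}hN4 := hN4 n ltac:(rewrite /n; lia).
rewrite !edges_intE; clearbody n.
set I1 := edges_int _ _ in hN3 *; set I2 := edges_int _ (resolvent A) in hN4 *.
set Q1 := nodes_sum _ _ _ in hN3; set Q2 := nodes_sum _ _ _ in hN4.
have nU p : p \in nodes n (cycle_edges H) -> U p.2 by move=> /nodes_trace/HUe[].
have [hS DS] := Dsum _ nU.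
have key : Q1 *b D (fun=> 1) - Q2 *b D f = D (fun z => \sum_(p <- nodes n (cycle_edges H)) p.1 * g p.2 z).
  rewrite DS /Q1 /Q2 /nodes_sum !bmul_suml -sumrB; apply: eq_big_seq => p /nodes_trace/HUe[h1 h2].
  rewrite (Dg _ h1 h2) bmulBr scalerBr !bmulZl bmulZr; congr (_ - _).
(* At [z] in [K] the sum of quotients is the Riemann sum for [f] minus [f z] times the one for 1.
   The two integrals cancel, and only the quadrature errors remain. *)
have bnd : nr (D (fun z => \sum_(p <- nodes n (cycle_edges H)) p.1 * g p.2 z)) <= c * ((1 + Mf) * e).
  apply: Dbound => //; last by rewrite mulr_ge0 ?addr_ge0 // ltW.
  move=> z Kz; have h1 := hN1 _ Kz; have h2 := hN2 _ Kz.
  have -> : \sum_(p <- nodes n (cycle_edges H)) p.1 * g p.2 z =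
    (nodes_sum n (cycle_edges H) (fun l => (l - z)^-1 *: f l) - two_pi_i R *: f z)
    - f z * (nodes_sum n (cycle_edges H) (fun l => (l - z)^-1 *: (1 : C) : C) - (two_pi_i R *: (1 : C) : C)).
    have -> : f z * (nodes_sum n (cycle_edges H) (fun l => (l - z)^-1 *: (1 : C) : C) - (two_pi_i R *: (1 : C) : C)) =
        nodes_sum n (cycle_edges H) (fun l => f z * (l - z)^-1) - two_pi_i R *: f z.
      rewrite mulrBr; congr (_ - _); last by rewrite -![_ *: _]/(_ * _) mulr1 mulrC.
      rewrite /nodes_sum mulr_sumr; apply: eq_bigr => p _.
      by rewrite -![_ *: _]/(_ * _) mulr1 mulrCA.
    rewrite opprB addrA subrK /nodes_sum -sumrB; apply: eq_big_seq => p hp.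
    have [Ul _] := HUe _ (nodes_trace hp); have [_ gE] := hg _ Ul.
    have pz : p.2 - z != 0.
      by rewrite subr_eq0; apply/eqP => pz; apply: (HKe _ Kz); rewrite -pz; exact: nodes_trace hp.
    rewrite -![_ *: _]/(_ * _) -mulrBr; congr (_ * _).
    by apply: (mulfI pz); rewrite gE; field.
  rewrite -edges_intE (hHC _ hf _ Kz) in h1.
  rewrite -edges_intE (hHC _ D1 _ Kz) in h2.
  apply: (le_trans (nrB _ _)); rewrite nrM mulrDl mul1r; apply: lerD => //.
  by apply: ler_pM; rewrite ?nr_ge0 //; exact: hMf.
have -> : I1 *b D (fun=> 1) - I2 *b D f =
    (I1 - Q1) *b D (fun=> 1) - (I2 - Q2) *b D f + (Q1 *b D (fun=> 1) - Q2 *b D f).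
  by rewrite !bmulBl; zmod.
rewrite key; apply: (le_trans (nrD _ _)).
have b1 : nr ((I1 - Q1) *b D (fun=> 1)) <= e * nr (D (fun=> 1)).
  by apply: (le_trans (nr_bmul _ _)); apply: ler_wpM2r; [exact: nr_ge0|rewrite nrBC].
have b2 : nr ((I2 - Q2) *b D f) <= e * nr (D f).
  by apply: (le_trans (nr_bmul _ _)); apply: ler_wpM2r; [exact: nr_ge0|rewrite nrBC].
have := nrB ((I1 - Q1) *b D (fun=> 1)) ((I2 - Q2) *b D f).
have eT : e * T <= eps.
  by rewrite /e mulrAC ler_pdivrMr // ler_wpM2l ?lerDl // ltW.
move: bnd b1 b2 eT; rewrite /T; lra.
Qed.

End HolomorphicCalculus.

(** * Multiplicativity, powers and commutation *)

Section CalculusProperties.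
Variable R : realType.
Local Notation C := (R[i] : numFieldType).
Variable B : banachAlgType C.
Local Notation hB := (@banach_complete R B).

Lemma hol_subl (U : set C) (l : C) : hol U (fun z => l - z).
Proof.
move=> z _; have h := cderivD (cderiv_cst l z) (cderivZ (cderiv_cst (-1 : C) z) (cderiv_id z)).
by eexists; apply: (@cderiv_ext _ _ _ _ _ _ 1) h => // w _; rewrite scaleN1r.
Qed.

Lemma hol_scale (U : set C) (q : C) f : (forall z, U z -> U (q * z)) -> hol U f -> hol U (fun z => f (q * z)).
Proof.
move=> Uq hf z Uz; have [D hD] := hf _ (Uq _ Uz).
have h : cderiv (fun w => f (q * w + 0)) z (q *: D) by apply: cderiv_affine; rewrite addr0.
by eexists; apply: (@cderiv_ext _ _ _ _ _ _ 1) h => // w _; rewrite addr0.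
Qed.

Lemma compact_scale (q : C) (K : set C) : compact K -> compact [set q * z | z in K].
Proof.
move=> cK; apply: continuous_compact => //; apply: continuous_subspaceT => z.
apply: cts_of_cvg => e e0; have p0 : 0 < nr q + 1 by rewrite ltr_wpDl ?nr_ge0.
apply/nbhs_nrP; exists (e / (nr q + 1)); first by rewrite divr_gt0.
move=> y; rewrite ltr_pdivlMr // -mulrBr nrM; have := nr_ge0 (y - z); have := nr_ge0 q; nra.
Qed.

Lemma compact_trace (G : seq (seq C)) : compact (cycle_trace G).
Proof. by rewrite cycle_traceE; exact: compact_edges_trace. Qed.

(** A point of the spectrum off [U] would have both winding numbers 1 and 0. *)
Lemma surrounds_spectrum (U : set C) (A : B) G : surrounds G U A -> spectrum A `<=` U.
Proof.
move=> [_ G1 G0] w sw; apply: contrapT => nUw; move: (G1 _ sw); rewrite (G0 _ nUw) => /esym/eqP.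
by rewrite (negbTE (two_pi_i_neq0 R)).
Qed.

(** The rigidity principle for the map that sends [f] to the calculus of [f * g]; its value at 1 is
    the calculus of [g]. *)
Lemma calcM (U : set C) (A : B) G f g : open U -> surrounds G U A -> hol U f -> hol U g ->
  calc A G (fun z => f z * g z) = calc A G f *b calc A G g.
Proof.
move=> oU hG hf hg; have [GU _ _] := hG.
have GU' : cycle_trace G `<=` U by move=> z /GU[].
have [c c0 hc] := calc_bound hG.
have [M M0 hM] : exists2 M : R, 0 < M & forall z, cycle_trace G z -> nr (g z) <= M.
  by apply: (ccont_bounded (@compact_trace G)) => z /GU'/hg[D]; exact: cderiv_ccont.
have := @functional_principle R B U (cycle_trace G) A (fun f => calc A G (fun z => f z * g z)) (c * M) oU
  (surrounds_spectrum hG) (@compact_trace G) GU'.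
move=> /(_ _ _ _ _ _ G f hG hf) ->.
- by congr (_ *b calc A G _); apply/funext => z; rewrite mul1r.
- by rewrite mulr_ge0 // ltW.
- move=> f1 f2 h1 h2; rewrite -(calcD hG (holM h1 hg) (holM h2 hg)).
  by congr (calc A G _); apply/funext => z; rewrite mulrDl.
- move=> a f1 h1; rewrite -(calcZ _ hG (holM h1 hg)).
  by congr (calc A G _); apply/funext => z; rewrite mulrA.
- move=> f1 m h1 hm m0; rewrite -mulrA; apply: hc; first exact: holM.
  move=> z hz; rewrite nrM mulrC; apply: ler_pM; rewrite ?nr_ge0 //; [exact: hM|exact: hm].
- move=> l h hh; rewrite -(calc_module l oU hG (holM hh hg)).
  by congr (calc A G _); apply/funext => z; rewrite mulrA.
Qed.

(** The module law with [l = 0] and [g = 1], up to sign. *)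
Lemma calc_id (U : set C) (A : B) G : open U -> surrounds G U A -> calc A G id = A.
Proof.
move=> oU hG; have h := calc_module 0 oU hG (@hol_cst R U 1).
have hh : hol U (fun z => (0 - z) * 1).
  exact: holM (hol_subl (U := U) 0) (@hol_cst R U 1).
have -> : id = fun z : C => -1 * ((0 - z) * 1).
  by apply/funext => z; rewrite mulr1 sub0r mulrN mulN1r opprK.
by rewrite (calcZ _ hG hh) h (calc1 hG) bmul1r scale0r sub0r scaleN1r opprK.
Qed.

Lemma calcX (U : set C) (A : B) G n : open U -> surrounds G U A -> calc A G (fun z => z ^+ n) = A ^b n.
Proof.
move=> oU hG; elim: n => [|n IH].
  by rewrite -[RHS](calc1 hG); congr (calc A G _); apply/funext => z; rewrite expr0.
have hX k : hol U (fun z => z ^+ k).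
  by move=> z _; eexists; exact: (cderivX k (cderiv_id z)).
rewrite bexpS -IH -{2}(calc_id oU hG) -(calcM oU hG (@hol_id R U) (hX n)).
by congr (calc A G _); apply/funext => z; rewrite exprS.
Qed.

Lemma spectrum_scale (q : C) (A : B) w : q != 0 -> spectrum (q *: A) w -> spectrum A (w / q).
Proof.
move=> q0 + [b [h1 h2]]; apply.
have -> : w *: \1b - q *: A = q *: ((w / q) *: \1b - A).
  by rewrite scalerBr scalerA mulrCA divff // mulr1.
by exists (q^-1 *: b); rewrite !bmulZl !bmulZr !scalerA divff // mulVf // !scale1r.
Qed.

(** As functions of [f], both [S f(T)] and the calculus of [f (q * z)] at [T] obey the module law of
    [q *: T], the former by the relation [ST]. Rigidity expresses each through [f(qT)], and the
    spectrum of [q *: T] lies in [U] because [U] is stable under [q]. *)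
Lemma calc_commute (U : set C) (q : C) (T S : B) G f : q != 0 -> open U ->
  (forall z, U z -> U (q * z)) -> S *b T = q *: (T *b S) -> surrounds G U T -> hol U f ->
  S *b calc T G f = calc T G (fun z => f (q * z)) *b S.
Proof.
move=> q0 oU Uq ST hG hf; have [GU _ _] := hG.
have GU' : cycle_trace G `<=` U by move=> z /GU[].
have sT := surrounds_spectrum hG.
have sqT : spectrum (q *: T) `<=` U.
  by move=> w /(spectrum_scale q0)/sT/Uq; rewrite mulrCA divff // mulr1.
have [H [hH _ _]] := surrounds_exists oU sqT (@compact0 _) (@sub0set _ U).
have [c c0 hc] := calc_bound hG.
have h1 := @functional_principle R B U (cycle_trace G) (q *: T) (fun f => S *b calc T G f) (nr S * c) oU
  sqT (@compact_trace G) GU'.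
have {}h1 : S *b calc T G f = calc (q *: T) H f *b S.
  have -> := h1 _ _ _ _ _ H f hH hf; first by rewrite (calc1 hG) bmul1r.
  - by rewrite mulr_ge0 ?nr_ge0.
  - by move=> f1 f2 k1 k2; rewrite (calcD hG k1 k2) bmulDr.
  - by move=> a f1 k1; rewrite (calcZ _ hG k1) bmulZr.
  - move=> f1 M k1 hM M0; apply: (le_trans (nr_bmul _ _)); rewrite -mulrA.
    by apply: ler_wpM2l; [exact: nr_ge0|exact: hc].
  - move=> l g hg; rewrite (calc_module l oU hG hg) !bmulA; congr (_ *b _).
    by rewrite bmulBr bmulZr bmul1r ST bmulBl !bmulZl bmul1l.
rewrite h1; congr (_ *b S).
(* The values of [f (q * z)] on the trace of [G] are those of [f] on this set, which supplies the
   sup norm for the second use of the principle. *)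
pose K2 := [set q * z | z in cycle_trace G].
have K2U : K2 `<=` U by move=> w [z /GU' Uz <-]; exact: Uq.
have h2 := @functional_principle R B U K2 (q *: T) (fun f => calc T G (fun z => f (q * z))) c oU
  sqT (compact_scale (q := q) (@compact_trace G)) K2U.
have -> := h2 _ _ _ _ _ H f hH hf; first by rewrite (calc1 hG) bmul1r.
- by [].
- by move=> f1 f2 k1 k2; rewrite -(calcD hG) //; exact: hol_scale.
- by move=> a f1 k1; rewrite -(calcZ _ hG) //; exact: hol_scale.
- move=> f1 M k1 hM M0; apply: hc; first exact: hol_scale.
  by move=> z hz; apply: hM; exists z.
- move=> l g hg; have hgq := hol_scale Uq hg.
  have -> : (fun z => (l - q * z) * g (q * z)) = fun z => q * ((l / q - z) * g (q * z)).
    by apply/funext => z; rewrite mulrA mulrBr mulrCA divff // mulr1.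
  have hl : hol U (fun z => (l / q - z) * g (q * z)).
    exact: holM (hol_subl (U := U) _) hgq.
  rewrite (calcZ _ hG hl) (calc_module _ oU hG hgq) -bmulZl scalerBr scalerA.
  by rewrite mulrCA divff // mulr1.
Qed.

Lemma calc_commuteX (U : set C) (q : C) (T S : B) G f i : q != 0 -> open U ->
  (forall z, U z -> U (q * z)) -> S *b T = q *: (T *b S) -> surrounds G U T -> hol U f ->
  S ^b i *b calc T G f = calc T G (fun z => f (q ^+ i * z)) *b S ^b i.
Proof.
move=> q0 oU Uq ST hG; elim: i f => [|i IH] f hf.
  rewrite bmul1l bmul1r; congr (calc T G _); apply/funext => z; by rewrite expr0 mul1r.
have Uqi z : U z -> U (q ^+ i * z).
  by elim: i {IH} => [|i IH] Uz; rewrite ?expr0 ?mul1r // exprS -mulrA; exact/Uq/IH.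
rewrite bexpS -bmulA (IH _ hf) bmulA (calc_commute q0 oU Uq ST hG) //; last exact: hol_scale.
by rewrite -bmulA; congr (calc T G _ *b _); apply/funext => z; rewrite exprSr mulrA.
Qed.

End CalculusProperties.

(** * Absolutely convergent series *)

Section Series.
Variable R : realType.
Local Notation C := (R[i] : numFieldType).

Lemma bounded_sums_cauchy (u : nat -> R) (M : R) : (forall n, 0 <= u n) ->
  (forall N, \sum_(n < N) u n <= M) -> forall e : R, 0 < e -> exists N, forall m n, (N <= n)%N -> (n <= m)%N ->
    \sum_(k < m) u k - \sum_(k < n) u k <= e.
Proof.
move=> u0 uM e e0.
have nd : nondecreasing_seq (fun N => \sum_(n < N) u n).
  by apply/nondecreasing_seqP => n; rewrite big_ord_recr /= lerDl.
have cv : cvgn (fun N => \sum_(n < N) u n).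
  by apply: nondecreasing_is_cvgn => //; exists M => _ [n _ <-].
have := nondecreasing_cvgn_le nd cv; set l := limn _ => hl.
have /cvgrPdist_le/(_ e e0)[N _ hN] := cv; exists N => m n Nn nm.
by have := hN _ Nn; have := hl m; rewrite /= -/l ler_norml => h /andP[_]; lra.
Qed.

Lemma sums_split (V : zmodType) (b : nat -> V) n m : (n <= m)%N ->
  \sum_(k < m) b k - \sum_(k < n) b k = \sum_(n <= k < m) b k.
Proof.
move=> nm; rewrite -!(big_mkord xpredT b) (big_cat_nat (leq0n n) nm) //=.
by rewrite [X in X - _]addrC addrK.
Qed.

Variable V : normedModType C.
Hypothesis hV : nr_complete V.

Lemma dominated_tail (u : nat -> R) (b : nat -> V) n m : (forall n, nr (b n) <= u n) -> (n <= m)%N ->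
  nr (\sum_(k < m) b k - \sum_(k < n) b k) <= \sum_(k < m) u k - \sum_(k < n) u k.
Proof.
by move=> bu nm; rewrite !sums_split //; apply: (le_trans (nr_sum _ _ _)); exact: ler_sum.
Qed.

Lemma dominated_sums (u : nat -> R) (b : nat -> V) (M : R) : (forall n, nr (b n) <= u n) ->
  (forall N, \sum_(n < N) u n <= M) ->
  exists l, [/\ (fun N => \sum_(n < N) b n) @ \oo --> l, nr l <= M &
     forall e : R, 0 < e -> exists K, forall N, (K <= N)%N -> nr (l - \sum_(n < N) b n) <= e].
Proof.
move=> bu uM; have u0 n : 0 <= u n by apply: le_trans (bu n); exact: nr_ge0.
have hc : nr_cauchy (fun N => \sum_(n < N) b n).
  move=> e e0; have e2 : 0 < e / 2 by rewrite divr_gt0.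
  have [N hN] := bounded_sums_cauchy u0 uM e2; exists N => m n Nm Nn.
  have [nm|mn] := leqP n m.
    by apply: (le_lt_trans (dominated_tail bu nm)); have := hN _ _ Nn nm; lra.
  rewrite nrBC; apply: (le_lt_trans (dominated_tail bu (ltnW mn))).
  by have := hN _ _ Nm (ltnW mn); lra.
have cv := hV hc; exists (lim ((fun N => \sum_(n < N) b n) @ \oo)); split=> //.
  apply/ler_addgt0Pr => e e0; have /cvg_nrP/(_ _ e0)[N hN] := cv.
  have := hN _ (leqnn N); rewrite nrBC => h.
  have := nr_lower (lim ((fun N => \sum_(n < N) b n) @ \oo)) (\sum_(n < N) b n).
  have : nr (\sum_(n < N) b n) <= M.
    by apply: le_trans (uM N); apply: (le_trans (nr_sum _ _ _)); exact: ler_sum.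
  lra.
move=> e e0; have /cvg_nrP/(_ _ e0)[N hN] := cv; exists N => n Nn.
by rewrite nrBC ltW // hN.
Qed.

End Series.

(** * The Cauchy product of dominated series *)

Section CauchyProduct.
Variable R : realType.
Local Notation C := (R[i] : numFieldType).
Variable B : banachAlgType C.

Lemma convolution_sums (a b : nat -> B) N :
  \sum_(n < N) \sum_(i < n.+1) a i *b b (n - i)%N = \sum_(i < N) a i *b \sum_(j < N - i) b j.
Proof.
elim: N => [|N IH]; first by rewrite !big_ord0.
rewrite big_ord_recr /= IH [X in _ + X]big_ord_recr [RHS]big_ord_recr /= addrA; congr (_ + _).
  rewrite -big_split /=; apply: eq_bigr => i _.
  by rewrite -bmulDr subSn ?(ltnW (ltn_ord i)) // big_ord_recr.
by rewrite subSnn big_ord_recr big_ord0 /= add0r subnn.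
Qed.

(** The product of the limits is compared with the sum of [a i] times a partial sum of [b]. For
    [i < N - K] the missing tail of [b] is small; for the last [K] indices it is only bounded, but
    there the majorant [u] has a small sum. *)
Lemma cauchy_product (a b : nat -> B) (u v : nat -> R) (Mu Mv : R) (la lb : B) :
  (forall n, nr (a n) <= u n) -> (forall N, \sum_(n < N) u n <= Mu) ->
  (forall n, nr (b n) <= v n) -> (forall N, \sum_(n < N) v n <= Mv) ->
  (fun N => \sum_(n < N) a n) @ \oo --> la -> (fun N => \sum_(n < N) b n) @ \oo --> lb ->
  (fun N => \sum_(n < N) \sum_(i < n.+1) a i *b b (n - i)%N) @ \oo --> la *b lb.
Proof.
move=> au uM bv vM ca cb.
have u0 n : 0 <= u n by apply: le_trans (au n); exact: nr_ge0.
have v0 n : 0 <= v n by apply: le_trans (bv n); exact: nr_ge0.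
have Mu0 : 0 <= Mu by have := uM 0%N; rewrite big_ord0.
have Mv0 : 0 <= Mv by have := vM 0%N; rewrite big_ord0.
have [lb' [cb' lbM tail]] := dominated_sums (@banach_complete R B) bv vM.
have lbE : lb' = lb by exact: (cvg_unique (@norm_hausdorff _ _) cb' cb).
rewrite {}lbE {lb' cb'} in lbM tail.
apply/cvg_nrP => e e0.
pose T := nr lb + Mu + 2 * Mv + 1.
have T0 : 0 < T by rewrite /T ltr_wpDl // !addr_ge0 ?nr_ge0 // mulr_ge0.
pose d := e / (2 * T); have d0 : 0 < d by rewrite divr_gt0 // mulr_gt0.
have /cvg_nrP/(_ _ d0)[N1 hN1] := ca.
have [K hK] := tail _ d0.
have [N2 hN2] := bounded_sums_cauchy u0 uM d0.
exists (N1 + (N2 + K))%N => N hN.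
rewrite convolution_sums.
have hN1' : (N1 <= N)%N by lia.
have E : \sum_(i < N) a i *b \sum_(j < N - i) b j - la *b lb =
   (\sum_(i < N) a i - la) *b lb - \sum_(i < N) a i *b (lb - \sum_(j < N - i) b j).
  have -> : \sum_(i < N) a i *b (lb - \sum_(j < N - i) b j) =
      \sum_(i < N) a i *b lb - \sum_(i < N) a i *b \sum_(j < N - i) b j.
    by rewrite -sumrB; apply: eq_bigr => i _; rewrite bmulBr.
  by rewrite bmulBl bmul_suml; zmod.
rewrite E; apply: (le_lt_trans (nrB _ _)).
have h1 : nr ((\sum_(i < N) a i - la) *b lb) <= d * nr lb.
  apply: (le_trans (nr_bmul _ _)); apply: ler_wpM2r; first exact: nr_ge0.
  exact: ltW (hN1 _ hN1').
have h2 : nr (\sum_(i < N) a i *b (lb - \sum_(j < N - i) b j)) <= Mu * d + d * (2 * Mv).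
  apply: (le_trans (nr_sum _ _ _)).
  have NK : (N - K <= N)%N by exact: leq_subr.
  rewrite -(big_mkord xpredT (fun i => nr (a i *b (lb - \sum_(j < N - i) b j)))) (big_cat_nat (leq0n _) NK) //=.
  apply: lerD.
    apply: (@le_trans _ _ (\sum_(0 <= i < N - K) u i * d)).
      rewrite !big_mkord; apply: ler_sum => i _; apply: (le_trans (nr_bmul _ _)).
      apply: ler_pM; rewrite ?nr_ge0 //; apply: hK; have := ltn_ord i; lia.
    by rewrite -mulr_suml ler_wpM2r ?(ltW d0) // big_mkord.
  apply: (@le_trans _ _ (\sum_(N - K <= i < N) u i * (2 * Mv))).
    apply: ler_sum => i _; apply: (le_trans (nr_bmul _ _)); apply: ler_pM; rewrite ?nr_ge0 //.
    apply: (le_trans (nrB _ _)).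
    have : nr (\sum_(j < N - i) b j) <= Mv.
      by apply: le_trans (vM (N - i)%N); apply: (le_trans (nr_sum _ _ _)); exact: ler_sum.
    lra.
  rewrite -mulr_suml; apply: ler_wpM2r; first by rewrite mulr_ge0.
  rewrite -(sums_split u NK); apply: hN2; [lia|exact: leq_subr].
have : d * (nr lb + Mu + 2 * Mv) < e.
  have -> : e = d * (2 * T) by rewrite /d divfK // gt_eqF // mulr_gt0.
  by rewrite ltr_pM2l // /T; have := nr_ge0 lb; lra.
lra.
Qed.

End CauchyProduct.

(** * Seminorms of series, and growth of powers *)

Section Seminorms.
Variable R : realType.
Local Notation C := (R[i] : numFieldType).
(** The element 0 adjoined to the set of values settles the case of an empty [K]. *)
Lemma supnorm_ge0 (K : set C) g : (0 <= supnorm K g)%E.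
Proof. by apply: ereal_sup_ubound; right. Qed.

Lemma supnorm_ge (K : set C) g z : K z -> ((nr (g z))%:E <= supnorm K g)%E.
Proof. by move=> Kz; apply: ereal_sup_ubound; left; exists z. Qed.

Lemma supnorm_le (K : set C) g (M : R) : 0 <= M -> (forall z, K z -> nr (g z) <= M) ->
  (supnorm K g <= M%:E)%E.
Proof.
move=> M0 hM; apply: ge_ereal_sup => _ [[z Kz <-]|->]; last by rewrite lee_fin.
by rewrite cabsE lee_fin; exact: hM.
Qed.

(** Trades the extended-real series of suprema for a real majorant [w] with bounded partial sums,
    which can be added, scaled and truncated. *)
Lemma qseminormP (K : set C) (rho : R) h (M : R) : 0 < rho ->
  (qseminorm K rho h <= M%:E)%E <->
  exists w : nat -> R, [/\ forall n, 0 <= w n, forall n z, K z -> nr (h n z) <= w n &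
    forall N, \sum_(n < N) w n * rho ^+ n <= M].
Proof.
move=> rho0; have rn n : 0 < rho ^+ n by exact: exprn_gt0.
have t0 n : (0 <= supnorm K (h n) * (rho ^+ n)%:E)%E.
  by rewrite mule_ge0 ?supnorm_ge0 // lee_fin ltW.
split=> [hM|[w [w0 hw hM]]]; last first.
  apply: lime_le; first by apply: is_cvg_nneseries => n _ _.
  near=> N; rewrite big_mkord.
  apply: (@le_trans _ _ (\sum_(n < N) (w n * rho ^+ n)%:E)%E); last by rewrite sumEFin lee_fin.
  apply: lee_sum => n _; rewrite EFinM; apply: lee_wpmul2r; first by rewrite lee_fin ltW.
  by apply: supnorm_le => // z; exact: hw.
have part N : (\sum_(n < N) supnorm K (h n) * (rho ^+ n)%:E <= M%:E)%E.
  by apply: le_trans hM; rewrite -(big_mkord xpredT (fun n => supnorm K (h n) * (rho ^+ n)%:E)%E); exact: nneseries_lim_ge.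
(* An infinite supremum would make a partial sum infinite, since [rho ^+ n] is positive. *)
have fin n : supnorm K (h n) = (fine (supnorm K (h n)))%:E.
  have := part n.+1; rewrite big_ord_recr /=; have := supnorm_ge0 K (h n).
  have : (0 <= \sum_(k < n) supnorm K (h k) * (rho ^+ k)%:E)%E by exact: sume_ge0.
  case: (supnorm K (h n)) => [r| |] // s0 _.
  rewrite gt0_mulye ?lte_fin // addey ?leye_eq //.
  by move: s0; case: (\sum_(_ < _) _)%E.
exists (fun n => fine (supnorm K (h n))); split=> [n|n z Kz|N].
- by rewrite fine_ge0 // supnorm_ge0.
- by rewrite -lee_fin -fin; exact: supnorm_ge.
- rewrite -lee_fin -sumEFin; apply: le_trans (part N).
  by apply: lee_sum => n _; rewrite EFinM -fin.
Unshelve. all: by end_near.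
Qed.

Lemma qseminorm_ge0 (K : set C) (rho : R) h : 0 < rho -> (0 <= qseminorm K rho h)%E.
Proof.
by move=> r0; apply: nneseries_ge0 => n _ _; rewrite mule_ge0 ?supnorm_ge0 // lee_fin exprn_ge0 // ltW.
Qed.

Lemma qseminorm_fin (K : set C) (rho : R) h : 0 < rho -> (qseminorm K rho h < +oo)%E ->
  exists2 M : R, 0 <= M & (qseminorm K rho h <= M%:E)%E.
Proof.
move=> r0; have := qseminorm_ge0 K h r0; case: (qseminorm K rho h) => [M| |] // M0 _.
by exists M; rewrite -?lee_fin.
Qed.

Lemma qseminormD (K : set C) (rho : R) f g (M N : R) : 0 < rho ->
  (qseminorm K rho f <= M%:E)%E -> (qseminorm K rho g <= N%:E)%E ->
  (qseminorm K rho (Oq_add f g) <= (M + N)%:E)%E.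
Proof.
move=> r0 /(qseminormP _ _ _ r0)[w [w0 hw wM]] /(qseminormP _ _ _ r0)[v [v0 hv vN]].
apply/(qseminormP _ _ _ r0); exists (fun n => w n + v n); split=> [n|n z Kz|n].
- exact: addr_ge0.
- by apply: (le_trans (nrD _ _)); apply: lerD; [exact: hw|exact: hv].
- under eq_bigr do rewrite mulrDl.
  by rewrite big_split; exact: lerD.
Qed.

Lemma qseminormZ (K : set C) (rho : R) c f (M : R) : 0 < rho ->
  (qseminorm K rho f <= M%:E)%E -> (qseminorm K rho (Oq_scale c f) <= (nr c * M)%:E)%E.
Proof.
move=> r0 /(qseminormP _ _ _ r0)[w [w0 hw wM]]; apply/(qseminormP _ _ _ r0).
exists (fun n => nr c * w n); split=> [n|n z Kz|n].
- by rewrite mulr_ge0 ?nr_ge0.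
- by rewrite nrM ler_wpM2l ?nr_ge0 //; exact: hw.
- under eq_bigr do rewrite -mulrA.
  by rewrite -mulr_sumr ler_wpM2l ?nr_ge0.
Qed.

Lemma open_disc (ry : \bar R) : open (disc ry).
Proof.
apply/open_nrP => x; rewrite /disc /= cabsE.
case: ry => [r| |] //=; last by move=> _; exists 1 => // y _; rewrite ltry.
rewrite lte_fin => xr; exists (r - nr x); first by rewrite subr_gt0.
by move=> y hy; rewrite cabsE lte_fin; have := nr_lower y x; lra.
Qed.

Lemma compact_in_disc (ry : \bar R) (K : set C) : (0 < ry)%E -> compact K -> K `<=` disc ry ->
  exists rho : R, [/\ 0 < rho, (rho%:E < ry)%E & forall z, K z -> nr z <= rho].
Proof.
case: ry => [r| |] // r0 cK Kr; last first.
  have [M hM] := compact_nr_bounded cK; exists (`|M| + 1); split; [by rewrite ltr_wpDl|exact: ltry|].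
  by move=> z /hM; have := ler_norm M; lra.
have /= [x Kx|d d0 hd] := compact_uniform (P := fun d z => nr z <= r - d) cK.
  have := Kr _ Kx; rewrite /disc /= cabsE lte_fin => xr.
  exists ((r - nr x) / 2); first by rewrite divr_gt0 // subr_gt0.
  apply/nbhs_nrP; exists ((r - nr x) / 2); first by rewrite divr_gt0 // subr_gt0.
  by move=> y hy d /andP[_ hd]; have := nr_lower y x; lra.
(* [r - d] need not be positive; the maximum with [r / 2] is, and it stays below [r]. *)
rewrite lte_fin in r0; exists (Num.max (r - d) (r / 2)); split.
- by rewrite lt_max divr_gt0 ?orbT.
- by rewrite lte_fin gt_max; apply/andP; split; lra.
- by move=> z Kz; rewrite le_max hd.
Qed.

Lemma power_bound (B : banachAlgType C) (S : B) (ry : \bar R) : (0 < ry)%E -> spectrum S `<=` disc ry ->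
  exists rho c : R, [/\ 0 < rho, (rho%:E < ry)%E, 0 <= c & forall n, nr (S ^b n) <= c * rho ^+ n].
Proof.
move=> ry0 sS; have oD := @open_disc ry.
have [G [hG _ _]] := surrounds_exists oD sS (@compact0 _) (@sub0set _ _).
have [GU _ _] := hG.
have [rho [rho0 rhory hrho]] : exists rho : R, [/\ 0 < rho, (rho%:E < ry)%E & forall z, cycle_trace G z -> nr z <= rho].
  by apply: compact_in_disc => //; [exact: compact_trace|move=> z /GU[]].
have [c c0 hc] := calc_bound hG.
exists rho, c; split=> // n; rewrite -(calcX n oD hG); apply: hc.
  by move=> z _; eexists; exact: (cderivX n (cderiv_id z)).
by move=> z hz; rewrite nrX lerXn2r ?nnegrE ?nr_ge0 ?(ltW rho0) // hrho.
Qed.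

Lemma surrounds_calc_rel (B : banachAlgType C) (U : set C) (A : B) f v :
  holo_calc_rel U A f v <-> exists G, surrounds G U A /\ v = calc A G f.
Proof.
have p0 := two_pi_i_neq0 R.
split=> [[G [GU G1 G0 ->]]|[G [[GU G1 G0] ->]]]; exists G; split=> //.
- split=> // w hw.
  + by apply: (mulfI (invr_neq0 p0)); rewrite mulVf //; exact: G1.
  + by apply: (mulfI (invr_neq0 p0)); rewrite mulr0; exact: G0.
- by move=> w hw; rewrite /winding G1 // mulVf.
- by move=> w hw; rewrite /winding G0 // mulr0.
Qed.

(** The chosen value comes from some surrounding cycle, and all of these agree. *)
Lemma holo_calcE (B : banachAlgType C) (U : set C) (A : B) G f : open U -> surrounds G U A -> hol U f ->
  holo_calc U A f = calc A G f.
Proof.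
move=> oU hG hf.
have : holo_calc_rel U A f (calc A G f) by apply/surrounds_calc_rel; exists G.
rewrite /holo_calc => /(xgetI (0 : B))/surrounds_calc_rel[H [hH ->]].
exact: (calc_indep oU hH hG hf).
Qed.

End Seminorms.

(** * The algebra O_q(U) and its extensions *)

Section SeriesAlgebra.
Variable R : realType.
Local Notation C := (R[i] : numFieldType).
Variables (q : C) (U : set C) (ry : \bar R).
Hypothesis oU : open U.
Local Notation fser := (nat -> C -> C).

Definition coef0 (g : C -> C) : fser := fun n z => if n == 0%N then g z else 0.
Definition ypow (k : nat) : fser := fun n _ => if n == k then 1 else 0.

Lemma Oq_mul_coef0 g (h : fser) : Oq_mul q (coef0 g) h = fun n z => g z * h n z.
Proof.
apply/funext => n; apply/funext => z; rewrite /Oq_mul big_ord_recl /= subn0 expr0 mul1r.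
by rewrite [X in _ + X]big1 ?addr0 // => i _; rewrite /coef0 mul0r.
Qed.

(** The rule y f(x) = f(qx) y. From the right, [y] only shifts the degree. *)
Lemma Oq_mul_y (h : fser) :
  Oq_mul q (@Oq_y R) h = fun n z => if n is m.+1 then h m (q * z) else 0.
Proof.
apply/funext => -[|n]; apply/funext => z; rewrite /Oq_mul big_ord_recl /= /Oq_y mul0r add0r.
  by rewrite big_ord0.
rewrite big_ord_recl /= mul1r subSS subn0 expr1 [X in _ + X]big1 ?addr0 // => i _.
by rewrite mul0r.
Qed.

Lemma Oq_mul_yr (h : fser) :
  Oq_mul q h (@Oq_y R) = fun n z => if n is m.+1 then h m z else 0.
Proof.
apply/funext => -[|n]; apply/funext => z; rewrite /Oq_mul big_ord_recr /= /Oq_y subnn mulr0 addr0.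
  by rewrite big_ord0.
rewrite big_ord_recr /= subSnn mulr1 [X in X + _]big1 ?add0r // => i _.
have -> : (n.+1 - i == 1)%N = false by have := ltn_ord i; lia.
by rewrite mulr0.
Qed.

Lemma hol_ext f g : (forall z, U z -> f z = g z) -> hol U f -> hol U g.
Proof.
move=> fg hf z Uz; have [D hD] := hf z Uz; exists D.
have [r r0 hr] := (open_nrP U).1 oU _ Uz.
by apply: (cderiv_ext r0) hD => w /hr; exact: fg.
Qed.

Lemma Oq_hol f : Oq U ry f -> forall n, hol U (f n).
Proof. by move=> [hf _] n; apply/holP; exact: hf. Qed.

Lemma OqP f : (forall n, hol U (f n)) ->
  (forall K rho, seminorm_index U ry K rho -> exists M : R, (qseminorm K rho f <= M%:E)%E) -> Oq U ry f.
Proof.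
move=> hf hM; split=> [n|K rho /hM[M]]; first by apply/holP; exact: hf.
by move=> h; apply: (le_lt_trans h); exact: ltry.
Qed.

Lemma Oq_bound f K rho : Oq U ry f -> seminorm_index U ry K rho ->
  exists2 M : R, 0 <= M & (qseminorm K rho f <= M%:E)%E.
Proof. by move=> [_ hf] hK; have [_ _ r0 _] := hK; apply: qseminorm_fin => //; exact: hf. Qed.

Lemma Oq_add_in f g : Oq U ry f -> Oq U ry g -> Oq U ry (Oq_add f g).
Proof.
move=> hf hg; apply: OqP => [n|K rho hK].
  by apply: holD; exact: Oq_hol.
have [M _ fM] := Oq_bound hf hK; have [N _ gN] := Oq_bound hg hK; have [_ _ r0 _] := hK.
by exists (M + N); exact: qseminormD.
Qed.

Lemma Oq_scale_in c f : Oq U ry f -> Oq U ry (Oq_scale c f).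
Proof.
move=> hf; apply: OqP => [n|K rho hK].
  by apply: holZ; exact: Oq_hol.
have [M _ fM] := Oq_bound hf hK; have [_ _ r0 _] := hK.
by exists (nr c * M); exact: qseminormZ.
Qed.

(** Coefficients are functions on all of [C], but membership sees only their values on [U]. *)
Lemma Oq_ext f g : (forall n z, U z -> f n z = g n z) -> Oq U ry f -> Oq U ry g.
Proof.
move=> fg hf; apply: OqP => [n|K rho hK].
  by apply: hol_ext (Oq_hol hf n) => z; exact: fg.
have [M _ fM] := Oq_bound hf hK; have [_ KU r0 _] := hK; exists M.
have [w [w0 hw wM]] := (qseminormP K f M r0).1 fM.
by apply/(qseminormP _ _ _ r0); exists w; split=> // n z Kz; rewrite -fg; [exact: hw|exact: KU].
Qed.

Lemma single_bound K (rho : R) (g : C -> C) k (M : R) : 0 < rho -> 0 <= M -> (forall z, K z -> nr (g z) <= M) ->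
  (qseminorm K rho (fun n z => if n == k then g z else 0%R) <= (M * rho ^+ k)%:E)%E.
Proof.
move=> r0 M0 hM; apply/(qseminormP _ _ _ r0); exists (fun n => if n == k then M else 0).
split=> [n|n z Kz|N]; first by case: ifP.
  by case: ifP => _; [exact: hM|rewrite nr0].
have p0 : 0 <= M * rho ^+ k by rewrite mulr_ge0 // exprn_ge0 // ltW.
have [Nk|kN] := leqP N k.
  rewrite big1 // => i _; rewrite ifF ?mul0r //; have := ltn_ord i; lia.
rewrite (bigD1 (Ordinal kN)) //= eqxx big1 ?addr0 // => i ik.
by rewrite ifF ?mul0r //; apply/negbTE; apply: contra ik => /eqP ik; apply/eqP/val_inj.
Qed.

Lemma Oq_single g k : hol U g -> Oq U ry (fun n z => if n == k then g z else 0%R).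
Proof.
move=> hg; apply: OqP => [n|K rho [cK KU r0 _]].
  by case: (n == k) => //; exact: hol_cst.
have [M M0 hM] : exists2 M : R, 0 < M & forall z, K z -> nr (g z) <= M.
  by apply: (ccont_bounded cK) => z /KU/hg[D]; exact: cderiv_ccont.
by exists (M * rho ^+ k); apply: single_bound => //; exact: ltW.
Qed.

Lemma Oq_coef0 g : hol U g -> Oq U ry (coef0 g).
Proof. exact: Oq_single. Qed.

Lemma Oq_ypow k : Oq U ry (ypow k).
Proof. by apply: (Oq_single (g := fun=> 1)); exact: hol_cst. Qed.

Lemma Oq_tail f N : Oq U ry f -> Oq U ry (fun n z => if (n < N)%N then 0 else f n z).
Proof.
move=> hf; apply: OqP => [n|K rho hK].
  by case: (n < N)%N; [exact: hol_cst|exact: Oq_hol].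
have [M _ fM] := Oq_bound hf hK; have [_ _ r0 _] := hK; exists M.
have [w [w0 hw wM]] := (qseminormP K f M r0).1 fM.
apply/(qseminormP _ _ _ r0); exists w; split=> // n z Kz.
by case: ifP => _; [rewrite nr0|exact: hw].
Qed.

Lemma tail_small f K rho (e : R) : Oq U ry f -> seminorm_index U ry K rho -> 0 < e ->
  exists N0, forall N, (N0 <= N)%N ->
    (qseminorm K rho (fun n z => if (n < N)%N then 0%R else f n z) <= e%:E)%E.
Proof.
move=> hf hK e0; have [M _ fM] := Oq_bound hf hK; have [_ _ r0 _] := hK.
have [w [w0 hw wM]] := (qseminormP K f M r0).1 fM.
have u0 n : 0 <= w n * rho ^+ n by rewrite mulr_ge0 // exprn_ge0 // ltW.
have [N0 hN0] := bounded_sums_cauchy u0 wM e0; exists N0 => N hN.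
apply/(qseminormP _ _ _ r0); exists (fun n => if (n < N)%N then 0 else w n); split=> [n|n z Kz|m].
- by case: ifP.
- by case: ifP => _; [rewrite nr0|exact: hw].
have [mN|Nm] := leqP m N.
  rewrite big1 ?(ltW e0) // => i _; by rewrite (leq_trans (ltn_ord i)) // mul0r.
apply: le_trans (hN0 _ _ hN (ltnW Nm)); rewrite (sums_split (fun n => w n * rho ^+ n) (ltnW Nm)).
rewrite -(big_mkord xpredT (fun n => (if (n < N)%N then 0 else w n) * rho ^+ n)) (big_cat_nat (leq0n N) (ltnW Nm)) /=.
rewrite big_nat big1 ?add0r => [|i /andP[_ ->]]; last by rewrite mul0r.
by rewrite big_nat [leRHS]big_nat ler_sum // => i /andP[Ni _]; rewrite ltnNge Ni.
Qed.

(** Every admissible radius satisfies [rho < ry <= nr l], so each seminorm is bounded by a geometric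
    series with sum [(nr l - rho)^-1]. *)
Lemma Oq_geometric (l : C) : ~ disc ry l -> Oq U ry (fun n _ => l ^- n.+1).
Proof.
move=> nl; apply: OqP => [n|K rho [_ _ r0 rr]]; first exact: hol_cst.
have rl : rho < nr l.
  rewrite -lte_fin; apply: (lt_le_trans rr); rewrite leNgt; apply/negP => h.
  by apply: nl; rewrite /disc /= cabsE.
have l0 : 0 < nr l by lra.
exists (nr l - rho)^-1; apply/(qseminormP _ _ _ r0).
exists (fun n => (nr l) ^- n.+1); split=> [n|n z _|N].
- by rewrite invr_ge0 exprn_ge0 // ltW.
- by rewrite nrV nrX.
have -> : (nr l - rho)^-1 = (nr l)^-1 * (1 - rho / nr l)^-1.
  by rewrite -invfM mulrBr mulr1 mulrCA divff ?mulr1 // gt_eqF.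
under eq_bigr do rewrite exprS invfM -mulrA -exprVn -exprMn [_^-1 * rho]mulrC.
rewrite -mulr_sumr ler_wpM2l ?invr_ge0 ?(ltW l0) //.
have t0 : 0 < 1 - rho / nr l by rewrite subr_gt0 ltr_pdivrMr // mul1r.
rewrite -[leRHS]mul1r ler_pdivlMr //; set x := rho / nr l.
have x0 : 0 <= x ^+ N by rewrite exprn_ge0 // divr_ge0 // ltW.
have := subrX1 x N; set s := \sum_(i < N) _ => E.
have h : s * (1 - x) = 1 - x ^+ N by lra.
by lra.
Qed.

End SeriesAlgebra.

(** * Properties shared by all extensions *)

Section Extension.
Variable R : realType.
Local Notation C := (R[i] : numFieldType).
Variable B : banachAlgType C.
Variables (q : C) (U : set C) (ry : \bar R) (T S : B).
Hypothesis oU : open U.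
Variable Phi : (nat -> C -> C) -> B.
Hypothesis hPhi : Oq_extension q U ry T S Phi.

Lemma ext_add f g : Oq U ry f -> Oq U ry g -> Phi (Oq_add f g) = Phi f + Phi g.
Proof. by case: hPhi => _ h _ _ _; exact: h. Qed.

Lemma ext_scale c f : Oq U ry f -> Phi (Oq_scale c f) = c *: Phi f.
Proof. by case: hPhi => _ _ h _ _; exact: h. Qed.

Lemma ext_mul f g : Oq U ry f -> Oq U ry g -> Phi (Oq_mul q f g) = Phi f *b Phi g.
Proof. by case: hPhi => _ _ _ h _; exact: h. Qed.

Lemma ext_one : Phi (@Oq_one R) = \1b.
Proof. by case: hPhi => _ _ _ _ []. Qed.

Lemma ext_x : Phi (@Oq_x R) = T.
Proof. by case: hPhi => _ _ _ _ []. Qed.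

Lemma ext_y : Phi (@Oq_y R) = S.
Proof. by case: hPhi => _ _ _ _ []. Qed.

Lemma Oq_one_in : Oq U ry (@Oq_one R).
Proof. exact: (@Oq_coef0 R U ry (fun=> 1) (@hol_cst R U 1)). Qed.

Lemma Oq_y_in : Oq U ry (@Oq_y R).
Proof. exact: (@Oq_ypow R U ry 1). Qed.

Lemma Oq_sub_in f g : Oq U ry f -> Oq U ry g -> Oq U ry (fun n z => f n z - g n z).
Proof.
move=> hf hg; have -> : (fun n z => f n z - g n z) = Oq_add f (Oq_scale (-1) g).
  by apply/funext => n; apply/funext => z; rewrite /Oq_add /Oq_scale mulN1r.
by apply: Oq_add_in => //; exact: Oq_scale_in.
Qed.

Lemma ext_sub f g : Oq U ry f -> Oq U ry g -> Phi (fun n z => f n z - g n z) = Phi f - Phi g.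
Proof.
move=> hf hg; have -> : (fun n z => f n z - g n z) = Oq_add f (Oq_scale (-1) g).
  by apply/funext => n; apply/funext => z; rewrite /Oq_add /Oq_scale mulN1r.
by rewrite ext_add ?ext_scale ?scaleN1r //; exact: Oq_scale_in.
Qed.

Lemma ext_zero : Phi (fun _ _ => 0) = 0.
Proof.
have h := Oq_one_in; have := ext_sub h h; rewrite subrr => <-.
by congr Phi; apply/funext => n; apply/funext => z; rewrite subrr.
Qed.

Lemma Oq_zero_in : Oq U ry (fun _ _ => 0).
Proof.
have := Oq_sub_in Oq_one_in Oq_one_in; congr (Oq _ _ _).
by apply/funext => n; apply/funext => z; rewrite subrr.
Qed.

(** Continuity at 0, turned by homogeneity into a linear bound by finitely many seminorms. *)
Lemma ext_bound : exists m (Ks : 'I_m -> set C) (rhos : 'I_m -> R) (c : R),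
  [/\ forall i, seminorm_index U ry (Ks i) (rhos i), 0 <= c &
      forall g (M : R), Oq U ry g -> 0 <= M -> (forall i, (qseminorm (Ks i) (rhos i) g <= M%:E)%E) ->
        nr (Phi g) <= c * M].
Proof.
have [hc _ _ _ _] := hPhi; have [m [Ks [rhos [d [hK d0 hd]]]]] := hc _ Oq_zero_in 1 ltr01.
exists m, Ks, rhos, (2 / d); split=> //; first by rewrite divr_ge0 // ltW.
have pos g (M : R) : Oq U ry g -> 0 < M -> (forall i, (qseminorm (Ks i) (rhos i) g <= M%:E)%E) -> nr (Phi g) <= 2 / d * M.
  (* The series is scaled to size [d / 2], because continuity asks for a strict inequality with
     [d]. *)
  move=> hg M0 hM; pose t := d / (2 * M); have t0 : 0 < t by rewrite divr_gt0 // mulr_gt0.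
  have := hd _ (Oq_scale_in t%:C hg); rewrite ext_zero subr0 (ext_scale _ hg) -nr_lt nrZ nr_real (gtr0_norm t0).
  move=> h; have {h} : t * nr (Phi g) < 1.
    apply: h => i; have [_ _ r0 _] := hK i.
    have -> : (fun n z => Oq_scale t%:C g n z - 0) = Oq_scale t%:C g.
      by apply/funext => n; apply/funext => z; rewrite subr0.
    apply: (le_lt_trans (qseminormZ _ r0 (hM i))).
    rewrite nr_real (gtr0_norm t0) lte_fin /t; have -> : d / (2 * M) * M = d / 2 by field; rewrite gt_eqF.
    by lra.
  have -> : 2 / d * M = t^-1 by rewrite /t invfM invrK; ring.
  by move=> h; rewrite -[leRHS]mulr1 mulrC ler_pdivlMr // mulrC ltW.
move=> g M hg M0 hM; have d2 : 0 < 2 / d by rewrite divr_gt0.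
apply/ler_addgt0Pr => e e0.
(* [M] may be 0, so it is replaced by a slightly larger bound, at a total cost of [e]. *)
have Me : 0 < M + e / (2 / d) by rewrite ltr_wpDl // divr_gt0.
have -> : 2 / d * M + e = 2 / d * (M + e / (2 / d)) by rewrite mulrDr mulrCA divff ?mulr1 // gt_eqF.
apply: pos => // i; apply: (le_trans (hM i)); by rewrite lee_fin lerDl divr_ge0 // ltW.
Qed.

(** The difference of [f] and [g] vanishes in every seminorm, whose compact sets lie in [U]; hence
    identities that hold only on [U] may be used under [Phi]. *)
Lemma ext_eq f g : Oq U ry f -> (forall n z, U z -> f n z = g n z) -> Phi f = Phi g.
Proof.
move=> hf fg; have hg := Oq_ext oU fg hf.
apply/eqP; rewrite -subr_eq0 -nr_eq0 eq_le nr_ge0 andbT -ext_sub //.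
have [m [Ks [rhos [c [hK c0 hc]]]]] := ext_bound.
rewrite -[leRHS](mulr0 c); apply: hc => // [|i]; first exact: Oq_sub_in.
have [_ KU r0 _] := hK i; apply/(qseminormP _ _ _ r0); exists (fun=> 0); split=> // [n z Kz|N].
  by rewrite fg ?subrr ?nr0 //; exact: KU.
by rewrite big1 // => n _; rewrite mul0r.
Qed.

Lemma ext_subl (l : C) : Phi (coef0 (fun z => l - z)) = l *: \1b - T.
Proof.
have hl : Oq U ry (Oq_scale l (@Oq_one R)) by exact: Oq_scale_in Oq_one_in.
have hx : Oq U ry (@Oq_x R) by exact: (@Oq_coef0 R U ry id (@hol_id R U)).
have -> : coef0 (fun z => l - z) = fun n z => Oq_scale l (@Oq_one R) n z - @Oq_x R n z.
  apply/funext => -[|n]; apply/funext => z; rewrite /coef0 /Oq_scale /Oq_one /Oq_x /= ?mulr1 //.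
  by rewrite mulr0 subrr.
by rewrite ext_sub // ext_scale ?ext_one ?ext_x //; exact: Oq_one_in.
Qed.

Lemma ext_coef0_mul f g : hol U f -> hol U g ->
  Phi (coef0 (fun z => f z * g z)) = Phi (coef0 f) *b Phi (coef0 g).
Proof.
move=> hf hg; rewrite -ext_mul; try exact: Oq_coef0.
congr Phi; rewrite Oq_mul_coef0; apply/funext => n; apply/funext => z.
by rewrite /coef0; case: ifP => _ //; rewrite mulr0.
Qed.

Lemma ext_spectrum_x : spectrum T `<=` U.
Proof.
move=> l; apply: contra_notP => nUl.
have h1 : hol U (fun z => l - z) by exact: hol_subl.
have zl z : U z -> l - z != 0 by move=> Uz; rewrite subr_eq0; apply: contra_notN nUl => /eqP ->.
have h2 : hol U (fun z => (l - z)^-1).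
  move=> z /zl lz; have lz' : z != l by rewrite eq_sym -subr_eq0.
  have h := cderivZ (cderiv_cst (-1 : C) z) (cderiv_subV lz').
  by eexists; apply: (@cderiv_ext _ _ _ _ _ _ 1) h => // w _; rewrite scaleN1r -invrN opprB.
(* At [z = l] the product is 0 and not 1, so the equality is available on [U] only. *)
have E : Phi (coef0 (fun z => (l - z) * (l - z)^-1)) = \1b.
  rewrite -ext_one; apply: ext_eq; first by apply: Oq_coef0; exact: holM.
  by move=> n z /zl lz; rewrite /coef0 /Oq_one; case: ifP => // _; rewrite divff.
exists (Phi (coef0 (fun z => (l - z)^-1))); rewrite -ext_subl; split.
  by rewrite -ext_coef0_mul.
by rewrite -ext_coef0_mul // -E; congr Phi; congr coef0; apply/funext => z; rewrite mulrC.
Qed.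

Lemma ext_spectrum_y : (0 < ry)%E -> spectrum S `<=` disc ry.
Proof.
move=> ry0 l; apply: contra_notP => nl.
have hg := Oq_geometric U nl; set g := (X in Oq _ _ X) in hg.
have l0 : l != 0.
  by apply: contra_notN nl => /eqP ->; rewrite /disc /= cabsE (@nr0 R C).
have hs := Oq_scale_in l hg.
(* The geometric series [g] moved up by one degree is [l g - 1]. Its coefficients are constants, so
   [y] produces it from either side. *)
have E : (fun n z => if n is m.+1 then l ^- m.+1 else 0) = fun (n : nat) (z : C) => Oq_scale l g n z - @Oq_one R n z.
  apply/funext => -[|n]; apply/funext => z; rewrite /Oq_scale /Oq_one /g /=.
    by rewrite expr1 divff ?subrr.
  by rewrite [l ^+ n.+2]exprS invfM mulrA divff ?mul1r ?subr0.
have SE : S *b Phi g = l *: Phi g - \1b.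
  rewrite -{1}ext_y -ext_mul //; last exact: Oq_y_in.
  by rewrite Oq_mul_y [X in Phi X]E ext_sub ?ext_scale ?ext_one //; exact: Oq_one_in.
have SE' : Phi g *b S = l *: Phi g - \1b.
  rewrite -{1}ext_y -ext_mul //; last exact: Oq_y_in.
  by rewrite Oq_mul_yr [X in Phi X]E ext_sub ?ext_scale ?ext_one //; exact: Oq_one_in.
exists (Phi g); rewrite bmulBl bmulBr bmulZl bmulZr bmul1l bmul1r SE SE'.
by split; rewrite opprB addrC subrK.
Qed.

(** On series concentrated in degree 0 each seminorm is a sup norm, so the union of the finitely
    many compact sets from [ext_bound] serves as the [K] of the rigidity principle. *)
Lemma ext_coef0 g : hol U g -> Phi (coef0 g) = holo_calc U T g.
Proof.
move=> hg; have sT := ext_spectrum_x.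
have [G [hG _ _]] := surrounds_exists oU sT (@compact0 _) (@sub0set _ U).
rewrite (holo_calcE oU hG hg).
have [m [Ks [rhos [c [hK c0 hc]]]]] := ext_bound.
pose K := \big[setU/set0]_(i < m) Ks i.
have cK : compact K by apply: bigsetU_compact => i _; have [] := hK i.
have KsK i : Ks i `<=` K.
  by rewrite /K (bigD1 i) //; left.
have KU : K `<=` U.
  by rewrite /K; elim/big_ind: _ => // [A A' hA hA'|i _]; [by move=> z [/hA|/hA']|have [] := hK i].
have := @functional_principle R B U K T (fun g => Phi (coef0 g)) c oU sT cK KU c0.
move=> /(_ _ _ _ _ G g hG hg) ->.
- have -> : coef0 (fun=> 1) = @Oq_one R by [].
  by rewrite ext_one bmul1r.
- move=> f h hf hh; rewrite -ext_add; try exact: Oq_coef0.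
  congr Phi; apply/funext => n; apply/funext => z; rewrite /coef0 /Oq_add; case: ifP => // _.
  by rewrite addr0.
- move=> a f hf; rewrite -ext_scale; last exact: Oq_coef0.
  congr Phi; apply/funext => n; apply/funext => z; rewrite /coef0 /Oq_scale; case: ifP => // _.
  by rewrite mulr0.
- move=> f M hf hM M0; apply: hc => // [|i]; first exact: Oq_coef0.
  have [_ _ r0 _] := hK i.
  have := @single_bound R (Ks i) (rhos i) f 0 M r0 M0; rewrite expr0 mulr1; apply=> z /KsK; exact: hM.
- move=> l h hh; rewrite ext_coef0_mul ?ext_subl //; exact: hol_subl.
Qed.

Lemma ext_ypow n : Phi (ypow n) = S ^b n.
Proof.
elim: n => [|n IH]; first by rewrite -[RHS]ext_one.
rewrite bexpS -IH -{1}ext_y -ext_mul; [|exact: Oq_y_in|exact: Oq_ypow].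
by rewrite Oq_mul_y; congr Phi; apply/funext => -[|m].
Qed.

Lemma ext_single g n : hol U g -> Phi (fun k z => if k == n then g z else 0) = holo_calc U T g *b S ^b n.
Proof.
move=> hg; rewrite -ext_coef0 // -ext_ypow -ext_mul; [|exact: Oq_coef0|exact: Oq_ypow].
rewrite Oq_mul_coef0; congr Phi; apply/funext => k; apply/funext => z; rewrite /ypow.
by case: ifP => _; rewrite ?mulr1 ?mulr0.
Qed.

Lemma ext_truncation f N : Oq U ry f ->
  Oq U ry (fun n z => if (n < N)%N then f n z else 0) /\
  Phi (fun n z => if (n < N)%N then f n z else 0) = \sum_(n < N) holo_calc U T (f n) *b S ^b n.
Proof.
move=> hf; elim: N => [|N [IH1 IH2]]; first by rewrite big_ord0; split; [exact: Oq_zero_in|exact: ext_zero].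
have E : (fun n z => if (n < N.+1)%N then f n z else 0) =
    Oq_add (fun n z => if (n < N)%N then f n z else 0) (fun n z => if n == N then f N z else 0).
  apply/funext => n; apply/funext => z; rewrite /Oq_add ltnS leq_eqVlt.
  by case: (eqVneq n N) => [->|_]; rewrite ?ltnn ?add0r ?addr0.
have hN : Oq U ry (fun n z => if n == N then f N z else 0) by apply: Oq_single; exact: Oq_hol hf N.
rewrite E; split; first exact: Oq_add_in.
by rewrite ext_add // IH2 big_ord_recr /= ext_single //; exact: Oq_hol hf N.
Qed.

(** Finitely many seminorms control [Phi], and the tails of [f] are small in each, so the values of
    the truncations converge to that of [f]. *)
Lemma ext_series f : Oq U ry f ->
  (fun N : nat => \sum_(n < N) holo_calc U T (f n) *b S ^b n) @ \oo --> Phi f.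
Proof.
move=> hf; apply/cvg_nrP => e e0.
have [m [Ks [rhos [c [hK c0 hc]]]]] := ext_bound.
have c1 : 0 < c + 1 by rewrite ltr_wpDl.
have d0 : 0 < e / (c + 1) by rewrite divr_gt0.
have /choice[N hN] : forall i, exists N0, forall N, (N0 <= N)%N ->
    (qseminorm (Ks i) (rhos i) (fun n z => if (n < N)%N then 0%R else f n z) <= (e / (c + 1))%:E)%E.
  by move=> i; exact: tail_small hf (hK i) d0.
exists (\max_(i < m) N i) => n hn; have [h1 <-] := ext_truncation n hf.
have h2 := Oq_tail n hf.
have -> : Phi f = Phi (fun k z => if (k < n)%N then f k z else 0) + Phi (fun k z => if (k < n)%N then 0 else f k z).
  rewrite -ext_add //; congr Phi; apply/funext => k; apply/funext => z; rewrite /Oq_add.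
  by case: ifP => _; rewrite ?addr0 ?add0r.
rewrite nrBC addrC addKr; apply: (@le_lt_trans _ _ (c * (e / (c + 1)))).
  apply: hc => //; first exact: ltW.
  by move=> i; apply: hN; apply: leq_trans hn; exact: leq_bigmax.
by rewrite mulrCA -[ltRHS]mulr1 ltr_pM2l // ltr_pdivrMr // mul1r; lra.
Qed.

End Extension.

(** * An extension built from a cycle and a power bound *)

Section Existence.
Variable R : realType.
Local Notation C := (R[i] : numFieldType).
Variable B : banachAlgType C.
Variables (q : C) (U : set C) (ry : \bar R) (T S : B) (G : seq (seq C)) (rho c1 c2 : R).
Hypotheses (oU : open U) (q0 : q != 0) (Uq : forall z, U z -> U (q * z)).
Hypothesis ST : S *b T = q *: (T *b S).
Hypotheses (hG : surrounds G U T) (rho0 : 0 < rho) (rhory : (rho%:E < ry)%E).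
Hypotheses (c10 : 0 <= c1) (c20 : 0 <= c2).
Hypothesis hc1 : forall f (M : R), hol U f -> (forall z, cycle_trace G z -> nr (f z) <= M) -> nr (calc T G f) <= c1 * M.
Hypothesis hc2 : forall n, nr (S ^b n) <= c2 * rho ^+ n.

Definition series_map (f : nat -> C -> C) : B := lim ((fun N => \sum_(n < N) calc T G (f n) *b S ^b n) @ \oo).

Lemma trace_index : seminorm_index U ry (cycle_trace G) rho.
Proof. by split=> //; [exact: compact_trace|have [GU _ _] := hG; move=> z /GU[]]. Qed.

(** The bound [c1 * w n] of the calculus on the trace meets the bound [c2 * rho ^+ n] of the powers;
    their product is a term of a single seminorm. *)
Lemma series_terms f (M : R) : Oq U ry f -> (qseminorm (cycle_trace G) rho f <= M%:E)%E ->
  exists u : nat -> R, (forall n, nr (calc T G (f n) *b S ^b n) <= u n) /\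
    forall N, \sum_(n < N) u n <= c1 * c2 * M.
Proof.
move=> hf /(qseminormP _ _ _ rho0)[w [w0 hw wM]].
exists (fun n => c1 * c2 * (w n * rho ^+ n)); split=> [n|N]; last by rewrite -mulr_sumr ler_wpM2l // mulr_ge0.
apply: (le_trans (nr_bmul _ _)); rewrite mulrACA; apply: ler_pM; rewrite ?nr_ge0 //.
by apply: hc1; [exact: Oq_hol hf n|exact: hw].
Qed.

Lemma series_map_cvg f : Oq U ry f ->
  (fun N => \sum_(n < N) calc T G (f n) *b S ^b n) @ \oo --> series_map f.
Proof.
move=> hf; have [M M0 fM] := Oq_bound hf trace_index; have [u [hu uM]] := series_terms hf fM.
have [l [hl _ _]] := dominated_sums (@banach_complete R B) hu uM.
by rewrite /series_map (cvg_lim (@norm_hausdorff _ _) hl).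
Qed.

Lemma series_map_bound f (M : R) : Oq U ry f -> (qseminorm (cycle_trace G) rho f <= M%:E)%E ->
  nr (series_map f) <= c1 * c2 * M.
Proof.
move=> hf fM; have [u [hu uM]] := series_terms hf fM.
have [l [hl lM _]] := dominated_sums (@banach_complete R B) hu uM.
by rewrite /series_map (cvg_lim (@norm_hausdorff _ _) hl).
Qed.

Lemma series_mapE (f : nat -> C -> C) (v : B) : (fun N : nat => \sum_(n < N) calc T G (f n) *b S ^b n) @ \oo --> v -> series_map f = v.
Proof. by move=> h; rewrite /series_map (cvg_lim (@norm_hausdorff _ _) h). Qed.

Lemma series_map_add f g : Oq U ry f -> Oq U ry g ->
  series_map (Oq_add f g) = series_map f + series_map g.
Proof.
move=> hf hg; apply: series_mapE.
have -> : (fun N => \sum_(n < N) calc T G (Oq_add f g n) *b S ^b n) =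
  fun N => \sum_(n < N) calc T G (f n) *b S ^b n + \sum_(n < N) calc T G (g n) *b S ^b n.
  apply/funext => N; rewrite -big_split /=; apply: eq_bigr => n _.
  by rewrite -bmulDl -(calcD hG (Oq_hol hf n) (Oq_hol hg n)).
by apply: cvgD; exact: series_map_cvg.
Qed.

Lemma series_map_scale c f : Oq U ry f -> series_map (Oq_scale c f) = c *: series_map f.
Proof.
move=> hf; apply: series_mapE.
have -> : (fun N => \sum_(n < N) calc T G (Oq_scale c f n) *b S ^b n) =
  fun N => c *: \sum_(n < N) calc T G (f n) *b S ^b n.
  apply/funext => N; rewrite scaler_sumr; apply: eq_bigr => n _.
  by rewrite -bmulZl -(calcZ _ hG (Oq_hol hf n)).
by apply: cvgZr; exact: series_map_cvg.
Qed.

Lemma series_map_mul f g : Oq U ry f -> Oq U ry g ->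
  series_map (Oq_mul q f g) = series_map f *b series_map g.
Proof.
move=> hf hg; apply: series_mapE.
have Uqi i z : U z -> U (q ^+ i * z).
  by elim: i => [|i IH] Uz; rewrite ?expr0 ?mul1r // exprS -mulrA; exact/Uq/IH.
have -> : (fun N => \sum_(n < N) calc T G (Oq_mul q f g n) *b S ^b n) =
  fun N => \sum_(n < N) \sum_(i < n.+1) (calc T G (f i) *b S ^b i) *b (calc T G (g (n - i)%N) *b S ^b (n - i)).
  apply/funext => N; apply: eq_bigr => n _.
  have hh (i : 'I_n.+1) : hol U (fun z => f i z * g (n - i)%N (q ^+ i * z)).
    apply: holM; first exact: Oq_hol hf i.
    by apply: hol_scale; [exact: Uqi|exact: Oq_hol hg _].
  rewrite (calc_sum _ hG hh) bmul_suml; apply: eq_bigr => i _.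
  have hgi := hol_scale (Uqi i) (Oq_hol hg (n - i)%N).
  rewrite (calcM oU hG (Oq_hol hf i) hgi) -!bmulA; congr (_ *b _); rewrite [RHS]bmulA.
  (* Moving [S ^b i] to the right past the calculus of [g] replaces [z] by [q ^+ i * z], which is
     the twist in [Oq_mul]. *)
  rewrite (calc_commuteX i q0 oU Uq ST hG (Oq_hol hg _)) -bmulA -bexp_addn subnKC //.
  by rewrite -ltnS.
have [M M0 fM] := Oq_bound hf trace_index; have [u [hu uM]] := series_terms hf fM.
have [N N0 gN] := Oq_bound hg trace_index; have [v [hv vN]] := series_terms hg gN.
by apply: (cauchy_product hu uM hv vN); exact: series_map_cvg.
Qed.

Lemma series_map_finite f n : (forall k, (n <= k)%N -> f k = fun=> 0) ->
  series_map f = \sum_(k < n) calc T G (f k) *b S ^b k.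
Proof.
move=> hf; apply: series_mapE; apply/cvg_nrP => e e0; exists n => N nN.
have c00 : calc T G (fun=> 0) = 0.
  have := calcZ 0 hG (@hol_cst R U 1); rewrite scale0r => <-.
  by congr calc; apply/funext => z; rewrite mul0r.
rewrite (sums_split (fun k => calc T G (f k) *b S ^b k) nN) big_nat big1 ?nr0 // => k /andP[nk _].
by rewrite hf // c00 bmul0l.
Qed.

Lemma series_map_extension : Oq_extension q U ry T S series_map.
Proof.
split; [|exact: series_map_add|by move=> *; exact: series_map_scale|exact: series_map_mul|].
(* By linearity the bound in one seminorm gives continuity at every [f]; [c] exceeds the bound by 1
   to make the inequality strict. *)
- move=> f hf eps e0; pose c := c1 * c2 + 1; have cp : 0 < c by rewrite ltr_wpDl // mulr_ge0.
  exists 1%N, (fun=> cycle_trace G), (fun=> rho), (eps / c); split=> [_||g hg hs].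
  + exact: trace_index.
  + by rewrite divr_gt0.
  rewrite -nr_lt.
  have E : series_map g - series_map f = series_map (fun n z => g n z - f n z).
    have -> : (fun n z => g n z - f n z) = Oq_add g (Oq_scale (-1) f).
      by apply/funext => n; apply/funext => z; rewrite /Oq_add /Oq_scale mulN1r.
    by rewrite series_map_add ?series_map_scale ?scaleN1r //; exact: Oq_scale_in.
  rewrite E; apply: (le_lt_trans (series_map_bound (Oq_sub_in hg hf) (ltW (hs ord0)))).
  by rewrite mulrCA -[ltRHS]mulr1 ltr_pM2l // ltr_pdivrMr // mul1r ltrDl ltr01.
- split.
  + rewrite (@series_map_finite _ 1) => [|[|k] //]; rewrite big_ord1 bmul1r; exact: (calc1 hG).
  + rewrite (@series_map_finite _ 1) => [|[|k] //]; rewrite big_ord1 bmul1r; exact: (calc_id oU hG).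
  + rewrite (@series_map_finite _ 2) => [|[|[|k]] //]; rewrite !big_ord_recl big_ord0 /= addr0.
    rewrite !bmul1r.
    have -> : calc T G (@Oq_y R 0) = 0.
      have := calcZ 0 hG (@hol_cst R U 1); rewrite scale0r => <-.
      by congr calc; apply/funext => z; rewrite mul0r.
    by rewrite add0r [calc _ _ _](calc1 hG) bmul1l.
Qed.

End Existence.

(** * The spectral criterion and the series formula *)

Theorem theorem5p2 (R : realType) (q : R[i]) (B : banachAlgType (R[i] : numFieldType))
    (T S : B) (Ux : set R[i]) (ry : \bar R) :
  0 < `|q| < 1 ->
  T *b S = q^-1 *: (S *b T) ->
  q_open q Ux -> (0 < ry)%E ->
  ((exists Phi : (nat -> R[i] -> R[i]) -> B, Oq_extension q Ux ry T S Phi) <->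
     (spectrum T `<=` Ux /\ spectrum S `<=` disc ry)) /\
  (spectrum T `<=` Ux -> spectrum S `<=` disc ry ->
   forall Phi : (nat -> R[i] -> R[i]) -> B, Oq_extension q Ux ry T S Phi ->
   forall f, Oq Ux ry f ->
     (fun N : nat => \sum_(n < N) holo_calc Ux T (f n) *b S ^b n) @ \oo --> Phi f).
Proof.
move=> /andP[]; rewrite normr_gt0 => q0 _ TS [oU _ Uq] ry0.
split; last by move=> _ _ Phi hPhi f; exact: (ext_series oU hPhi).
split=> [[Phi hPhi]|[sT sS]].
  by split; [exact: (ext_spectrum_x oU hPhi)|exact: (ext_spectrum_y hPhi ry0)].
have ST : S *b T = q *: (T *b S) by rewrite TS scalerA divff // scale1r.
have Uq1 z : Ux z -> Ux (q * z) by move=> /(Uq _ 1%N); rewrite expr1.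
have [G [hG _ _]] := surrounds_exists oU sT (@compact0 _) (@sub0set _ Ux).
have [rho [c2 [rho0 rhory c20 hc2]]] := power_bound ry0 sS.
have [c1 c10 hc1] := calc_bound hG.
exists (series_map T S G); exact: (series_map_extension oU q0 Uq1 ST hG rho0 rhory c10 c20 hc1 hc2).
Qed.
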